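(* Let $0<E<2$ and $p\ge2$. There exist constants $\delta,C_\star>0$ depending only on $(E,p)$ such that the following holds. Let $(N_\star,v_\star)$ and $(N,v)$ be pairs of random variables with $N_\star,N\in\mathbb N$, $v_\star,v\in\mathbb H\cup\mathbb R$, $\mathbb E N_\star=d_\star$, $\mathbb E N=d$ and $\mathbb P(N_\star\ge1)=\mathbb P(N\ge1)=1$, and assume that either $v$ is real-valued or $\mathbb E N^{2p}<\infty$. Put $\rho=d_\star/d$, and for $\lambda\in(0,1)$ let $$\mathcal E_\lambda=\left\{|v|<\lambda,\ N\ge2,\ \tfrac Nd\in(1-\lambda,1+\lambda)\right\},\qquad \alpha_p(\lambda)=\mathbb E\left[\mathbf 1_{\mathcal E_\lambda^c}(1+|v|)^{2p}\left(\tfrac Nd+\tfrac dN\right)^p\right],$$ $$\mathcal F_\lambda=\left\{\tfrac{|v_\star|}{\rho}<\lambda,\ \tfrac{N_\star}{d_\star}\in(1-\lambda,1+\lambda)\right\},\qquad \beta_p(\lambda)=\mathbb E\left[\mathbf 1_{\mathcal F_\lambda^c}\left(1+\left|\tfrac{v_\star}{\rho}\right|\right)^{2p}\left(\tfrac{N_\star}{d_\star}+\tfrac{d_\star}{N_\star}\right)^p\right],$$ $$\varepsilon(\lambda)=\big(1+\lambda+\alpha_p(\lambda)\big)\big(1+\lambda+\beta_p(\lambda)\big)-1.$$ If $\lambda+\alpha_p(\lambda)\le\delta$, then for every $z\in\mathbb H_E$ and all $\mathbb H$-valued random variables $g_o(z),g(z)$ satisfying the equations in distribution $$g_o(z)\stackrel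 d=-\Big(z+\frac1d\sum_{i=1}^{N_\star}g_i(z)+v_\star\Big)^{-1},\qquad g(z)\stackrel d=-\Big(z+\frac1d\sum_{i=1}^{N}g_i(z)+v\Big)^{-1},$$ where $(g_i(z))_{i\ge1}$ are i.i.d. copies of $g(z)$, independent of $(N_\star,v_\star)$ in the first equation and of $(N,v)$ in the second, one has $$\mathbb E\left[|g_o(z)-\Gamma_\star(z)|^p\right]\le C_\star\rho^{-p}\max\left\{\varepsilon(\lambda),\sqrt{\varepsilon(\lambda)}\right\},$$ $$\mathbb E\left[(\Im g_o(z))^{-p}\right]\le C_\star\left(1+\beta_p(\lambda)\right)^p\left(\rho+\frac1\rho\right)^p.$$
   Context: $\mathbb N=\{0,1,\dots\}$, $\mathbb H=\{z\in\mathbb C:\Im z>0\}$, $\mathbb H_E=\{z\in\mathbb H:\Re z\in(-E,E),\ \Im z\le1\}$. $\Gamma(z)=\int\frac{d\mu_{sc}(x)}{x-z}$ is the Cauchy–Stieltjes transform of the semicircle law $\mu_{sc}=\frac1{2\pi}\mathbf 1_{\{|x|\le2\}}\sqrt{4-x^2}\,dx$, which satisfies $\Gamma(z)=-(z+\Gamma(z))^{-1}$ for $z\in\mathbb H$. $\Gamma_\star(z)=-(z+\rho\,\Gamma(z))^{-1}$ (the Cauchy–Stieltjes transform of the modified Kesten–McKay distribution with ratio $\rho$). Within each pair, $N$ and $v$ (respectively $N_\star$ and $v_\star$) need not be independent. $\alpha_p(\lambda)$ and $\beta_p(\lambda)$ may be infinite; when $\beta_p(\lambda)=\infty$ the bounds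 are void. *)

(* Defs.v *)
(* MathComp-Analysis, with the complex numbers R[i] of mathcomp-real-closed. *)
From HB Require Import structures.
From mathcomp Require Import all_boot all_order all_algebra.
From mathcomp Require Import all_classical all_reals all_analysis.
From mathcomp Require Import complex.

Set Implicit Arguments.
Unset Strict Implicit.
Unset Printing Implicit Defensive.

Import Order.TTheory GRing.Theory Num.Theory.
Import numFieldNormedType.Exports.

Local Open Scope classical_set_scope.
Local Open Scope ring_scope.
Local Open Scope complex_scope.

Notation normc := Normc.normc.

(* R[i] carries no sigma-algebra in the libraries: it is given the Borel
   sigma-algebra of R * R, transported along z |-> (Re z, Im z).             *)
Definition reim {R : realType} (z : R[i]) : R * R :=
  (complex.Re z, complex.Im z).

Section complex_measurable.
Context {R : realType}.

Let mC : set (set R[i]) := preimage_set_system setT (@reim R) measurable.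

Let sigma_mC : sigma_algebra setT mC.
Proof. exact/sigma_algebra_preimage/sigma_algebra_measurable. Qed.

Let mC0 : mC set0. Proof. by have [] := sigma_mC. Qed.

Let mC_C A : mC A -> mC (~` A).
Proof. by move=> mA; rewrite -setTD; case: sigma_mC => _ + _; exact. Qed.

Let mC_bigcup (F : (set R[i])^nat) :
  (forall i, mC (F i)) -> mC (\bigcup_i F i).
Proof. by case: sigma_mC => _ _; exact. Qed.

HB.instance Definition _ := isPointed.Build R[i] 0.
HB.instance Definition _ := @isMeasurable.Build default_measure_display R[i]
  mC mC0 mC_C mC_bigcup.

End complex_measurable.

Definition eq_law {R : realType} {d1 d2 d : measure_display}
    {T1 : measurableType d1} {T2 : measurableType d2} {S : measurableType d}
    (P1 : probability T1 R) (X1 : T1 -> S)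
    (P2 : probability T2 R) (X2 : T2 -> S) : Prop :=
  forall A : set S, measurable A -> P1 (X1 @^-1` A) = P2 (X2 @^-1` A).

(* Mutual independence of the variables (N, v), x 0, x 1, ...; the sub-families
   omitting some of these variables are covered by taking full events.        *)
Definition indep_seq {R : realType} {dT : measure_display}
    {T : measurableType dT} (P : probability T R)
    (N : T -> nat) (v : T -> R[i]) (x : nat -> T -> R[i]) : Prop :=
  forall (n : nat) (A : set (nat * R[i])) (B : nat -> set R[i]),
    measurable A -> (forall i, measurable (B i)) ->
    P ([set w | A (N w, v w)] `&` [set w | forall i, (i < n)%N -> B i (x i w)])
    = (P [set w | A (N w, v w)] * \prod_(i < n) P (x i @^-1` B i))%E.

Definition resolvent_map {R : realType} (z : R[i]) (d : R) (n : nat)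
    (u : R[i]) (x : nat -> R[i]) : R[i] :=
  - (z + (d^-1)%:C * \sum_(i < n) x i + u)^-1.

(* h =(law)= - (z + d^-1 * (g_1 + ... + g_N) + v)^-1, where g_1, g_2, ... are
   i.i.d. copies of g, independent of (N, v). The right-hand side is realized
   on an auxiliary probability space carrying a copy (N', v') of (N, v); its
   law does not depend on the chosen realization.                             *)
Definition recursion_law {R : realType} {dN dh dg : measure_display}
    {TN : measurableType dN} {Th : measurableType dh} {Tg : measurableType dg}
    (z : R[i]) (d : R)
    (PN : probability TN R) (N : TN -> nat) (v : TN -> R[i])
    (Pg : probability Tg R) (g : Tg -> R[i])
    (Ph : probability Th R) (h : Th -> R[i]) : Prop :=
  exists (dT : measure_display) (T : measurableType dT) (P : probability T R)
         (N' : {RV P >-> nat}) (v' : {RV P >-> R[i]})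
         (x : nat -> {RV P >-> R[i]}),
    [/\ eq_law P (fun w => (N' w, v' w)) PN (fun w => (N w, v w)),
        forall i : nat, eq_law P (x i) Pg g,
        indep_seq P N' v' (fun i => x i : T -> R[i]) &
        eq_law Ph h P (fun w => resolvent_map z d (N' w) (v' w) (x ^~ w))].

Definition semicircle_pdf {R : realType} (x : R) : R :=
  (2 * pi)^-1 * \1_[set y : R | `|y| <= 2] x * Num.sqrt (4 - x ^+ 2).

Definition complex_integral {R : realType} (f : R -> R[i]) : R[i] :=
  (\int[lebesgue_measure]_x complex.Re (f x)) +i*
  (\int[lebesgue_measure]_x complex.Im (f x)).

Definition Gamma {R : realType} (z : R[i]) : R[i] :=
  complex_integral (fun x : R => (semicircle_pdf x)%:C / (x%:C - z)).

Definition Gamma_star {R : realType} (rho : R) (z : R[i]) : R[i] :=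
  - (z + rho%:C * Gamma z)^-1.

Definition upper_half_plane {R : realType} : set R[i] :=
  [set z | 0 < complex.Im z].

Definition half_strip {R : realType} (E : R) : set R[i] :=
  [set z | upper_half_plane z /\ (- E < complex.Re z < E) /\ complex.Im z <= 1].

Section errors.
Context {R : realType} {dT : measure_display} {T : measurableType dT}.
Variables (P : probability T R) (N : T -> nat) (v : T -> R[i]).

Definition event_E (d lambda : R) : set T :=
  [set w | [/\ normc (v w) < lambda, (2 <= N w)%N
             & 1 - lambda < (N w)%:R / d < 1 + lambda]].

Definition alpha (p d lambda : R) : \bar R :=
  'E_P[fun w => \1_(~` event_E d lambda) w *
                (1 + normc (v w)) `^ (2 * p) *
                ((N w)%:R / d + d / (N w)%:R) `^ p].

Definition event_F (rho d lambda : R) : set T :=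
  [set w | normc (v w) / rho < lambda /\
           1 - lambda < (N w)%:R / d < 1 + lambda].

Definition beta (p rho d lambda : R) : \bar R :=
  'E_P[fun w => \1_(~` event_F rho d lambda) w *
                (1 + normc (v w / rho%:C)) `^ (2 * p) *
                ((N w)%:R / d + d / (N w)%:R) `^ p].

End errors.

Definition eps {R : realType} (lambda : R) (a b : \bar R) : \bar R :=
  ((1 + lambda%:E + a) * (1 + lambda%:E + b) - 1)%E.

(* Main.v *)
(* The distance to the fixed point G = Gamma z is measured by
   hyp g h = |g - h|^2 / (Im g * Im h), an increasing function of the hyperbolic
   distance. The map g |-> -1/(z + g) does not increase hyp, and hyp(., G) is
   convex. Write A_q for the q-th moment of hyp(g, G) and eta for
   lambda + alpha.
   - A_p is finite, since resolvents at z lie in the disk |y|^2 Im z <= Im y.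
   - A_2 = O(eta): comparing the second moments of both sides of the equation in
     law, Jensen's inequality is saturated up to O(eta (1 + A_2)). If A_2 were
     much larger than eta, independent copies of g would nearly share one value
     of hyp(., G) and one slope (g - G)/Im g, and so would the resolvent of
     their average. But the resolvent step multiplies slopes by a positive
     multiple of G g', which is not positive since |Re G| <= (E/2)|G|.
   - A_p = O(eta): in E hyp^p, two distinct copies are averaged; comparable pairs
     are controlled by A_2 and A_{p-2}, the others contract by 3/4.
   - One more step gives the p-th moment of hyp(g_o, Gamma_star) in terms of A_p
     and beta, whence both bounds. *)
Require Import Defs.
From HB Require Import structures.
From mathcomp Require Import all_boot all_order all_algebra.
From mathcomp Require Import all_classical all_reals all_analysis.
From mathcomp Require Import complex.
From mathcomp Require Import measurable_realfun ring lra.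

Set Implicit Arguments.
Unset Strict Implicit.
Unset Printing Implicit Defensive.

Import Order.TTheory GRing.Theory Num.Theory.
Import numFieldNormedType.Exports.

Local Open Scope classical_set_scope.
Local Open Scope ring_scope.
Local Open Scope complex_scope.

(** The difficulty is uniformity as [Im z] tends to 0: the only strict contraction supplied by the
    map itself, the shift by [Im z], disappears there. The gain must come from averaging at least
    two copies, and averaging gains nothing when the copies share one slope; excluding that case is
    a rigidity statement about the resolvent step, which uses [|Re z| < E < 2]. Exponent 2 is
    treated first because the loss in Jensen's inequality for the square of [hyp] has an explicit
    lower bound in terms of values and slopes. A step on the good event costs a factor
    [1 + O(lambda)] and a term [O(lambda)]; off it, the cost is, up to a constant, the weight
    integrated in [alpha] and [beta]. The square root of epsilon appears only at the end:
    [|g - s|^2 = hyp g s * Im g * Im s] is of first order in [hyp] near [s], so the p-th power of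
    the modulus brings in the power [p / 2] of [hyp]. *)

Notation Re := complex.Re.
Notation Im := complex.Im.

(** * The hyperbolic distance *)

Section hyp.
Context {R : realType}.
Implicit Types g h s t z : R[i].

Definition normsq z : R := Re z ^+ 2 + Im z ^+ 2.

Definition hyp g h : R := normsq (g - h) / (Im g * Im h).

Lemma normc_sq z : normc z ^+ 2 = normsq z.
Proof. by case: z => a b; rewrite /= sqr_sqrtr // addr_ge0 // sqr_ge0. Qed.

Lemma normsqN z : normsq (- z) = normsq z.
Proof. by case: z => a b; rewrite /normsq /= !sqrrN. Qed.

Lemma normsq_ge0 z : 0 <= normsq z.
Proof. by rewrite addr_ge0 // sqr_ge0. Qed.

Lemma normsqM g h : normsq (g * h) = normsq g * normsq h.
Proof. by case: g => a b; case: h => c d; rewrite /normsq /=; ring. Qed.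

Lemma normsq_gt0 z : 0 < Im z -> 0 < normsq z.
Proof. by move=> z0; rewrite ltr_wpDl ?sqr_ge0 // exprn_gt0. Qed.

Lemma hyp_ge0 g h : 0 < Im g -> 0 < Im h -> 0 <= hyp g h.
Proof. by move=> g0 h0; rewrite divr_ge0 ?normsq_ge0 // mulr_ge0 // ltW. Qed.

Lemma Im_opp_inv s : Im (- s^-1) = Im s / normsq s.
Proof. by case: s => a b; rewrite /normsq /= opprK. Qed.

Lemma Re_opp_inv s : Re (- s^-1) = - (Re s / normsq s).
Proof. by case: s => a b; rewrite /normsq /=. Qed.

Lemma Im_opp_inv_gt0 s : 0 < Im s -> 0 < Im (- s^-1).
Proof. by move=> s0; rewrite Im_opp_inv divr_gt0 // normsq_gt0. Qed.

Lemma ImD g h : Im (g + h) = Im g + Im h.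
Proof. by case: g => a b; case: h => c d. Qed.

Lemma ReD g h : Re (g + h) = Re g + Re h.
Proof. by case: g => a b; case: h => c d. Qed.

Lemma ImCM (r : R) h : Im (r%:C * h) = r * Im h.
Proof. by case: h => c d /=; rewrite mul0r addr0. Qed.

Lemma ReCM (r : R) h : Re (r%:C * h) = r * Re h.
Proof. by case: h => c d /=; rewrite mul0r subr0. Qed.

Lemma normsq_opp_inv s : 0 < Im s -> normsq (- s^-1) = (normsq s)^-1.
Proof.
move=> s0; have n0 := normsq_gt0 s0.
have n1 : normsq s != 0 by rewrite gt_eqF.
rewrite {1}/normsq Im_opp_inv Re_opp_inv.
have -> : (- (Re s / normsq s)) ^+ 2 + (Im s / normsq s) ^+ 2
   = (Re s ^+ 2 + Im s ^+ 2) / normsq s ^+ 2 by field.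
by rewrite -/(normsq s); field.
Qed.

(** Inversion is an isometry of the half plane: the difference picks up the factor
    [(- s^-1) * (- t^-1)], whose squared modulus is cancelled by the two imaginary parts. *)
Lemma hyp_opp_inv s t : 0 < Im s -> 0 < Im t ->
  hyp (- s^-1) (- t^-1) = hyp s t.
Proof.
move=> s0 t0; have ns0 := normsq_gt0 s0; have nt0 := normsq_gt0 t0.
rewrite /hyp !Im_opp_inv.
have sE : s != 0 by apply: contraTneq s0 => ->; rewrite ltxx.
have tE : t != 0 by apply: contraTneq t0 => ->; rewrite ltxx.
have -> : - s^-1 - - t^-1 = (s - t) * ((- s^-1) * (- t^-1)).
  by field; rewrite sE tE.
rewrite !normsqM !normsq_opp_inv //.
by field; rewrite !gt_eqF.
Qed.

Lemma hyp_shift z s t : 0 <= Im z -> 0 < Im s -> 0 < Im t ->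
  hyp (z + s) (z + t) <= hyp s t.
Proof.
move=> z0 s0 t0; rewrite /hyp.
have -> : z + s - (z + t) = s - t by ring.
rewrite ler_wpM2l ?normsq_ge0 // lef_pV2 ?posrE ?mulr_gt0 // !ImD ?ltr_wpDl //.
rewrite ?ltr_wpDl ?mulr_gt0 ?ltr_wpDl //; apply: ler_pM; rewrite ?(ltW s0) ?(ltW t0) ?lerDr //.
Qed.

Lemma hyp_scale (r : R) s t : 0 < r -> 0 < Im s -> 0 < Im t ->
  hyp (r%:C * s) (r%:C * t) = hyp s t.
Proof.
move=> r0 s0 t0; rewrite /hyp -mulrBr normsqM !ImCM.
have -> : normsq r%:C = r ^+ 2 by rewrite /normsq /= expr0n addr0.
by field; rewrite !gt_eqF.
Qed.

(** The vertical part of [hyp] alone is [Im g / Im h + Im h / Im g - 2]. Hence [hyp] controls both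
    [Im g] and its inverse, which is what both bounds of the theorem rest on. *)
Lemma Im_ratio_le g h : 0 < Im g -> 0 < Im h ->
  Im g / Im h + Im h / Im g <= hyp g h + 2.
Proof.
case: g => a b; case: h => c d /= b0 d0; rewrite /hyp /normsq /=.
have -> : b / d + d / b = (b - d) ^+ 2 / (b * d) + 2.
  by field; rewrite !gt_eqF.
rewrite lerD2r ler_wpM2r ?invr_ge0 ?mulr_ge0 ?(ltW b0) ?(ltW d0) //.
by rewrite lerDr sqr_ge0.
Qed.

Lemma Im_le_hyp g h : 0 < Im g -> 0 < Im h -> Im g <= Im h * (hyp g h + 2).
Proof.
move=> g0 h0; rewrite mulrC -ler_pdivrMr //.
by apply: le_trans (Im_ratio_le g0 h0); rewrite lerDl divr_ge0 // ltW.
Qed.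

Lemma inv_Im_le_hyp g h : 0 < Im g -> 0 < Im h -> (Im g)^-1 <= (hyp g h + 2) / Im h.
Proof.
move=> g0 h0; rewrite ler_pdivlMr // mulrC.
by apply: le_trans (Im_ratio_le g0 h0); rewrite lerDr divr_ge0 // ltW.
Qed.

Lemma normsq_eq g h : 0 < Im g -> 0 < Im h ->
  normsq (g - h) = hyp g h * (Im g * Im h).
Proof. by move=> g0 h0; rewrite /hyp divfK // mulf_neq0 // gt_eqF. Qed.

(** Young's inequality with a free weight: [hyp_perturb] needs a leading factor that tends to 1,
    which the choice [e = 1] would lose. *)
Lemma normsqD_le (e : R) g h : 0 < e ->
  normsq (g + h) <= (1 + e) * normsq g + (1 + e^-1) * normsq h.
Proof.
move=> e0; case: g => a b; case: h => c d; rewrite /normsq /=.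
have H (x y : R) : (x + y) ^+ 2 <= (1 + e) * x ^+ 2 + (1 + e^-1) * y ^+ 2.
  rewrite -subr_ge0.
  have -> : (1 + e) * x ^+ 2 + (1 + e^-1) * y ^+ 2 - (x + y) ^+ 2
    = e * (x - y / e) ^+ 2 by field; rewrite gt_eqF.
  by rewrite mulr_ge0 ?sqr_ge0 // ltW.
by have := H a c; have := H b d; lra.
Qed.

End hyp.

(** * Perturbing the argument of the resolvent *)

Section perturbation.
Context {R : realType}.
Implicit Types (g h v G : R[i]) (c r lam : R).

Lemma normc_ge0 g : 0 <= normc g.
Proof. by case: g => a b; exact: sqrtr_ge0. Qed.

Lemma normsqZ r g : normsq (r%:C * g) = r ^+ 2 * normsq g.
Proof. by rewrite normsqM /normsq /= expr0n addr0. Qed.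

Lemma normsq_le g (m : R) : normc g <= m -> normsq g <= m ^+ 2.
Proof.
move=> gm; rewrite -normc_sq ler_sqr ?nnegrE ?normc_ge0 //.
exact: (le_trans (normc_ge0 g) gm).
Qed.

Lemma normsqD2 g h : normsq (g + h) <= 2 * normsq g + 2 * normsq h.
Proof. by have := @normsqD_le _ 1 g h ltr01; rewrite invr1. Qed.

Lemma hyp_scale_add_le r v G h : 0 < r -> 0 <= Im v -> 0 < Im h -> 0 < Im G ->
  hyp (r%:C * h + v) G <= normsq (r%:C * h + v - G) / (r * Im h * Im G).
Proof.
move=> r0 v0 h0 G0; rewrite /hyp ler_wpM2l ?normsq_ge0 // lef_pV2 ?posrE ?mulr_gt0 //.
  by rewrite ler_wpM2r ?(ltW G0) // ImD ImCM lerDl.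
by rewrite ImD ImCM ltr_wpDr ?mulr_gt0.
Qed.

Lemma inv_Im_mul_le c G h : 0 < c -> c <= Im G -> 0 < Im h ->
  (Im h)^-1 / Im G <= (hyp h G + 2) / c ^+ 2.
Proof.
move=> c0 cG h0; have G0 := lt_le_trans c0 cG; rewrite expr2 invfM mulrA.
have ic : (Im G)^-1 <= c^-1 by rewrite lef_pV2.
apply: ler_pM => //; rewrite ?invr_ge0 ?(ltW h0) ?(ltW G0) //.
by apply: (le_trans (inv_Im_le_hyp h0 G0)); rewrite ler_wpM2l // addr_ge0 ?hyp_ge0.
Qed.

(** Here [r%:C * h + v - G = r%:C * (h - G) + e] with [normsq e <= 4 * lam ^+ 2]. Splitting the
    square with weight [lam] keeps the leading factor at [1 + O(lam)], while the error costs only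
    [(1 + lam^-1) * lam ^+ 2 = O(lam)]; dividing it by [Im h] is paid for by [hyp h G + 2]. *)
Lemma hyp_perturb c lam r v G h :
  0 < c -> c <= Im G -> normsq G <= 1 -> 0 < lam <= 1 / 2 ->
  1 - lam < r < 1 + lam -> normsq v <= lam ^+ 2 -> 0 <= Im v -> 0 < Im h ->
  hyp (r%:C * h + v) G <= (1 + (3 + 32 / c ^+ 2) * lam) * hyp h G
                          + (32 / c ^+ 2) * lam.
Proof.
move=> c0 cG G1 /andP[l0 l1] /andP[r1 r2] vl v0 h0.
have G0 : 0 < Im G by apply: lt_le_trans cG.
have r0 : 0 < r by lra.
set e := (r - 1)%:C * G + v.
have eE : r%:C * h + v - G = r%:C * (h - G) + e.
  by rewrite /e rmorphB /= rmorph1; ring.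
have e4 : normsq e <= 4 * lam ^+ 2.
  apply: (le_trans (normsqD2 _ _)); rewrite normsqZ.
  have : (r - 1) ^+ 2 <= lam ^+ 2 by nra.
  by have := normsq_ge0 G; nra.
have num : normsq (r%:C * h + v - G) <=
    (1 + lam) * r ^+ 2 * normsq (h - G) + 8 * lam.
  rewrite eE; apply: (le_trans (@normsqD_le _ lam _ _ l0)).
  rewrite normsqZ mulrA lerD2l.
  have : (1 + lam^-1) * normsq e <= (1 + lam^-1) * (4 * lam ^+ 2).
    by rewrite ler_wpM2l // addr_ge0 // invr_ge0 ltW.
  move/le_trans; apply.
  have -> : (1 + lam^-1) * (4 * lam ^+ 2) = 4 * lam ^+ 2 + 4 * lam.
    by field; rewrite gt_eqF.
  by nra.
apply: (le_trans (hyp_scale_add_le r0 v0 h0 G0)).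
have den0 : 0 < r * Im h * Im G by rewrite !mulr_gt0.
apply: (@le_trans _ _ (((1 + lam) * r ^+ 2 * normsq (h - G) + 8 * lam) / (r * Im h * Im G))).
  by rewrite ler_wpM2r // invr_ge0 ltW.
have -> : ((1 + lam) * r ^+ 2 * normsq (h - G) + 8 * lam) / (r * Im h * Im G)
   = (1 + lam) * r * hyp h G + 8 * lam / r * ((Im h)^-1 / Im G).
  by rewrite /hyp; field; rewrite !gt_eqF.
have X0 : 0 <= hyp h G by apply: hyp_ge0.
have iv := inv_Im_mul_le c0 cG h0.
have ir : r^-1 <= 2.
  by rewrite -[2]invrK lef_pV2 ?posrE ?invr_gt0 //; lra.
have : 8 * lam / r * ((Im h)^-1 / Im G) <= 8 * lam * 2 * ((hyp h G + 2) / c ^+ 2).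
  apply: ler_pM => //.
  - by rewrite !mulr_ge0 ?invr_ge0 ?(ltW l0) ?(ltW r0).
  - by rewrite mulr_ge0 ?invr_ge0 ?(ltW h0) ?(ltW G0).
  - by rewrite ler_wpM2l // mulr_ge0 // ltW.
have : (1 + lam) * r * hyp h G <= (1 + 3 * lam) * hyp h G.
  by rewrite ler_wpM2r //; nra.
move=> H1 H2; apply: (le_trans (lerD H1 H2)).
set k := c ^- 2.
have k0 : 0 <= k by rewrite invr_ge0 exprn_ge0 // ltW.
set X := hyp h G in X0 *.
have lXk : 0 <= lam * X * k := mulr_ge0 (mulr_ge0 (ltW l0) X0) k0.
have lk : 0 <= lam * k := mulr_ge0 (ltW l0) k0.
by lra.
Qed.

(** Nothing is small here. With [m = 1 + normc v], dividing the terms [r ^+ 2] and [m ^+ 2] of the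
    numerator by [r * Im h * Im G] leaves [r] and [m ^+ 2 / r], whence the factor whose [p]-th power
    is integrated in [alpha] and [beta]. *)
Lemma hyp_perturb_crude c r v G h :
  0 < c -> c <= Im G -> normsq G <= 1 -> 0 < r -> 0 <= Im v -> 0 < Im h ->
  hyp (r%:C * h + v) G <=
    (36 / c ^+ 2) * ((1 + normc v) ^+ 2 * (r + r^-1)) * (1 + hyp h G).
Proof.
move=> c0 cG G1 r0 v0 h0.
have G0 : 0 < Im G by apply: lt_le_trans cG.
set m := 1 + normc v.
have m1 : 1 <= m by rewrite lerDl normc_ge0.
have X0 : 0 <= hyp h G by apply: hyp_ge0.
have hG : normsq h <= 2 * normsq (h - G) + 2.
  have -> : normsq h = normsq (h - G + G) by congr normsq; ring.
  by apply: (le_trans (normsqD2 _ _)); lra.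
have num : normsq (r%:C * h + v - G) <= 4 * r ^+ 2 * (normsq (h - G) + 1) + 4 * m ^+ 2.
  rewrite -addrA; apply: (le_trans (normsqD2 _ _)); rewrite normsqZ.
  have : normsq (v - G) <= 2 * m ^+ 2.
    apply: (le_trans (normsqD2 _ _)).
    rewrite normsqN; have := normsq_le (lexx (normc v)).
    by have := normc_ge0 v; rewrite /m; nra.
  have : r ^+ 2 * normsq h <= r ^+ 2 * (2 * normsq (h - G) + 2).
    by rewrite ler_wpM2l // sqr_ge0.
  by lra.
apply: (le_trans (hyp_scale_add_le r0 v0 h0 G0)).
have den0 : 0 < r * Im h * Im G by rewrite !mulr_gt0.
apply: (@le_trans _ _ ((4 * r ^+ 2 * (normsq (h - G) + 1) + 4 * m ^+ 2) / (r * Im h * Im G))).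
  by rewrite ler_wpM2r // invr_ge0 ltW.
have -> : (4 * r ^+ 2 * (normsq (h - G) + 1) + 4 * m ^+ 2) / (r * Im h * Im G)
   = 4 * r * hyp h G + (4 * r + 4 * m ^+ 2 / r) * ((Im h)^-1 / Im G).
  by rewrite /hyp; field; rewrite !gt_eqF.
have iv := inv_Im_mul_le c0 cG h0.
set k := c ^- 2; set X := hyp h G in X0 iv *.
have c1 : c <= 1.
  apply: (le_trans cG); rewrite -(@ler_sqr R) ?nnegrE ?(ltW G0) // expr1n.
  by apply: le_trans G1; rewrite lerDr sqr_ge0.
have k1 : 1 <= k by rewrite invf_ge1 ?exprn_gt0 // expr_le1 // ltW.
set s := r^-1.
have s0 : 0 < s by rewrite invr_gt0.
set M := m ^+ 2.
have M1 : 1 <= M by rewrite exprn_ege1.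
have H : (4 * r + 4 * M * s) * ((Im h)^-1 / Im G) <= (4 * r + 4 * M * s) * ((X + 2) * k).
  by rewrite ler_wpM2l //; nra.
apply: (@le_trans _ _ (4 * r * X + (4 * r + 4 * M * s) * ((X + 2) * k))).
  by rewrite lerD2l.
have -> : 36 * k * (M * (r + s)) * (1 + X) = 36 * (M * (r * (k * (1 + X)))) + 36 * (M * (s * (k * (1 + X)))) by ring.
have a1 : X + 1 <= k * (1 + X) by nra.
set Y := k * (1 + X) in a1 *.
have a2 : (X + 2) * k <= 2 * Y by rewrite /Y; nra.
have M0 : 0 <= M := le_trans ler01 M1.
have Y0 : 0 <= Y by apply: le_trans a1; rewrite addr_ge0.
have rY : 0 <= r * Y := mulr_ge0 (ltW r0) Y0.
have a3 : r * Y <= M * (r * Y) by rewrite ler_peMl.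
have a4 : r * X <= r * Y.
  by apply: (ler_wpM2l (ltW r0)); apply: le_trans a1; rewrite lerDl.
have a5 : (4 * r + 4 * M * s) * ((X + 2) * k) <= (4 * r + 4 * M * s) * (2 * Y).
  by rewrite ler_wpM2l //; nra.
have a6 : 0 <= M * (s * Y) := mulr_ge0 M0 (mulr_ge0 (ltW s0) Y0).
by lra.
Qed.

End perturbation.

(** * Convexity and slopes *)

Section averages.
Context {R : realType}.
Implicit Types (f : nat -> R) (x : nat -> R[i]) (g h k l w G s : R[i]) (n : nat).

Definition avg n f : R := n%:R^-1 * \sum_(i < n) f i.

Definition cavg n x : R[i] := (n%:R^-1)%:C * \sum_(i < n) x i.

Lemma avgD n f f' : avg n (fun i => f i + f' i) = avg n f + avg n f'.
Proof. by rewrite /avg big_split mulrDr. Qed.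

Lemma avgZ n (a : R) f : avg n (fun i => a * f i) = a * avg n f.
Proof. by rewrite /avg -mulr_sumr mulrCA. Qed.

Lemma avg_cst n (a : R) : (0 < n)%N -> avg n (fun=> a) = a.
Proof.
move=> n0; rewrite /avg sumr_const card_ord -[a *+ n]mulr_natl mulrA mulVf ?mul1r //.
by rewrite pnatr_eq0 -lt0n.
Qed.

Lemma le_avg n f f' : (forall i, (i < n)%N -> f i <= f' i) -> avg n f <= avg n f'.
Proof.
move=> ff'; rewrite ler_wpM2l ?invr_ge0 //.
by apply: ler_sum => i _; exact: ff'.
Qed.

Lemma eq_avg n f f' : (forall i, (i < n)%N -> f i = f' i) -> avg n f = avg n f'.
Proof. by move=> ff'; congr (_ * _); apply: eq_bigr => i _; exact: ff'. Qed.

Lemma avg_ge0 n f : (forall i, (i < n)%N -> 0 <= f i) -> 0 <= avg n f.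
Proof. by move=> f0; rewrite mulr_ge0 ?invr_ge0 // sumr_ge0 // => i _; exact: f0. Qed.

Lemma exists_le_avg n f : (0 < n)%N -> exists2 i, (i < n)%N & f i <= avg n f.
Proof.
move=> n0; apply: contrapT => H.
have fa i : (i < n)%N -> avg n f < f i.
  by move=> ni; rewrite ltNge; apply/negP => fi; apply: H; exists i.
suff : \sum_(i < n) avg n f < \sum_(i < n) f i.
  rewrite sumr_const card_ord -[avg n f *+ n]mulr_natl /avg mulrA mulfV ?mul1r ?ltxx //.
  by rewrite pnatr_eq0 -lt0n.
case: n n0 H fa => // n _ _ fa.
rewrite big_ord_recl [X in _ < X]big_ord_recl ltr_leD ?fa //.
by apply: ler_sum => i _; rewrite ltW // fa.
Qed.

Lemma sqr_avg_le n f : (0 < n)%N -> avg n f ^+ 2 <= avg n (fun i => f i ^+ 2).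
Proof.
move=> n0; set m := avg n f.
have : 0 <= avg n (fun i => (f i - m) ^+ 2) by apply: avg_ge0 => i _; exact: sqr_ge0.
rewrite (@eq_avg _ _ (fun i => f i ^+ 2 + ((- 2 * m) * f i + m ^+ 2))); last by move=> i _; ring.
by rewrite avgD avgD avgZ avg_cst // -/m; lra.
Qed.

Lemma Re_sum n x : Re (\sum_(i < n) x i) = \sum_(i < n) Re (x i).
Proof. by apply: (big_morph (@complex.Re R) (@ReD R)). Qed.

Lemma Im_sum n x : Im (\sum_(i < n) x i) = \sum_(i < n) Im (x i).
Proof. by apply: (big_morph (@complex.Im R) (@ImD R)). Qed.

Lemma Re_cavg n x : Re (cavg n x) = avg n (fun i => Re (x i)).
Proof. by rewrite /cavg ReCM Re_sum. Qed.

Lemma Im_cavg n x : Im (cavg n x) = avg n (fun i => Im (x i)).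
Proof. by rewrite /cavg ImCM Im_sum. Qed.

Lemma Im_cavg_gt0 n x : (0 < n)%N -> (forall i, (i < n)%N -> 0 < Im (x i)) ->
  0 < Im (cavg n x).
Proof.
move=> n0 x0; rewrite Im_cavg; have [i ni ia] := exists_le_avg (fun i => Im (x i)) n0.
by apply: lt_le_trans ia; exact: x0.
Qed.

(** The map taking [g] to [normsq (g - G) / Im g] is the perspective function of the squared
    modulus; its tangent plane at a point depends only on this quotient. *)
Definition slope G g : R[i] := ((Im g)^-1)%:C * (g - G).

Lemma normsq_slope G g : 0 < Im g -> 0 < Im G ->
  Im g * normsq (slope G g) = Im G * hyp g G.
Proof. by move=> g0 G0; rewrite normsqZ /hyp; field; rewrite !gt_eqF. Qed.

(* The support function of the convex map [g |-> hyp g G * Im G] at the point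
   of slope [w]. *)
Definition tangent G w g : R :=
  2 * (Re w * (Re g - Re G) + Im w * (Im g - Im G)) - Im g * normsq w.

Lemma hyp_tangent G w g : 0 < Im g -> 0 < Im G ->
  Im G * hyp g G = Im g * normsq (slope G g - w) + tangent G w g.
Proof.
case: g => a b; case: G => c d; case: w => e f /= b0 d0.
rewrite /hyp /tangent /normsq /slope /=.
by field; rewrite !gt_eqF.
Qed.

Lemma tangent_cavg G w n x : (0 < n)%N ->
  tangent G w (cavg n x) = avg n (fun i => tangent G w (x i)).
Proof.
move=> n0; rewrite /tangent Re_cavg Im_cavg.
rewrite (@eq_avg n (fun i => _ - _) (fun i => (2 * Re w) * Re (x i) +
  ((2 * Im w - normsq w) * Im (x i) + (- 2 * (Re w * Re G + Im w * Im G))))); last first.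
  by move=> i _; ring.
by rewrite !avgD !avgZ avg_cst //; ring.
Qed.

Lemma tangent_slope G g : 0 < Im g -> 0 < Im G ->
  tangent G (slope G g) g = Im G * hyp g G.
Proof.
move=> g0 G0; rewrite (hyp_tangent (slope G g)) // subrr.
by rewrite /normsq /= expr0n /= addr0 mulr0 add0r.
Qed.

(** The variance of the slopes, weighted by the imaginary parts, about the slope of the average. *)
Definition spread G n x : R :=
  avg n (fun i => Im (x i) * normsq (slope G (x i) - slope G (cavg n x)) / Im G).

(** Jensen's inequality with its exact remainder: apply [hyp_tangent] to each point with the slope
    of the average. The support function is affine, so its average is its value at the average,
    where it touches [hyp]. *)
Lemma hyp_cavg G n x : 0 < Im G -> (0 < n)%N -> (forall i, (i < n)%N -> 0 < Im (x i)) ->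
  hyp (cavg n x) G + spread G n x = avg n (fun i => hyp (x i) G).
Proof.
move=> G0 n0 x0; set h := cavg n x; have h0 : 0 < Im h by exact: Im_cavg_gt0.
apply: (mulfI (lt0r_neq0 G0)); rewrite mulrDr -tangent_slope // tangent_cavg //.
rewrite /spread -!avgZ -avgD; apply: eq_avg => i ni.
rewrite (hyp_tangent (slope G h)) ?x0 // addrC; congr (_ + _).
by rewrite mulrCA mulfV ?mulr1 // gt_eqF.
Qed.

Lemma spread_ge0 G n x : 0 < Im G -> (forall i, (i < n)%N -> 0 < Im (x i)) ->
  0 <= spread G n x.
Proof.
move=> G0 x0; apply: avg_ge0 => i /x0 xi.
by rewrite divr_ge0 ?(ltW G0) // mulr_ge0 ?normsq_ge0 ?(ltW xi).
Qed.

Lemma hyp_cavg_le G n x : 0 < Im G -> (0 < n)%N -> (forall i, (i < n)%N -> 0 < Im (x i)) ->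
  hyp (cavg n x) G <= avg n (fun i => hyp (x i) G).
Proof. by move=> G0 n0 x0; rewrite -hyp_cavg // lerDl spread_ge0. Qed.

Definition mid k l : R[i] := (2^-1)%:C * (k + l).

(** The case of two points of [spread], where the weighted variance reduces to the difference of the
    two slopes. *)
Definition hyp_gap G k l : R :=
  Im k * Im l / (2 * (Im k + Im l) * Im G) * normsq (slope G k - slope G l).

Lemma Im_mid_gt0 k l : 0 < Im k -> 0 < Im l -> 0 < Im (mid k l).
Proof. by move=> k0 l0; rewrite /mid ImCM ImD mulr_gt0 // addr_gt0. Qed.

Lemma hyp_mid G k l : 0 < Im G -> 0 < Im k -> 0 < Im l ->
  hyp (mid k l) G + hyp_gap G k l = (hyp k G + hyp l G) / 2.
Proof.
case: G => a b; case: k => c d; case: l => e f /= b0 d0 f0.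
rewrite /hyp_gap /hyp /mid /normsq /slope /=.
by field; rewrite !gt_eqF // addr_gt0.
Qed.

Lemma hyp_gap_ge0 G k l : 0 < Im G -> 0 < Im k -> 0 < Im l -> 0 <= hyp_gap G k l.
Proof.
move=> G0 k0 l0; rewrite mulr_ge0 ?normsq_ge0 // divr_ge0 // ?mulr_ge0 ?addr_ge0 ?ltW //.
Qed.

Definition defect G k l : R :=
  (hyp k G ^+ 2 + hyp l G ^+ 2) / 2 - hyp (mid k l) G ^+ 2.

(** With values [a], [b] and gap [d], the midpoint has value [(a + b) / 2 - d], so the defect is
    [(a - b) ^+ 2 / 4 + d * (a + b) - d ^+ 2], and [d <= (a + b) / 2]. A small defect thus forces
    the two values to agree, and the two slopes as well. *)
Lemma defect_ge G k l : 0 < Im G -> 0 < Im k -> 0 < Im l ->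
  (hyp k G - hyp l G) ^+ 2 / 4 + hyp_gap G k l * (hyp k G + hyp l G) / 2
    <= defect G k l.
Proof.
move=> G0 k0 l0; rewrite /defect.
have e := hyp_mid G0 k0 l0; have d0 := hyp_gap_ge0 G0 k0 l0.
have m0 := hyp_ge0 (Im_mid_gt0 k0 l0) G0.
move: e d0 m0; set m := hyp (mid _ _) _; set d := hyp_gap _ _ _.
set a := hyp k G; set b := hyp l G => e d0 m0.
have -> : m = (a + b) / 2 - d by rewrite -e addrK.
have : d * d <= d * ((a + b) / 2) by rewrite ler_wpM2l //; lra.
by lra.
Qed.

Lemma defect_ge0 G k l : 0 < Im G -> 0 < Im k -> 0 < Im l -> 0 <= defect G k l.
Proof.
move=> G0 k0 l0; apply: le_trans (defect_ge G0 k0 l0).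
by rewrite addr_ge0 // divr_ge0 ?sqr_ge0 // mulr_ge0 ?hyp_gap_ge0 ?addr_ge0 ?hyp_ge0.
Qed.

(* When the variables are averaged around a cycle, neighbours are distinct as
   soon as there are at least two of them. *)
Definition next n i : nat := (i.+1 %% n)%N.

Lemma next_lt n i : (0 < n)%N -> (next n i < n)%N.
Proof. by move=> n0; rewrite ltn_mod. Qed.

Lemma next_neq n i : (1 < n)%N -> (i < n)%N -> next n i != i.
Proof.
move=> n1 ni; rewrite /next; have [e|ne] := eqVneq i.+1 n.
  by rewrite e modnn eq_sym -lt0n -ltnS e.
rewrite modn_small ?gtn_eqF //.
by rewrite ltn_neqAle ne.
Qed.

Lemma avg_next n f : (0 < n)%N -> avg n (fun i => f (next n i)) = avg n f.
Proof.
case: n => // n _; congr (_ * _).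
by rewrite [RHS](reindex_inj (@ordS_inj n.+1)).
Qed.

Lemma cavg_next n x : (0 < n)%N -> cavg n (fun i => x (next n i)) = cavg n x.
Proof.
case: n => // n _; congr (_ * _).
by rewrite [RHS](reindex_inj (@ordS_inj n.+1)).
Qed.

Lemma cavg_mid n x : (0 < n)%N -> cavg n (fun i => mid (x i) (x (next n i))) = cavg n x.
Proof.
move=> n0; rewrite {1}/cavg /mid -mulr_sumr big_split /= mulrCA mulrDr.
have := @cavg_next n x n0; rewrite /cavg => ->.
rewrite -mulr2n -[X in _ * X]mulr_natl mulrA.
have -> : (2^-1)%:C * 2%:R = 1 :> R[i].
  have -> : 2%:R = (2%:R)%:C :> R[i] by rewrite rmorph_nat.
  by rewrite -rmorphM mulVf ?rmorph1 // pnatr_eq0.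
by rewrite mul1r.
Qed.

Definition jensen_gap G n x : R :=
  avg n (fun i => hyp (x i) G ^+ 2) - hyp (cavg n x) G ^+ 2.

(** Replacing each point by the midpoint with its cyclic neighbour preserves the average and costs
    exactly the mean pair defect; convexity takes care of the rest. Only pairs of neighbours appear,
    and these are independent once [n] is at least 2. *)
Lemma jensen_gap_defect G n x : 0 < Im G -> (0 < n)%N ->
  (forall i, (i < n)%N -> 0 < Im (x i)) ->
  avg n (fun i => defect G (x i) (x (next n i))) <= jensen_gap G n x.
Proof.
move=> G0 n0 x0.
have x0' i : (i < n)%N -> 0 < Im (x (next n i)) by move=> _; exact/x0/next_lt.
have m0 i : (i < n)%N -> 0 < Im (mid (x i) (x (next n i))).
  by move=> ni; apply: Im_mid_gt0; [exact: x0|exact: x0'].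
rewrite (@eq_avg _ _ (fun i => 2^-1 * (hyp (x i) G ^+ 2) + (2^-1 * (hyp (x (next n i)) G ^+ 2)
   + (-1) * hyp (mid (x i) (x (next n i))) G ^+ 2))); last first.
  by move=> i ni; rewrite /defect; lra.
rewrite !avgD !avgZ (avg_next (fun i => hyp (x i) G ^+ 2)) // addrA -mulrDl.
have -> : 2^-1 + 2^-1 = 1 :> R by lra.
rewrite mul1r mulN1r lerD2l lerN2 -cavg_mid //.
apply: le_trans (sqr_avg_le _ n0); rewrite ler_sqr ?nnegrE.
- exact: hyp_cavg_le.
- by apply: hyp_ge0 => //; exact: Im_cavg_gt0.
- by apply: avg_ge0 => i ni; apply: hyp_ge0 => //; exact: m0.
Qed.

(** With mean value [m] and spread [V], the gap is at least
    [m ^+ 2 - (m - V) ^+ 2 = V * (2 * m - V)], and [V <= m]. *)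
Lemma jensen_gap_spread G n x : 0 < Im G -> (0 < n)%N ->
  (forall i, (i < n)%N -> 0 < Im (x i)) ->
  spread G n x * avg n (fun i => hyp (x i) G) <= jensen_gap G n x.
Proof.
move=> G0 n0 x0; have e := hyp_cavg G0 n0 x0.
have V0 := spread_ge0 G0 x0.
have h0 : 0 <= hyp (cavg n x) G by apply: hyp_ge0 => //; exact: Im_cavg_gt0.
have sq := sqr_avg_le (fun i => hyp (x i) G) n0.
by rewrite /jensen_gap; move: e sq; set m := avg n (fun i => hyp (x i) G) => e sq; nra.
Qed.

Lemma jensen_gap_ge0 G n x : 0 < Im G -> (0 < n)%N ->
  (forall i, (i < n)%N -> 0 < Im (x i)) -> 0 <= jensen_gap G n x.
Proof.
move=> G0 n0 x0; apply: le_trans (jensen_gap_spread G0 n0 x0).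
rewrite mulr_ge0 ?spread_ge0 ?avg_ge0 // => i ni.
by apply: hyp_ge0 => //; exact: x0.
Qed.

End averages.

(** * Rigidity: the resolvent step cannot preserve slopes *)

Section concentration.
Context {R : realType}.
Implicit Types (x : nat -> R[i]) (g h k l w G s : R[i]) (n : nat).

(** The defect bound gives [hyp k G >= t / 2] and [hyp_gap G k s <= 2 * kap * t] for [t = hyp s G].
    In [hyp_gap] the sum of the heights is at most twice the larger one, which then cancels. If
    [Im s] is the larger, the bound is first relative to the slope of [k], which is itself
    controlled by that of [s] because [kap] is small. *)
Lemma slope_close (kap : R) G s k :
  0 < kap <= 1 / 64 -> 0 < Im G -> 0 < Im s -> 0 < Im k -> 0 < hyp s G ->
  defect G k s <= kap * hyp s G ^+ 2 ->
  normsq (slope G k - slope G s) <= 64 * kap * normsq (slope G s) /\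
  Im s <= 8 * Im k.
Proof.
move=> /andP[kap0 kap1] G0 s0 k0 t0 D.
have := le_trans (defect_ge G0 k0 s0) D.
have gap0 := hyp_gap_ge0 G0 k0 s0.
have K0 := hyp_ge0 k0 G0.
have es := normsq_slope s0 G0; have ek := normsq_slope k0 G0.
set t := hyp s G in t0 es *; set K := hyp k G in K0 ek *.
have egap : Im k * Im s * normsq (slope G k - slope G s)
    = hyp_gap G k s * (2 * (Im k + Im s) * Im G).
  by rewrite /hyp_gap; field; rewrite !gt_eqF // addr_gt0.
move: egap; set gap := hyp_gap G k s in gap0 *.
set Q := normsq (slope G k - slope G s); set S := normsq (slope G s) in es *.
set T := normsq (slope G k) in ek *.
have QT : T <= 2 * Q + 2 * S.
  have -> : T = normsq (slope G k - slope G s + slope G s) by rewrite subrK.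
  exact: normsqD2.
have Q0 : 0 <= Q by exact: normsq_ge0.
have S0 : 0 <= S by exact: normsq_ge0.
have T0 : 0 <= T by exact: normsq_ge0.
move: (Im k) (Im s) (Im G) k0 s0 G0 es ek => yk ys b k0 s0 b0 es ek egap H.
have gK : 0 <= gap * K by rewrite mulr_ge0.
have sq : 0 <= (K - t) ^+ 2 by exact: sqr_ge0.
have gapt : gap <= 2 * kap * t.
  rewrite -(ler_pM2r t0); have := H; lra.
have Kt : (K - t) ^+ 2 <= t ^+ 2 / 4.
  have gt : 0 <= gap * t by rewrite mulr_ge0 // ltW.
  have : kap * t ^+ 2 <= 1 / 64 * t ^+ 2 by rewrite ler_wpM2r // sqr_ge0.
  by lra.
have Klb : t / 2 <= K.
  by rewrite leNgt; apply/negP => Klt; nra.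
have St0 : 0 < S.
  rewrite lt_def S0 andbT; apply/eqP => S00.
  by move: es; rewrite S00 mulr0 => /esym/eqP; rewrite mulf_eq0 !gt_eqF.
have [ysk|yks] := leP ys yk.
  split; last by lra.
  have H1 : yk * (ys * Q) <= yk * (8 * kap * (ys * S)).
    rewrite mulrA egap es.
    have -> : yk * (8 * kap * (b * t)) = (2 * kap * t) * (2 * (yk + yk) * b) by ring.
    apply: ler_pM => //; first by rewrite !mulr_ge0 ?addr_ge0 ?ltW.
    by rewrite ler_wpM2r ?(ltW b0) // ler_wpM2l // lerD2l.
  have : Q <= 8 * kap * S.
    by move: H1; rewrite ler_pM2l // mulrCA ler_pM2l.
  by move/le_trans; apply; rewrite ler_wpM2r // ler_wpM2r ?(ltW kap0) //; lra.
have H1 : ys * (yk * Q) <= ys * (16 * kap * (yk * T)).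
  rewrite mulrA [ys * yk]mulrC egap ek.
  have -> : ys * (16 * kap * (b * K)) = (2 * kap * (2 * K)) * (2 * (ys + ys) * b) by ring.
  apply: ler_pM => //; first by rewrite !mulr_ge0 ?addr_ge0 ?ltW.
    by apply: (le_trans gapt); rewrite ler_wpM2l ?mulr_ge0 ?(ltW kap0) //; lra.
  by rewrite ler_wpM2r ?(ltW b0) // ler_wpM2l // lerD2r ltW.
have QT' : Q <= 16 * kap * T by move: H1; rewrite ler_pM2l // mulrCA ler_pM2l.
have kT : kap * T <= 1 / 64 * T by rewrite ler_wpM2r.
have T4 : T <= 4 * S by lra.
split.
  have kT4 : kap * T <= kap * (4 * S) by rewrite ler_wpM2l // ltW.
  by lra.
have : yk * T <= yk * (4 * S) by rewrite ler_wpM2l // ltW.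
have : b * (t / 2) <= b * K by rewrite ler_wpM2l // ltW.
rewrite -ek => h1 h2.
have : (ys * S) <= (8 * yk) * S by rewrite es; lra.
by rewrite ler_pM2r.
Qed.

Definition dot (a b : R[i]) : R := Re a * Re b + Im a * Im b.

Lemma dot_le a b : dot a b <= normc a * normc b.
Proof.
have [d0|d0] := leP (dot a b) 0.
  by apply: (le_trans d0); rewrite mulr_ge0 ?normc_ge0.
rewrite -ler_sqr ?nnegrE ?mulr_ge0 ?normc_ge0 // ?(ltW d0) //.
rewrite exprMn !normc_sq /dot /normsq.
by have := sqr_ge0 (Re a * Im b - Im a * Re b); lra.
Qed.

Lemma normc_le (a b : R[i]) (e : R) : 0 <= e -> normsq a <= e ^+ 2 * normsq b ->
  normc a <= e * normc b.
Proof.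
move=> e0 H; rewrite -ler_sqr ?nnegrE ?mulr_ge0 ?normc_ge0 //.
by rewrite exprMn !normc_sq.
Qed.

Lemma normcZ (r : R) a : 0 <= r -> normc (r%:C * a) = r * normc a.
Proof. by move=> r0; rewrite Normc.normcM /= expr0n addr0 sqrtr_sqr ger0_norm. Qed.

Lemma resolvent_sub z G w : 0 < Im (z + G) -> 0 < Im (z + w) -> G = - (z + G)^-1 ->
  - (z + w)^-1 - G = G * - (z + w)^-1 * (w - G).
Proof.
move=> G0 w0 GE; rewrite [X in _ - X]GE [X in X * _ * _]GE.
have GE0 : z + G != 0 by apply: contraTneq G0 => ->; rewrite ltxx.
have wE0 : z + w != 0 by apply: contraTneq w0 => ->; rewrite ltxx.
by field; rewrite GE0 wE0.
Qed.

(** In [Re (G * g) = Re G * Re g - Im G * Im g] the second term only lowers the value. Thus the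
    angle of [G * g] from the positive axis is bounded below as soon as [G] is not nearly real. *)
Lemma Re_mul_upper_le (c0 : R) G g : `|Re G| <= (1 - c0) * normc G ->
  0 < Im G -> 0 < Im g -> Re (G * g) <= (1 - c0) * normc (G * g).
Proof.
move=> H G0 g0; rewrite Normc.normcM mulrA.
have -> : Re (G * g) = Re G * Re g - Im G * Im g by case: (G); case: (g).
have : 0 <= Im G * Im g by rewrite mulr_ge0 // ltW.
have : Re G * Re g <= `|Re G| * normc g.
  apply: (le_trans (ler_norm _)); rewrite normrM ler_wpM2l //.
  rewrite -ler_sqr ?nnegrE ?normc_ge0 // normc_sq /normsq real_normK ?num_real //.
  by rewrite lerDl sqr_ge0.
have : `|Re G| * normc g <= (1 - c0) * normc G * normc g.
  by rewrite ler_wpM2r // normc_ge0.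
by lra.
Qed.

(* The resolvent step multiplies [w - G] by [G * g'] up to a positive factor;
   as [G] and [g'] both lie in the upper half plane, this product stays away
   from the positive real axis, so the step cannot preserve slopes. *)
Lemma slope_resolvent_far (c0 r : R) G z h v :
  0 < c0 <= 1 -> 0 < Im G -> G = - (z + G)^-1 -> 0 <= Im z ->
  `|Re G| <= (1 - c0) * normc G ->
  1 / 2 <= r <= 3 / 2 -> 0 <= Im v -> 0 < Im h ->
  0 < normc (slope G h) ->
  normc ((r - 1)%:C * G + v) <= c0 / 40 * normc (h - G) ->
  c0 / 20 * normc (slope G h) <
    normc (slope G (- (z + r%:C * h + v)^-1) - slope G h).
Proof.
move=> /andP[c00 c01] G0 GE z0 ReG /andP[r1 r2] v0 h0 W0 eW.
rewrite ltNge; apply/negP => e1W.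
set w := r%:C * h + v.
have r0 : 0 < r by lra.
have w0 : 0 < Im w by rewrite ImD ImCM ltr_wpDr ?mulr_gt0.
have zw0 : 0 < Im (z + w) by rewrite ImD ltr_wpDl.
have zG0 : 0 < Im (z + G) by rewrite ImD ltr_wpDl.
move: e1W; rewrite -addrA -/w; set g := - (z + w)^-1.
have g0 : 0 < Im g by exact: Im_opp_inv_gt0.
set e := (r - 1)%:C * G + v in eW.
set X := w - G; set u := slope G h in W0 *.
have uE : h - G = (Im h)%:C * u.
  by rewrite /u /slope mulrA -rmorphM mulfV ?gt_eqF // rmorph1 mul1r.
have XE : X = (r * Im h)%:C * u + e.
  by rewrite rmorphM -mulrA -uE /X /w /e rmorphB /= rmorph1; ring.
rewrite [slope G g]/slope (resolvent_sub zG0 zw0 GE) -/g -/X mulrA.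
set q := _ * (G * g).
(* As [q] is a positive multiple of [G * g], the cosine of the angle between [q * X] and [X] is at
   most [1 - c0]. If the slopes nearly agreed, both vectors would be nearly positive multiples of
   [u], and the cosine would be nearly 1. *)
have qX : dot (q * X) X <= (1 - c0) * (normc (q * X) * normc X).
  have -> : dot (q * X) X = Re q * normsq X.
    by case: (q) (X) => a b [a' b']; rewrite /dot /normsq /=; ring.
  rewrite Normc.normcM -mulrA -expr2 normc_sq mulrA ler_wpM2r ?normsq_ge0 //.
  rewrite /q ReCM normcZ ?invr_ge0 ?(ltW g0) // mulrCA ler_wpM2l ?invr_ge0 ?(ltW g0) //.
  exact: Re_mul_upper_le.
set e1 := q * X - u => e1W.
have qXE : q * X = u + e1 by rewrite /e1 addrC subrK.
have d1 : dot (q * X) X = dot u X - dot (- e1) X.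
  by rewrite qXE; case: (u) (e1) (X) => [? ?] [? ?] [? ?]; rewrite /dot /=; ring.
have d2 : dot u X = r * Im h * normsq u - dot (- u) e.
  by rewrite XE; case: (u) (e) => [? ?] [? ?]; rewrite /dot /normsq /=; ring.
have b1 := dot_le (- e1) X; have b2 := dot_le (- u) e.
rewrite !normcN in b1 b2.
have eW' : normc e <= c0 / 40 * (Im h * normc u).
  by apply: (le_trans eW); rewrite uE normcZ // ltW.
have XW : normc X <= (r + c0 / 40) * (Im h * normc u).
  rewrite XE; apply: (le_trans (le_normcD _ _)).
  by rewrite normcZ ?mulr_ge0 ?(ltW r0) ?(ltW h0) //; lra.
have qW : normc (q * X) <= (1 + c0 / 20) * normc u.
  by rewrite qXE; apply: (le_trans (le_normcD _ _)); lra.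
move: d1 d2 b1 b2 qX; rewrite -normc_sq.
move: (dot (q * X) X) (dot u X) (dot (- e1) X) (dot (- u) e) => D1 D2 D3 D4.
have X0 := normc_ge0 X; have q0 := normc_ge0 (q * X).
have E0 := normc_ge0 e; have E10 := normc_ge0 e1.
move: (normc X) (normc (q * X)) (normc e) (normc e1) (normc u) (Im h) X0 q0 E0 E10 W0 h0 eW' XW qW e1W.
move=> nX nq ne ne1 W y X0 q0 E0 E10 W0 y0 eW' XW qW e1W d1 d2 b1 b2 qX.
set P := y * W ^+ 2.
have P0 : 0 < P by rewrite mulr_gt0 // exprn_gt0.
have c1 : ne1 * nX <= (c0 / 20) * (r + c0 / 40) * P.
  have -> : (c0 / 20) * (r + c0 / 40) * P = (c0 / 20 * W) * ((r + c0 / 40) * (y * W)).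
    by rewrite /P; ring.
  exact: ler_pM.
have c2 : W * ne <= c0 / 40 * P.
  have -> : c0 / 40 * P = W * (c0 / 40 * (y * W)) by rewrite /P; ring.
  by rewrite ler_wpM2l // ltW.
have c3 : nq * nX <= (1 + c0 / 20) * (r + c0 / 40) * P.
  have -> : (1 + c0 / 20) * (r + c0 / 40) * P = ((1 + c0 / 20) * W) * ((r + c0 / 40) * (y * W)).
    by rewrite /P; ring.
  exact: ler_pM.
have c4 : (1 - c0) * (nq * nX) <= (1 - c0) * ((1 + c0 / 20) * (r + c0 / 40) * P).
  by rewrite ler_wpM2l // subr_ge0.
have : (r - c0 / 40 - c0 / 20 * (r + c0 / 40)) * P
     <= (1 - c0) * (1 + c0 / 20) * (r + c0 / 40) * P.
  have : D1 = r * P - D4 - D3 by rewrite d1 d2 /P; ring.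
  by move: b1 b2 qX c1 c2 c4; lra.
(* The right side of [F] loses [c0 * r], at least [c0 / 2]; the error terms on the two sides add up
   to less. *)
rewrite ler_pM2r // => F.
by nra.
Qed.

End concentration.

Section no_concentration.
Context {R : realType}.
Implicit Types (x : nat -> R[i]) (g h k l w v z G s : R[i]) (n : nat).

Lemma normsq_sub_ge (c : R) G h : 0 < c <= Im G -> 0 < Im h ->
  c ^+ 2 * hyp h G <= (hyp h G + 2) * normsq (h - G).
Proof.
move=> /andP[c0 cG] h0; have G0 : 0 < Im G by apply: lt_le_trans cG.
have X0 := hyp_ge0 h0 G0.
have K : c ^+ 2 <= (hyp h G + 2) * (Im h * Im G).
  have := inv_Im_le_hyp h0 G0; rewrite ler_pdivlMr // ler_pdivrMl // => H.
  have c2 : c ^+ 2 <= Im G ^+ 2 by rewrite ler_sqr ?nnegrE // ltW.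
  apply: (le_trans c2); rewrite expr2 mulrA.
  by rewrite ler_wpM2r ?(ltW G0) // mulrC.
rewrite (normsq_eq h0 G0) mulrC; move: X0 K; move: (hyp h G) (Im h * Im G) => X y X0 K.
by rewrite [(X + 2) * _]mulrCA ler_wpM2l.
Qed.

(** The perturbation has modulus at most [2 * lam], while [normsq_sub_ge] and [t / 4 <= hyp h G]
    give [normsq (h - G) >= c ^+ 2 * t / (t + 8)]; this is the origin of [t + 8] in the smallness
    condition on [lam]. *)
Lemma small_perturb_normc (c eps lam r t : R) G h v :
  0 < c <= Im G -> normsq G <= 1 -> 0 < Im h -> 0 < eps ->
  0 < t -> t / 4 <= hyp h G -> (r - 1) ^+ 2 <= lam ^+ 2 -> normsq v <= lam ^+ 2 ->
  4 * lam ^+ 2 * (t + 8) <= eps ^+ 2 * c ^+ 2 * t ->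
  normc ((r - 1)%:C * G + v) <= eps * normc (h - G).
Proof.
move=> cG G1 h0 e0 t0 tX rl vl H; apply: normc_le; first exact: ltW.
have e4 : normsq ((r - 1)%:C * G + v) <= 4 * lam ^+ 2.
  apply: (le_trans (normsqD2 _ _)); rewrite normsqZ.
  by have := normsq_ge0 G; nra.
apply: (le_trans e4).
have := normsq_sub_ge cG h0; move: tX; set X := hyp h G => tX; set m := normsq (h - G) => Hm.
have m0 : 0 <= m by exact: normsq_ge0.
have c0 : 0 < c by case/andP: cG.
have X2 : 0 < X + 2 by lra.
have c2 : 0 < c ^+ 2 by rewrite exprn_gt0.
have tm : c ^+ 2 * t <= (t + 8) * m.
  rewrite -(ler_pM2l X2).
  have a1 : t * (c ^+ 2 * X) <= t * ((X + 2) * m) by rewrite ler_wpM2l // ltW.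
  have a2 : 0 <= (X + 2) * m by rewrite mulr_ge0 // ltW.
  have a3 : c ^+ 2 * (t / 4) <= c ^+ 2 * X by rewrite ler_wpM2l // ltW.
  lra.
have t8 : 0 < t + 8 by lra.
rewrite -(ler_pM2r t8); apply: (le_trans H).
rewrite -mulrA -[X in _ <= X]mulrA; rewrite ler_wpM2l ?sqr_ge0 //.
by rewrite [m * _]mulrC.
Qed.

Lemma sqr_sub1_le (lam r : R) : 1 - lam < r -> r < 1 + lam -> (r - 1) ^+ 2 <= lam ^+ 2.
Proof. by move=> r1 r2; nra. Qed.

Lemma half_bounds (lam r : R) :
  lam <= 1 / 2 -> 1 - lam < r -> r < 1 + lam -> 1 / 2 <= r <= 3 / 2.
Proof. by move=> l r1 r2; apply/andP; split; lra. Qed.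

Lemma normc_le_mul (k m e : R) (a b : R[i]) : 0 <= m -> 0 <= e -> k <= m ^+ 2 ->
  normsq a <= k * e ^+ 2 * normsq b -> normc a <= m * e * normc b.
Proof.
move=> m0 e0 km H; apply: normc_le; first exact: mulr_ge0.
by apply: (le_trans H); rewrite exprMn ler_wpM2r ?normsq_ge0 // ler_wpM2r ?sqr_ge0.
Qed.

(** Meant for the slopes [a] of the resolvent, [b] of the reference point, [w] of one copy and [u]
    of the average. The three errors sum to [19 * e * normc b], and [normc b <= 2 * normc u]. *)
Lemma close_far_step (a b w u : R[i]) (e : R) : 0 < e <= 1 / 40 -> 0 < normc b ->
  normc (a - b) <= 8 * e * normc b -> normc (w - b) <= 8 * e * normc b ->
  normc (w - u) <= 3 * e * normc b ->
  0 < normc u /\ normc (a - u) <= 40 * e * normc u.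
Proof.
move=> /andP[e0 e1] b0 ab wb wu.
have bu : normc b <= normc u + (normc (w - u) + normc (w - b)).
  rewrite -[normc (w - b)]normcN {1}(_ : b = u + ((w - u) + - (w - b))); last by ring.
  by apply: (le_trans (le_normcD _ _)); rewrite lerD2l le_normcD.
have au : normc (a - u) <= normc (a - b) + (normc (w - b) + normc (w - u)).
  rewrite -[normc (w - b)]normcN (_ : a - u = (a - b) + (- (w - b) + (w - u))); last by ring.
  by apply: (le_trans (le_normcD _ _)); rewrite lerD2l le_normcD.
have eb : e * normc b <= 1 / 40 * normc b by rewrite ler_pM2r.
have u0 : normc b / 2 <= normc u by lra.
have eu : e * (normc b / 2) <= e * normc u by rewrite ler_pM2l.
have p0 : 0 < e * normc b := mulr_gt0 e0 b0.
split; first by lra.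
move: ab wb wu au eu p0; move: (normc (a - u)) (normc (a - b)) (normc (w - b)) (normc (w - u)).
by move=> x1 x2 x3 x4; lra.
Qed.

(** If all three terms on the right were small, the resolvent and some [x i] would have nearly the
    slope of [s], and that [x i] nearly the slope of the average. The resolvent and its input would
    then share a slope, against [slope_resolvent_far]. *)
Lemma no_concentration (c0 c lam r t : R) G z s x n v :
  0 < c0 <= 1 -> 0 < c <= Im G -> normsq G <= 1 -> G = - (z + G)^-1 ->
  `|Re G| <= (1 - c0) * normc G ->
  0 <= Im z -> (0 < n)%N -> (forall i, (i < n)%N -> 0 < Im (x i)) -> 0 < Im s ->
  t = hyp s G -> 0 < t -> 0 < lam <= 1 / 2 -> 1 - lam < r < 1 + lam ->
  normsq v <= lam ^+ 2 -> 0 <= Im v ->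
  4 * lam ^+ 2 * (t + 8) <= (c0 / 40) ^+ 2 * c ^+ 2 * t ->
  (c0 / 40 / 20) ^+ 2 / 3 * t ^+ 2 <=
    defect G (- (z + r%:C * cavg n x + v)^-1) s
    + avg n (fun i => defect G (x i) s) + jensen_gap G n x.
Proof.
move=> c0P cG G1 GE ReG z0 n0 x0 s0 tE t0 /andP[l0 l1] /andP[r1 r2] vl v0 lamt.
have rl := sqr_sub1_le r1 r2.
have G0 : 0 < Im G by case/andP: cG => cc; exact: lt_le_trans.
have h0 : 0 < Im (cavg n x) by exact: Im_cavg_gt0.
set h := cavg n x in h0 *.
set g := - (z + r%:C * h + v)^-1.
have r0 : 0 < r by lra.
have g0 : 0 < Im g.
  by apply: Im_opp_inv_gt0; rewrite !ImD ImCM ltr_wpDr // ltr_wpDl // mulr_gt0.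
have [c00 c01] := andP c0P.
(* [sk] is such that [40 * sk = c0 / 20], the threshold of [slope_resolvent_far]. The 3 pays for one
   share of the defects and two of the spread when an index is selected below. *)
set sk := c0 / 40 / 20; set k1 := sk ^+ 2 / 3.
have sk0 : 0 < sk by rewrite /sk; lra.
have sk1 : sk <= 1 / 40 by rewrite /sk; lra.
have kap1 : sk ^+ 2 <= 1 / 64 by nra.
have kap0 : 0 < sk ^+ 2 by rewrite exprn_gt0.
have D0 := defect_ge0 G0 g0 s0.
have A0 : 0 <= avg n (fun i => defect G (x i) s).
  by apply: avg_ge0 => i ni; apply: defect_ge0 => //; exact: x0.
have J0 := jensen_gap_ge0 G0 n0 x0.
rewrite leNgt; apply/negP => H.
have Dg : defect G g s <= k1 * t ^+ 2 by lra.
have Dx : avg n (fun i => defect G (x i) s) <= k1 * t ^+ 2 by lra.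
have J : jensen_gap G n x <= k1 * t ^+ 2 by lra.
(* A defect dominates a quarter of the squared difference of the values, so the mean value [m]
   satisfies [(m - t) ^+ 2 <= 4 * k1 * t ^+ 2]. A lower bound on [m] is needed to turn the Jensen
   gap into a bound on the spread. *)
have mt : t / 2 <= avg n (fun i => hyp (x i) G).
  set m := avg n _.
  have : (m - t) ^+ 2 <= 4 * (k1 * t ^+ 2).
    have -> : m - t = avg n (fun i => hyp (x i) G - t) by rewrite avgD avg_cst.
    apply: (le_trans (sqr_avg_le _ n0)).
    have -> : avg n (fun i => (hyp (x i) G - t) ^+ 2) =
       4 * avg n (fun i => (hyp (x i) G - t) ^+ 2 / 4).
      by rewrite -avgZ; apply: eq_avg => i _; field.
    rewrite ler_wpM2l //; apply: le_trans Dx; apply: le_avg => i ni.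
    apply: le_trans (defect_ge G0 (x0 _ ni) s0).
    rewrite -tE lerDl mulr_ge0 // mulr_ge0 ?hyp_gap_ge0 ?addr_ge0 ?(ltW t0) //.
    - exact: x0.
    - by apply: hyp_ge0 => //; exact: x0.
  have : k1 * t ^+ 2 <= 1 / 64 * t ^+ 2.
    by rewrite ler_wpM2r ?sqr_ge0 // /k1; lra.
  move=> a1 a2; rewrite leNgt; apply/negP => mt; nra.
have V : spread G n x <= 2 * k1 * t.
  rewrite -(ler_pM2r t0).
  have : spread G n x * (t / 2) <= spread G n x * avg n (fun i => hyp (x i) G).
    by rewrite ler_wpM2l // spread_ge0.
  by have := jensen_gap_spread G0 n0 x0; lra.
have ht : t / 4 <= hyp h G.
  have := hyp_cavg G0 n0 x0; rewrite -/h => e.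
  by have : 2 * k1 * t <= 1 / 64 * t; [rewrite ler_pM2r // /k1; lra|lra].
pose W i := Im (x i) * normsq (slope G (x i) - slope G h) / Im G.
have [i ni Wi] := exists_le_avg (fun i => t^-1 * defect G (x i) s + W i) n0.
have Wi' : t^-1 * defect G (x i) s + W i <= 3 * k1 * t.
  apply: (le_trans Wi); rewrite avgD avgZ.
  have : t^-1 * avg n (fun i => defect G (x i) s) <= k1 * t.
    by rewrite ler_pdivrMl // mulrCA -expr2.
  by rewrite -/(spread G n x) /W; move: V; rewrite /spread -/h; lra.
have xi0 := x0 _ ni.
have k13 : 3 * k1 = sk ^+ 2 by rewrite /k1; field.
have Wi0 : 0 <= W i by rewrite divr_ge0 ?(ltW G0) // mulr_ge0 ?normsq_ge0 ?(ltW xi0).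
have di0 : 0 <= defect G (x i) s by exact: defect_ge0.
have ti0 : 0 <= t^-1 * defect G (x i) s by rewrite mulr_ge0 // invr_ge0 ltW.
have Di : defect G (x i) s <= sk ^+ 2 * hyp s G ^+ 2.
  have : t^-1 * defect G (x i) s <= 3 * k1 * t by lra.
  by rewrite ler_pdivrMl // mulrCA -expr2 -tE k13.
have Dg' : defect G g s <= sk ^+ 2 * hyp s G ^+ 2.
  by apply: (le_trans Dg); rewrite -tE ler_wpM2r ?sqr_ge0 // /k1; lra.
have skP : 0 < sk ^+ 2 <= 1 / 64 by rewrite kap0.
have t0' : 0 < hyp s G by rewrite -tE.
have [Q1 _] := slope_close skP G0 s0 g0 t0' Dg'.
have [Q2 y8] := slope_close skP G0 s0 xi0 t0' Di.
(* [W i] carries the weight [Im (x i)]; [Im s <= 8 * Im (x i)] exchanges it for [Im s], which turns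
   [t * Im G] into a squared slope. *)
have Q3 : normsq (slope G (x i) - slope G h) <= 8 * sk ^+ 2 * normsq (slope G s).
  have : W i <= sk ^+ 2 * t by rewrite -k13; lra.
  rewrite /W ler_pdivrMr // => H1.
  have H2 : Im s * normsq (slope G (x i) - slope G h) <=
            Im s * (8 * sk ^+ 2 * normsq (slope G s)).
    have -> : Im s * (8 * sk ^+ 2 * normsq (slope G s)) = 8 * (sk ^+ 2 * t * Im G).
      have -> : Im s * (8 * sk ^+ 2 * normsq (slope G s)) =
        8 * (sk ^+ 2 * (Im s * normsq (slope G s))) by ring.
      by rewrite normsq_slope // tE; ring.
    apply: le_trans (_ : 8 * (Im (x i) * normsq (slope G (x i) - slope G h)) <= _).
      by rewrite mulrA ler_wpM2r ?normsq_ge0.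
    by rewrite ler_wpM2l.
  by move: H2; rewrite ler_pM2l.
have skb : 0 < sk <= 1 / 40 by rewrite sk0.
have k64 : 64 <= 8 ^+ 2 :> R by rewrite -natrX ler_nat.
have k8 : 8 <= 3 ^+ 2 :> R by rewrite -natrX ler_nat.
have U0 : 0 < normc (slope G s).
  rewrite lt_def normc_ge0 andbT; apply/eqP => /(congr1 (fun a => a ^+ 2)).
  rewrite normc_sq expr0n /= => S00.
  have := normsq_slope s0 G0; rewrite S00 mulr0 => /esym/eqP.
  by rewrite mulf_eq0 !gt_eqF.
have [W00 T] := close_far_step skb U0 (normc_le_mul (ler0n _ 8) (ltW sk0) k64 Q1)
  (normc_le_mul (ler0n _ 8) (ltW sk0) k64 Q2) (normc_le_mul (ler0n _ 3) (ltW sk0) k8 Q3).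
have eW : normc ((r - 1)%:C * G + v) <= c0 / 40 * normc (h - G).
  apply: (@small_perturb_normc c _ lam r t) => //; by rewrite divr_gt0.
have r12 := half_bounds l1 r1 r2.
have := slope_resolvent_far c0P G0 GE z0 ReG r12 v0 h0 W00 eW.
rewrite -/g ltNge => /negP; apply.
by rewrite (_ : c0 / 20 = 40 * sk) // /sk; field.
Qed.

End no_concentration.

(** * Inequalities for real powers *)

Section powers.
Context {R : realType}.
Implicit Types (f : nat -> R) (a b p q lam K : R) (n : nat).

Lemma powR_le a b p : 0 <= p -> 0 <= a -> a <= b -> a `^ p <= b `^ p.
Proof.
by move=> p0 a0 ab; apply: ge0_ler_powR => //; rewrite nnegrE // (le_trans a0).
Qed.

Lemma powRDn a p q : 0 < p -> 0 <= q -> a `^ (p + q) = a `^ p * a `^ q.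
Proof. by move=> p0 q0; rewrite powRD // gt_eqF // ltr_wpDr. Qed.

Lemma powR_sqr_split a p : 0 <= a -> 2 <= p -> a `^ p = a ^+ 2 * a `^ (p - 2).
Proof.
move=> a0 p2; rewrite -powR_mulrn // -powRDn ?subr_ge0 //.
by rewrite addrC subrK.
Qed.

(** Multiplied by [p], this says that the power function lies above its tangent line at [m]; it is
    Young's inequality for the conjugate exponents [p / (p - 1)] and [p]. Taken at the mean and
    averaged, it gives Jensen's inequality in [powR_avg_le]. *)
Lemma young_tangent m c p : 1 < p -> 0 <= m -> 0 <= c ->
  m `^ (p - 1) * c <= (1 - p^-1) * m `^ p + p^-1 * c `^ p.
Proof.
move=> p1 m0 c0.
have p0 : 0 < p by lra.
have pp : 0 < p - 1 by rewrite subr_gt0.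
have e : (p / (p - 1))^-1 = 1 - p^-1 by field; rewrite !gt_eqF.
have := @conjugate_powR R (m `^ (p - 1)) c (p / (p - 1)) p (powR_ge0 _ _) c0.
rewrite -powRrM e => /(_ (divr_gt0 p0 pp) p0); rewrite subrK => /(_ erefl).
by rewrite mulrCA mulfV ?gt_eqF // mulr1 [_ * (1 - _)]mulrC [_ / p]mulrC.
Qed.

Lemma powR_avg_le n f p : 1 < p -> (0 < n)%N -> (forall i, (i < n)%N -> 0 <= f i) ->
  avg n f `^ p <= avg n (fun i => f i `^ p).
Proof.
move=> p1 n0 f0; set m := avg n f.
have m0 : 0 <= m by exact: avg_ge0.
have p0 : 0 < p by lra.
have : avg n (fun i => m `^ (p - 1) * f i) <=
    avg n (fun i => (1 - p^-1) * m `^ p + p^-1 * f i `^ p).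
  by apply: le_avg => i ni; apply: young_tangent => //; exact: f0.
rewrite avgZ avgD avg_cst // avgZ -/m.
rewrite [_ * m]mulrC mulr_powRB1 // => H.
rewrite -(ler_pM2l (_ : 0 < p^-1)) ?invr_gt0 //.
by move: H; lra.
Qed.

Lemma powRD_le a b p : 0 <= p -> 0 <= a -> 0 <= b ->
  (a + b) `^ p <= 2 `^ p * (a `^ p + b `^ p).
Proof.
move=> p0 a0 b0; wlog ab : a b a0 b0 / a <= b => [H|].
  have [/H|/ltW/H] := leP a b; first exact.
  by rewrite addrC [b `^ p + _]addrC; exact.
apply: (@le_trans _ _ ((2 * b) `^ p)).
  by apply: powR_le => //; [rewrite addr_ge0|lra].
by rewrite powRM // ler_wpM2l ?powR_ge0 // lerDr powR_ge0.
Qed.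

(* A pair of values that are not comparable gains a factor [3 / 4] over the
   average of the [p]-th powers; a comparable pair is absorbed by
   [a ^ 2 * b ^ (p - 2)]. *)
Lemma powR_pair a b p K lam : 2 <= p -> 0 <= a -> 0 <= b -> 0 <= K ->
  0 < lam <= 1 -> K * lam <= 1 / 20 ->
  ((1 + K * lam) * ((a + b) / 2) + K * lam) `^ p <=
    3 / 8 * (a `^ p + b `^ p) + 7 `^ p * (a ^+ 2 * b `^ (p - 2))
    + (22 * K) `^ p * lam.
Proof.
move=> p2 a0 b0 K0 /andP[l0 l1] Kl.
have p0 : 0 <= p by lra.
have Kl0 : 0 <= K * lam by rewrite mulr_ge0 // ltW.
set X := _ + K * lam.
have X0 : 0 <= X by rewrite addr_ge0 // mulr_ge0 ?addr_ge0 // divr_ge0 // addr_ge0.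
have T1 : 0 <= 3 / 8 * (a `^ p + b `^ p) by rewrite mulr_ge0 // addr_ge0 ?powR_ge0.
have T2 : 0 <= 7 `^ p * (a ^+ 2 * b `^ (p - 2)).
  by rewrite !mulr_ge0 ?powR_ge0 ?sqr_ge0.
have T3 : 0 <= (22 * K) `^ p * lam by rewrite mulr_ge0 ?powR_ge0 // ltW.
(* If the additive error dominates, then [a + b < 40 * K * lam] and the base is at most [(21 / 20 *
   20 + 1) * K * lam = 22 * K * lam]. Otherwise it is at most [21 / 40 + 1 / 40 = 11 / 20] of
   [a + b]. *)
have [Kab|Kab] := ltP ((a + b) / 40) (K * lam).
  apply: (@le_trans _ _ ((22 * K) `^ p * lam)); last by lra.
  apply: (@le_trans _ _ ((22 * K * lam) `^ p)).
    by apply: powR_le => //; rewrite /X; nra.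
  rewrite powRM ?mulr_ge0 ?(ltW l0) // ler_wpM2l ?powR_ge0 //.
  by apply: ge1r_powR; [rewrite l0|lra].
have XL : X <= 11 / 20 * (a + b) by rewrite /X; nra.
(* For very unequal values the base is at most [11 / 20 * 11 / 10 * c], below [61 / 100 * c], and
   the square of [61 / 100] is below [3 / 8]. *)
have Q (c d : R) : 0 <= c -> 0 <= d -> d <= c / 10 -> X <= 11 / 20 * (c + d) ->
    X `^ p <= 3 / 8 * c `^ p.
  move=> c0 d0 dc Xcd; apply: (@le_trans _ _ ((61 / 100 * c) `^ p)).
    by apply: powR_le => //; lra.
  rewrite powRM // ler_wpM2r ?powR_ge0 //.
  apply: (@le_trans _ _ ((61 / 100) `^ 2)).
    by apply: ger_powR => //; lra.
  by rewrite powR_mulrn //; lra.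
have [ba|ab] := leP b (a / 10).
  have := Q a b a0 b0 ba XL; have := powR_ge0 b p; lra.
have [ab'|ba'] := leP a (b / 10).
  have := Q b a b0 a0 ab'; rewrite [b + a]addrC => /(_ XL).
  by have := powR_ge0 a p; lra.
(* Values within a factor 10 of each other: the base is at most [11 / 20 * 11 = 6.05] times either
   of them, so it can be shared between [a] and [b] at will. *)
apply: (@le_trans _ _ (7 `^ p * (a ^+ 2 * b `^ (p - 2)))); last by lra.
have s7 : (0 : R) <= 7 by [].
rewrite powR_sqr_split // [7 `^ p]powR_sqr_split //.
have -> : 7 ^+ 2 * 7 `^ (p - 2) * (a ^+ 2 * b `^ (p - 2)) =
   (7 * a) ^+ 2 * (7 * b) `^ (p - 2) by rewrite [(7 * b) `^ _]powRM //; ring.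
apply: ler_pM; rewrite ?sqr_ge0 ?powR_ge0 //.
  by rewrite ler_sqr ?nnegrE ?mulr_ge0 //; lra.
by apply: powR_le => //; lra.
Qed.

Lemma powR_le1D a p q : 0 <= a -> 0 <= q <= p -> a `^ q <= 1 + a `^ p.
Proof.
move=> a0 /andP[q0 qp]; have [a1|a1] := leP a 1.
  apply: (@le_trans _ _ 1); last by rewrite lerDl powR_ge0.
  by have := powR_le q0 a0 a1; rewrite powR1.
apply: (@le_trans _ _ (a `^ p)); last by rewrite lerDr.
by apply: ler_powR => //; exact: ltW.
Qed.

End powers.

(** * The Stieltjes transform of the semicircle law *)

Section integral_0_pi.
Context {R : realType}.
Local Notation mu := (@lebesgue_measure R).
Implicit Types (f g F : R -> R).

Definition ipi f : R := \int[mu]_(t in `[0, pi]) f t.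

Lemma integrable_ipi f : continuous f -> mu.-integrable `[0, pi] (EFin \o f).
Proof.
move=> cf; apply: continuous_compact_integrable; first exact: segment_compact.
exact: continuous_subspaceT.
Qed.

Lemma ipiD f g : continuous f -> continuous g ->
  ipi (fun t => f t + g t) = ipi f + ipi g.
Proof. by move=> cf cg; rewrite /ipi RintegralD //; exact: integrable_ipi. Qed.

Lemma ipiZ (a : R) f : continuous f -> ipi (fun t => a * f t) = a * ipi f.
Proof. by move=> cf; rewrite /ipi RintegralZl //; exact: integrable_ipi. Qed.

Lemma eq_ipi f g : (forall t, 0 <= t <= pi -> f t = g t) -> ipi f = ipi g.
Proof. by move=> fg; apply: eq_Rintegral => t; rewrite inE /= in_itv /=; exact: fg. Qed.

Lemma normr_ipi_le (M : R) f : continuous f -> (forall t, `|f t| <= M) ->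
  `|ipi f| <= M * pi.
Proof.
move=> cf fM.
apply: (le_trans (le_normr_Rintegral _ (integrable_ipi cf))) => //.
have -> : M * pi = \int[mu]_(t in `[0, pi]) M.
  rewrite Rintegral_cst //.
  by have /= -> := @lebesgue_measure_itv R `[0, pi]; rewrite lte_fin pi_gt0 /= subr0.
apply: le_Rintegral => //.
- apply: integrable_ipi => t; apply: (@continuous_comp _ _ _ f Num.norm); first exact: cf.
  exact: norm_continuous.
- by apply: integrable_ipi; exact: cst_continuous.
Qed.

Lemma ipi_FTC f F : continuous f -> (forall x : R, is_derive x (1 : R) F (f x)) ->
  ipi f = F pi - F 0.
Proof.
move=> cf dF; rewrite /ipi /Rintegral (@continuous_FTC2 _ f F) //.
- exact: pi_gt0.
- exact: continuous_subspaceT.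
- have cF : continuous F.
    by move=> x; apply: differentiable_continuous; apply/derivable1_diffP.
  split; first by move=> x _; exact: ex_derive.
  + exact/cvg_at_right_filter/cF.
  + exact/cvg_at_left_filter/cF.
- by move=> x _; rewrite derive1E; apply: derive_val.
Qed.

End integral_0_pi.

Section sine_moments.
Context {R : realType}.

Lemma is_derive_sinZ (c x : R) : is_derive x 1 (fun t => sin (c * t)) (c * cos (c * x)).
Proof.
have h : is_derive x 1 (fun t : R => c * t) c.
  have := @is_deriveZ _ _ _ (fun t : R => t) c x 1 1 (is_derive_id _ _).
  by move=> d; apply: is_derive_eq; rewrite /GRing.scale /= mulr1.
have := @is_derive1_comp _ (@sin R) (fun t => c * t) x (cos (c * x)) c (is_derive_sin _) h.
by move=> d; apply: is_derive_eq; rewrite mulrC.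
Qed.

Lemma continuous_sinZ (c : R) : continuous (fun t : R => sin (c * t)).
Proof.
move=> t; apply: (@continuous_comp _ _ _ (fun t : R => c * t) (@sin R)).
  exact: mulrl_continuous.
exact: continuous_sin.
Qed.

Lemma sin_natpi n : sin (n%:R * pi) = 0 :> R.
Proof.
elim: n => [|n IHn]; first by rewrite mul0r sin0.
by rewrite -natr1 mulrDl mul1r sinDpi IHn oppr0.
Qed.

Lemma continuous_sin_sinZ (c : R) : continuous (fun t : R => sin (c * t) * sin t).
Proof. by move=> t; apply: cvgM; [exact: continuous_sinZ|exact: continuous_sin]. Qed.

Lemma ipi_sin_sin1 : ipi (fun t : R => sin (1%:R * t) * sin t) = pi / 2.
Proof.
have d (x : R) : is_derive x 1 (fun t => 2^-1 * t - 4^-1 * sin (2 * t))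
    (sin (1%:R * x) * sin x).
  have h1 := @is_deriveZ _ _ _ (fun t : R => t) 2^-1 x 1 1 (is_derive_id _ _).
  have h2 := @is_deriveZ _ _ _ (fun t : R => sin (2 * t)) 4^-1 x 1 _ (is_derive_sinZ 2 x).
  have h := is_deriveB h1 h2.
  apply: is_derive_eq; rewrite /GRing.scale /= mulr1 mul1r.
  have -> : 2 * x = x + x by rewrite mulr_natl mulr2n.
  by rewrite cosD; have := cos2Dsin2 x; lra.
rewrite (ipi_FTC (@continuous_sin_sinZ _) d).
by rewrite !mulr0 sin0 (sin_natpi 2) !mulr0 !subr0 mulrC.
Qed.

Lemma ipi_sin_sin0 k : ipi (fun t : R => sin (k.+2%:R * t) * sin t) = 0.
Proof.
have k1 : (k.+1%:R : R) != 0 by rewrite pnatr_eq0.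
have k3 : (k.+3%:R : R) != 0 by rewrite pnatr_eq0.
have d (x : R) : is_derive x 1 (fun t => (2 * k.+1%:R)^-1 * sin (k.+1%:R * t)
    - (2 * k.+3%:R)^-1 * sin (k.+3%:R * t)) (sin (k.+2%:R * x) * sin x).
  have h1 := @is_deriveZ _ _ _ (fun t : R => sin (k.+1%:R * t)) (2 * k.+1%:R)^-1 x 1 _ (is_derive_sinZ _ x).
  have h2 := @is_deriveZ _ _ _ (fun t : R => sin (k.+3%:R * t)) (2 * k.+3%:R)^-1 x 1 _ (is_derive_sinZ _ x).
  have h := is_deriveB h1 h2.
  apply: is_derive_eq; rewrite /GRing.scale /=.
  have -> : (2 * k.+1%:R)^-1 * (k.+1%:R * cos (k.+1%:R * x)) = 2^-1 * cos (k.+1%:R * x).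
    by field.
  have -> : (2 * k.+3%:R)^-1 * (k.+3%:R * cos (k.+3%:R * x)) = 2^-1 * cos (k.+3%:R * x).
    by field.
  have -> : k.+3%:R * x = k.+2%:R * x + x by rewrite -natr1 mulrDl mul1r.
  have -> : k.+1%:R * x = k.+2%:R * x - x by rewrite -[k.+2%:R]natr1 mulrDl mul1r addrK.
  by rewrite cosB cosD; field.
rewrite (ipi_FTC (@continuous_sin_sinZ _) d).
by rewrite !sin_natpi !mulr0 sin0 !mulr0 !subr0.
Qed.

End sine_moments.

Section quadratic.
Context {R : realType}.

(** The roots of the quadratic have product 1. If neither were inside the unit disk, both would lie
    on the circle and be conjugate, so their sum [- z] would be real. The sign of [Im m] follows
    from [Im z = Im m * ((normsq m)^-1 - 1)]. *)
Lemma exists_small_root (z : R[i]) : 0 < Im z ->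
  exists m : R[i], [/\ m * (m + z) = -1, normc m < 1 & 0 < Im m].
Proof.
move=> z0.
have [m [mE m1]] : exists m : R[i], m * (m + z) = -1 /\ normc m < 1.
  set w := sqrtc (z ^+ 2 - 4).
  have w2 : w ^+ 2 = z ^+ 2 - 4 by exact: sqr_sqrtc.
  set a := (- z + w) / 2; set b := (- z - w) / 2.
  have aE : a * (a + z) = -1.
    have -> : a * (a + z) = (w ^+ 2 - z ^+ 2) / 4 by rewrite /a; field.
    by rewrite w2; field.
  have bE : b * (b + z) = -1.
    have -> : b * (b + z) = (w ^+ 2 - z ^+ 2) / 4 by rewrite /b; field.
    by rewrite w2; field.
  have ab : a * b = 1.
    have -> : a * b = (z ^+ 2 - w ^+ 2) / 4 by rewrite /a /b; field.
    by rewrite w2; field.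
  have [|a1] := ltP (normc a) 1; first by exists a.
  have [|b1] := ltP (normc b) 1; first by exists b.
  exfalso; have nab : normc a * normc b = 1 by rewrite -Normc.normcM ab Normc.normc1.
  have na : normc a = 1.
    apply/eqP; rewrite eq_le a1 andbT -nab ler_peMr //; exact: normc_ge0.
  have zE : - z = a + b by rewrite /a /b; field.
  move: na ab zE z0; case: (a) (b) (z) => [a' b'] [c d] [e f] na.
  have n1 : a' ^+ 2 + b' ^+ 2 = 1 by have := normc_sq (a' +i* b'); rewrite na expr1n.
  move=> [ac ad] [ez fz] /= f0.
  have : d = - b' by have : (a' ^+ 2 + b' ^+ 2) * d = - b' * (a' * c - b' * d) + a' * (a' * d + b' * c); [ring|rewrite n1 ac ad; lra].
  by move=> db; move: fz; rewrite db; lra.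
exists m; split => //.
have m00 : m != 0.
  apply/eqP => m0; move: mE; rewrite m0 mul0r => /eqP.
  by rewrite eq_sym oppr_eq0 oner_eq0.
have zE : z = - m^-1 - m.
  by apply: (mulfI m00); rewrite mulrBr mulrN mulfV // -mE; ring.
have n1 : normsq m < 1 by rewrite -normc_sq expr_lt1 // normc_ge0.
have n0 : 0 < normsq m.
  rewrite lt_def normsq_ge0 andbT -normc_sq expf_eq0 /=; apply/eqP => /Normc.eq0_normc m0.
  by rewrite m0 eqxx in m00.
move: z0; rewrite zE ImD Im_opp_inv.
have -> : Im (- m) = - Im m by case: (m).
have -> : Im m / normsq m - Im m = Im m * ((normsq m)^-1 - 1) by ring.
by rewrite pmulr_lgt0 // subr_gt0 invf_gt1.
Qed.

Lemma bounded_geometric (q B c : R) : 0 <= q < 1 ->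
  (forall n, c <= B * q ^+ n) -> c <= 0.
Proof.
move=> /andP[q0 q1] H.
have cv : (B * q ^+ n) @[n --> \oo] --> B * 0.
  by apply: cvgMl_tmp; apply: cvg_expr; rewrite ger0_norm.
by rewrite -(mulr0 B); apply: (cvgr_to_ge cv); exact: nearW.
Qed.

End quadratic.

Section semicircle.
Context {R : realType}.
Local Notation mu := (@lebesgue_measure R).

(** The decreasing substitution [x = 2 cos t]: the density and the Jacobian each contribute
    [2 sin t]. *)
Lemma semicircle_integral (G0 : R -> R) : continuous G0 ->
  \int[mu]_x (semicircle_pdf x * G0 x) =
  2 / pi * ipi (fun t => sin t * sin t * G0 (2 * cos t)).
Proof.
move=> cG.
pose g (x : R) := (2 * pi)^-1 * Num.sqrt (4 - x ^+ 2) * G0 x.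
have cg : continuous g.
  move=> x; apply: cvgM; last exact: cG.
  apply: cvgMl_tmp; apply: continuous_comp; last exact: sqrt_continuous.
  by apply: cvgB; [exact: cvg_cst|exact: exprn_continuous].
pose F (t : R) := 2 * cos t.
have dF (x : R) : is_derive x 1 F (- 2 * sin x).
  have h := @is_deriveZ _ _ _ (@cos R) 2 x 1 _ (is_derive_cos x).
  by apply: is_derive_eq; rewrite /GRing.scale /=; ring.
have F1 : (F^`())%classic = (fun x => - 2 * sin x).
  by apply/funext => x; rewrite derive1E; apply: derive_val.
have cF1 : continuous (fun x : R => - 2 * sin x).
  by move=> x; apply: cvgMl_tmp; exact: continuous_sin.
have cF : continuous F by move=> x; apply: cvgMl_tmp; exact: continuous_cos.
have pi0 : 0 < pi :> R by exact: pi_gt0.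
transitivity (\int[mu]_(x in `[-2, 2]) g x).
  rewrite [RHS]Rintegral_mkcond; apply: eq_Rintegral => x _.
  rewrite patchE /semicircle_pdf /g indicE.
  have -> : (x \in [set y : R | `|y| <= 2]) = (x \in `[(-2)%R, 2%R]%classic).
    by apply/idP/idP; rewrite !inE /= in_itv /= ler_norml.
  by case: ifPn; rewrite ?mulr1 ?mulr0 ?mul0r.
have F0 : F 0 = 2 by rewrite /F cos0 mulr1.
have Fpi : F pi = -2 by rewrite /F cospi mulrN1.
rewrite /ipi -RintegralZl //; last first.
  apply: integrable_ipi => t; apply: cvgM.
    by apply: cvgM; exact: continuous_sin.
  by apply: (@continuous_comp _ _ _ F G0); [exact: cF|exact: cG].
rewrite /Rintegral; congr fine.
have -> : `[(-2)%R, 2%R]%classic = `[F pi, F 0]%classic by rewrite F0 Fpi.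
rewrite integration_by_substitution_decreasing ?(ltW pi0) //.
- apply: eq_integral => t; rewrite inE /= in_itv /= => /andP[t0 tpi].
  rewrite F1 /g /F /=; congr EFin.
  change ((2 * pi)^-1 * Num.sqrt (4 - (2 * cos t) ^+ 2) * G0 (2 * cos t) * (- (- 2 * sin t)) =
    2 / pi * (sin t * sin t * G0 (2 * cos t))).
  have st : 0 <= sin t by rewrite sin_ge0_pi // t0.
  have -> : 4 - (2 * cos t) ^+ 2 = (2 * sin t) ^+ 2 by have := cos2Dsin2 t; lra.
  rewrite sqrtr_sqr ger0_norm ?mulr_ge0 //.
  by move: (pi : R) (lt0r_neq0 pi0) => P P0; field.
- move=> x y xI yI xy; rewrite /F ltr_pM2l // ltr_cos //.
- by move=> x _; rewrite F1; exact: cF1.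
- rewrite F1; apply/cvg_ex; exists (- 2 * sin 0); exact/cvg_at_right_filter/cF1.
- rewrite F1; apply/cvg_ex; exists (- 2 * sin pi); exact/cvg_at_left_filter/cF1.
- split; first by move=> x _; exact: ex_derive.
  + exact/cvg_at_right_filter/cF.
  + exact/cvg_at_left_filter/cF.
- exact: continuous_subspaceT.
Qed.

End semicircle.

Section stieltjes.
Context {R : realType}.
Variable z : R[i].
Hypothesis z0 : 0 < Im z.

Let q (x : R) : R := (x - Re z) ^+ 2 + Im z ^+ 2.
Let kre (x : R) : R := (x - Re z) / q x.
Let kim (x : R) : R := Im z / q x.

Let q_gt0 x : 0 < q x.
Proof. by rewrite /q ltr_wpDl ?sqr_ge0 // exprn_gt0. Qed.

Let continuous_q : continuous q.
Proof.
move=> x; apply: cvgD; last exact: cvg_cst.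
have c : continuous (fun x : R => x - Re z).
  by move=> y; apply: cvgB; [exact: cvg_id|exact: cvg_cst].
rewrite (_ : (fun x : R => (x - Re z) ^+ 2) = (fun x => (x - Re z) * (x - Re z))).
  by apply: cvgM; exact: c.
by apply/funext => y; rewrite expr2.
Qed.

Let continuous_kre : continuous kre.
Proof.
move=> x; apply: cvgM.
  by apply: cvgB; [exact: cvg_id|exact: cvg_cst].
by apply: cvgV; [rewrite gt_eqF|exact: continuous_q].
Qed.

Let continuous_kim : continuous kim.
Proof.
move=> x; apply: cvgMl_tmp.
by apply: cvgV; [rewrite gt_eqF|exact: continuous_q].
Qed.

Let kre_le x : `|kre x| <= (Im z)^-1.
Proof.
rewrite normrM normfV (gtr0_norm (q_gt0 x)) ler_pdivrMr // ler_pdivlMl //.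
rewrite /q; move: (x - Re z) => a; rewrite -[a ^+ 2]real_normK ?num_real //.
by have := sqr_ge0 (`|a| - Im z); have := sqr_ge0 `|a|; nra.
Qed.

Let kim_le x : `|kim x| <= (Im z)^-1.
Proof.
rewrite normrM normfV (gtr0_norm (q_gt0 x)) ler_pdivrMr // ler_pdivlMl //.
by rewrite (gtr0_norm z0) -expr2 /q lerDr sqr_ge0.
Qed.

(** Since [sin (n t) / sin t] is a Chebyshev polynomial of the second kind in [cos t], this is, up
    to the factor [2 / pi], the integral of [k] times that polynomial against the semicircle law;
    [kre] and [kim] are the two parts of [(x - z)^-1]. *)
Let b (k : R -> R) (n : nat) : R :=
  ipi (fun t => sin (n%:R * t) * sin t * k (2 * cos t)).

Let cos2 : continuous (fun t : R => 2 * cos t).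
Proof. by move=> t; apply: cvgMl_tmp; exact: continuous_cos. Qed.

Let continuous_b (k : R -> R) (n : nat) : continuous k ->
  continuous (fun t : R => sin (n%:R * t) * sin t * k (2 * cos t)).
Proof.
move=> ck t; apply: cvgM; first exact: continuous_sin_sinZ.
by apply: (@continuous_comp _ _ _ (fun t => 2 * cos t) k); [exact: cos2|exact: ck].
Qed.

Let b_le (k : R -> R) n : continuous k -> (forall x, `|k x| <= (Im z)^-1) ->
  `|b k n| <= (Im z)^-1 * pi.
Proof.
move=> ck kle; apply: normr_ipi_le; first exact: continuous_b.
move=> t; rewrite normrM -[X in _ <= X]mul1r; apply: ler_pM => //.
rewrite normrM -[X in _ <= X]mul1r.
by apply: ler_pM => //; rewrite ler_norml sin_geN1 sin_le1.
Qed.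

Let sin_rec (n : nat) (t : R) :
  sin (n.+2%:R * t) + sin (n%:R * t) = 2 * cos t * sin (n.+1%:R * t).
Proof.
have -> : n.+2%:R * t = n.+1%:R * t + t by rewrite -natr1 mulrDl mul1r.
have -> : n%:R * t = n.+1%:R * t - t by rewrite -[n.+1%:R]natr1 mulrDl mul1r addrK.
by rewrite sinD sinB; ring.
Qed.

Let cZ (a : R) k m : continuous k ->
  continuous (fun t : R => a * (sin (m%:R * t) * sin t * k (2 * cos t))).
Proof. by move=> ck t; apply: cvgMl_tmp; exact: continuous_b. Qed.

Let s (n : nat) : R := ipi (fun t : R => sin (n%:R * t) * sin t).

Let b_rec_re n : b kre n.+2 + b kre n =
  s n.+1 + (Re z * b kre n.+1 + (- Im z) * b kim n.+1).
Proof.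
rewrite /b -ipiD; [|exact: continuous_b|exact: continuous_b].
rewrite -!ipiZ; [|exact: continuous_b|exact: continuous_b].
rewrite -ipiD; [|exact: cZ|exact: cZ].
rewrite /s -ipiD; [|exact: continuous_sin_sinZ|]; last first.
  by move=> t; apply: cvgD; exact: cZ.
apply: eq_ipi => t _; rewrite -!mulrDl sin_rec /kre /kim.
have := q_gt0 (2 * cos t).
rewrite /q; move: (2 * cos t) (sin t) (sin _) => x S T q0.
by field; rewrite gt_eqF.
Qed.

Let b_rec_im n : b kim n.+2 + b kim n =
  Im z * b kre n.+1 + Re z * b kim n.+1.
Proof.
rewrite /b -ipiD; [|exact: continuous_b|exact: continuous_b].
rewrite -!ipiZ; [|exact: continuous_b|exact: continuous_b].
rewrite -ipiD; [|exact: cZ|exact: cZ].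
apply: eq_ipi => t _; rewrite -!mulrDl sin_rec /kre /kim.
have := q_gt0 (2 * cos t).
rewrite /q; move: (2 * cos t) (sin t) (sin _) => x S T q0.
by field; rewrite gt_eqF.
Qed.

Let B n : R[i] := b kre n +i* b kim n.

(** The three-term recurrence of the sines produces a factor [x = 2 cos t], and
    [x / (x - z) = 1 + z / (x - z)]; the 1 gives the source term [s], which orthogonality kills
    except at [n = 0]. *)
Let B_rec n : B n.+2 + B n = (s n.+1)%:C + z * B n.+1.
Proof.
have := b_rec_re n; have := b_rec_im n; rewrite /B; case: (z) => e f /= h1 h2.
by apply/eqP; rewrite eq_complex /= h1 h2; apply/andP; split; apply/eqP; ring.
Qed.

Let B0 : B 0 = 0.
Proof.
have b0 k : b k 0 = 0.
  rewrite /b (eq_ipi (g := fun t => 0 * (0 : R))); last first.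
    by move=> t _; rewrite mul0r sin0 !mul0r.
  by rewrite ipiZ ?mul0r //; exact: cst_continuous.
by rewrite /B !b0.
Qed.

Let B_le n : normc (B n) <= 2 * ((Im z)^-1 * pi).
Proof.
have h1 := b_le n continuous_kre kre_le; have h2 := b_le n continuous_kim kim_le.
set M := (Im z)^-1 * pi in h1 h2 *.
have M0 : 0 <= M by apply: le_trans h1.
rewrite -ler_sqr ?nnegrE ?normc_ge0 ?mulr_ge0 ?pi_ge0 ?invr_ge0 ?(ltW z0) //.
have -> : normc (B n) ^+ 2 = b kre n ^+ 2 + b kim n ^+ 2 by exact: (normc_sq (B n)).
rewrite -[b kre n ^+ 2]real_normK ?num_real // -[b kim n ^+ 2]real_normK ?num_real //.
have := normr_ge0 (b kre n); have := normr_ge0 (b kim n); nra.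
Qed.

(* With x = 2 cos t, the transforms B n of sin (n t) sin t satisfy
   B (n+2) + B n = z B (n+1) for n >= 1; being bounded, they decay like m ^ n. *)
Lemma ipi_stieltjes (m : R[i]) : m * (m + z) = -1 -> normc m < 1 ->
  B 1 = m * (pi / 2)%:C.
Proof.
move=> mE m1.
(* [c] factors out one root of the characteristic equation and so is geometric of ratio [- m^-1],
   which has modulus above 1; boundedness makes it vanish. It starts at index 1 because the source
   term survives in the first recurrence. *)
pose c n := B n.+1 + m * B n.
have cS n : m * c n.+2 = - c n.+1.
  rewrite /c.
  have -> : B n.+3 = z * B n.+2 - B n.+1.
    by rewrite -[LHS](addrK (B n.+1)) B_rec /s ipi_sin_sin0 add0r.
  have -> : m * (z * B n.+2 - B n.+1 + m * B n.+2) = m * (m + z) * B n.+2 - m * B n.+1.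
    by ring.
  by rewrite mE; ring.
have cn n : c 1%N = (- m) ^+ n * c n.+1.
  elim: n => [|n IHn]; first by rewrite expr0 mul1r.
  by rewrite IHn exprSr -mulrA mulNr cS opprK.
have c1 : c 1%N = 0.
  apply: Normc.eq0_normc; apply/eqP; rewrite eq_le normc_ge0 andbT.
  apply: (@bounded_geometric _ (normc m) (2 * (2 * ((Im z)^-1 * pi)))).
    by rewrite normc_ge0.
  move=> n; rewrite (cn n) Normc.normcM.
  have -> : normc ((- m) ^+ n) = normc m ^+ n.
    elim: n => [|n IHn]; first by rewrite !expr0 Normc.normc1.
    by rewrite !exprS Normc.normcM IHn normcN.
  rewrite mulrC ler_wpM2r ?exprn_ge0 ?normc_ge0 //.
  apply: (le_trans (le_normcD _ _)); rewrite mulrDl mul1r; apply: lerD => //.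
  rewrite Normc.normcM -[X in _ <= X]mul1r; apply: ler_pM; rewrite ?normc_ge0 //.
  exact: ltW.
have h1 : B 2 = - m * B 1.
  by apply/eqP; rewrite -subr_eq0 mulNr opprK; apply/eqP.
have h2 : B 2 = (pi / 2)%:C + z * B 1.
  by have := B_rec 0; rewrite B0 addr0 /s ipi_sin_sin1.
have h3 : (m + z) * B 1 = - (pi / 2)%:C.
  have : - m * B 1 = (pi / 2)%:C + z * B 1 by rewrite -h1 h2.
  by move=> /(congr1 (fun a => - a - (pi / 2)%:C + (pi / 2)%:C)) h; rewrite mulrDl; move: h; rewrite mulNr opprK => h; rewrite -[m * _](subrK (pi / 2)%:C) h; ring.
apply/eqP; rewrite -subr_eq0; apply/eqP.
have -> : B 1 - m * (pi / 2)%:C = - (m * (m + z) * B 1 + m * (pi / 2)%:C).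
  by rewrite mE; ring.
by rewrite -mulrA h3 mulrN addNr oppr0.
Qed.

Lemma Gamma_eq (m : R[i]) : m * (m + z) = -1 -> normc m < 1 -> Gamma z = m.
Proof.
move=> mE m1.
have pi0 : (pi : R) != 0 by rewrite gt_eqF // pi_gt0.
have -> : Gamma z = (2 / pi)%:C * B 1.
  rewrite /Gamma /complex_integral.
  have e (x : R) : (semicircle_pdf x)%:C / (x%:C - z) =
      (semicircle_pdf x * kre x) +i* (semicircle_pdf x * kim x).
    have -> : (x%:C - z)^-1 = kre x +i* kim x.
      rewrite /kre /kim /q; case: (z) => e f.
      by apply/eqP; rewrite eq_complex /= !add0r !sqrrN !mulNr !opprK !eqxx.
    by apply/eqP; rewrite eq_complex /= !mul0r subr0 addr0 !eqxx.
  under eq_Rintegral do rewrite e /=.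
  under [X in _ +i* X]eq_Rintegral do rewrite e /=.
  rewrite !semicircle_integral // /B; simpc.
  have eb k : ipi (fun t => sin t * sin t * k (2 * cos t)) = b k 1.
    by apply: eq_ipi => t _; rewrite mul1r.
  by rewrite !eb.
rewrite (ipi_stieltjes mE m1) mulrCA -rmorphM.
have -> : 2 / pi * (pi / 2) = 1 :> R by move: (pi : R) pi0 => P P0; field.
by rewrite mulr1.
Qed.

End stieltjes.

Section Gamma_facts.
Context {R : realType}.
Implicit Types (z : R[i]) (E : R).

Lemma Gamma_fixed_point z : 0 < Im z ->
  0 < Im (Gamma z) /\ Gamma z = - (z + Gamma z)^-1.
Proof.
move=> z0; have [m [mE m1 m0]] := exists_small_root z0.
rewrite (Gamma_eq z0 mE m1); split=> //.
have zm : z + m != 0.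
  apply/eqP => h; move: mE; rewrite [m + z]addrC h mulr0 => /eqP.
  by rewrite eq_sym oppr_eq0 oner_eq0.
by apply: (mulIf zm); rewrite mulNr mulVf // addrC mE.
Qed.

(** Imaginary parts in the fixed-point equation: [Im G * normsq (z + G) = Im z + Im G], so
    [normsq (z + G)] exceeds 1. *)
Lemma Gamma_normsq_lt1 z : 0 < Im z -> normsq (Gamma z) < 1.
Proof.
move=> z0; have [G0 GE] := Gamma_fixed_point z0.
have zG0 : 0 < Im (z + Gamma z) by rewrite ImD addr_gt0.
have n0 := normsq_gt0 zG0.
rewrite [in X in X < _]GE normsq_opp_inv // invf_lt1 //.
rewrite -(ltr_pM2l G0) mulr1.
have -> : Im (Gamma z) * normsq (z + Gamma z) = Im (z + Gamma z).
  by rewrite {1}GE Im_opp_inv divfK // gt_eqF.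
by rewrite ImD ltrDr.
Qed.

(** Real parts in the fixed-point equation give [Re G * (1 + normsq G) = - Re z * normsq G], and
    [2 * normc G <= 1 + normsq G]. Moreover [normsq (z + G) <= 2 * 5 + 2 = 12], so
    [normsq G >= 1 / 12]; removing the real part bounds the square of [Im G], which is at most
    [Im G]. *)
Lemma Gamma_bounds E z : 0 < E -> E < 2 -> half_strip E z ->
  (1 - E / 2) / 12 <= Im (Gamma z) /\ `|Re (Gamma z)| <= E / 2 * normc (Gamma z).
Proof.
move=> E0 E2 [z0 [/andP[zE1 zE2] z1]].
rewrite /upper_half_plane /= in z0.
have [G0 GE] := Gamma_fixed_point z0; have G1 := Gamma_normsq_lt1 z0.
set G := Gamma z in G0 GE G1 *.
have zG0 : 0 < Im (z + G) by rewrite ImD addr_gt0.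
have n0 := normsq_gt0 zG0.
have nG0 := normsq_gt0 G0.
have nG : normsq G * normsq (z + G) = 1.
  by rewrite {1}GE normsq_opp_inv // mulVf // gt_eqF.
have n1 : normsq (z + G) = (normsq G)^-1.
  by apply: (mulfI (lt0r_neq0 nG0)); rewrite nG mulfV // gt_eqF.
have ReG : Re G = - ((Re z + Re G) * normsq G).
  by rewrite {1}GE Re_opp_inv n1 invrK ReD.
have zG : normsq (z + G) <= 12.
  apply: (le_trans (normsqD2 _ _)).
  have : normsq z <= 5 by rewrite /normsq; nra.
  by move: G1; lra.
have n12 : 1 / 12 <= normsq G.
  have : 12^-1 <= (normsq (z + G))^-1 by rewrite lef_pV2 ?posrE.
  by rewrite n1 invrK; lra.
have rn := normc_sq G; have r0 := normc_ge0 G.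
have a1 : `|Re G| * (1 + normsq G) <= E * normsq G.
  have e1 : `|1 + normsq G| = 1 + normsq G by rewrite ger0_norm // addr_ge0 // ltW.
  rewrite -[in leLHS]e1 -normrM.
  have -> : Re G * (1 + normsq G) = - (Re z * normsq G) by move: ReG; lra.
  rewrite normrN normrM [`|normsq G|]gtr0_norm // ler_wpM2r ?(ltW nG0) //.
  by rewrite ler_norml !ltW.
have aB : `|Re G| <= E / 2 * normc G.
  have n1p : 0 < 1 + normsq G by apply: ltr_pwDl => //; exact: ltW.
  rewrite -(ler_pM2r n1p).
  apply: (le_trans a1); rewrite -rn.
  have : 0 <= (normc G) * (1 - normc G) ^+ 2 by rewrite mulr_ge0 ?sqr_ge0.
  by move: (normc G) => r h; nra.
split; last exact: aB.
have aB2 : Re G ^+ 2 <= (E / 2) ^+ 2 * normsq G.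
  rewrite -rn -exprMn -[Re G ^+ 2]real_normK ?num_real //.
  by rewrite ler_sqr ?nnegrE ?mulr_ge0 ?(ltW E0).
have bn : Im G ^+ 2 = normsq G - Re G ^+ 2 by rewrite /normsq; ring.
have b2 : Im G ^+ 2 <= Im G.
  by move: G1 G0; rewrite /normsq; have := sqr_ge0 (Re G); nra.
apply: le_trans b2; rewrite bn.
move: aB2 n12; move: (normsq G) (Re G ^+ 2) => n a aB2 n12.
have : (1 - E / 2) * (1 / 12) <= (1 - (E / 2) ^+ 2) * n.
  apply: ler_pM => //; nra.
by lra.
Qed.

End Gamma_facts.

(** * Measurability and independence *)

Section measurability.
Context {R : realType}.
Context {d : measure_display} {T : measurableType d}.
Implicit Types (f g : T -> R[i]).

Lemma measurable_reim : measurable_fun setT (@reim R).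
Proof.
move=> _ B mB; rewrite setTI.
by exists B => //; rewrite setTI.
Qed.

Lemma measurable_Re : measurable_fun setT (@complex.Re R).
Proof. exact: (measurableT_comp (@measurable_fst _ _ R R) measurable_reim). Qed.

Lemma measurable_Im : measurable_fun setT (@complex.Im R).
Proof. exact: (measurableT_comp (@measurable_snd _ _ R R) measurable_reim). Qed.

Lemma measurable_Re_comp f : measurable_fun setT f ->
  measurable_fun setT (fun w => Re (f w)).
Proof. by move=> mf; exact: (measurableT_comp measurable_Re mf). Qed.

Lemma measurable_Im_comp f : measurable_fun setT f ->
  measurable_fun setT (fun w => Im (f w)).
Proof. by move=> mf; exact: (measurableT_comp measurable_Im mf). Qed.

Lemma measurable_complexP f : measurable_fun setT (fun w => Re (f w)) ->
  measurable_fun setT (fun w => Im (f w)) -> measurable_fun setT f.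
Proof.
move=> mr mi _ A [B mB <-]; rewrite !setTI.
have := measurable_fun_pair mr mi.
by move=> /(_ measurableT B mB); rewrite setTI.
Qed.

Lemma measurable_complexD f g : measurable_fun setT f -> measurable_fun setT g ->
  measurable_fun setT (fun w => f w + g w).
Proof.
move=> mf mg; apply: measurable_complexP.
- under eq_fun do rewrite ReD.
  by apply: measurable_funD; exact: measurable_Re_comp.
- under eq_fun do rewrite ImD.
  by apply: measurable_funD; exact: measurable_Im_comp.
Qed.

Lemma measurable_complexM f g : measurable_fun setT f -> measurable_fun setT g ->
  measurable_fun setT (fun w => f w * g w).
Proof.
move=> mf mg.
have ReM (a b : R[i]) : Re (a * b) = Re a * Re b - Im a * Im b by case: a; case: b.
have ImM (a b : R[i]) : Im (a * b) = Re a * Im b + Im a * Re b by case: a; case: b.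
apply: measurable_complexP.
- under eq_fun do rewrite ReM.
  by apply: measurable_funB; apply: measurable_funM;
    do ?[exact: measurable_Re_comp|exact: measurable_Im_comp].
- under eq_fun do rewrite ImM.
  by apply: measurable_funD; apply: measurable_funM;
    do ?[exact: measurable_Re_comp|exact: measurable_Im_comp].
Qed.

Lemma measurable_normsq f : measurable_fun setT f ->
  measurable_fun setT (fun w => normsq (f w)).
Proof.
move=> mf; apply: measurable_funD; apply: measurable_funX.
  exact: measurable_Re_comp.
exact: measurable_Im_comp.
Qed.

Lemma measurable_invr (h : T -> R) : measurable_fun setT h ->
  measurable_fun setT (fun w => (h w)^-1).
Proof.
move=> mh; rewrite (_ : (fun w => _) = (fun w => h w * (h w ^+ 2) `^ (-1))).
  apply: measurable_funM => //.
  by apply: (measurableT_comp (measurable_powR (-1))); exact: measurable_funX.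
apply/funext => w; rewrite powR_inv1 ?sqr_ge0 //.
have [->|h0] := eqVneq (h w) 0; first by rewrite invr0 mul0r.
by field.
Qed.

Lemma measurable_normc f : measurable_fun setT f ->
  measurable_fun setT (fun w => normc (f w)).
Proof.
move=> mf; rewrite (_ : (fun w => _) = (fun w => Num.sqrt (normsq (f w)))).
  apply: (measurableT_comp _ (measurable_normsq mf)).
  by apply: continuous_measurable_fun; exact: sqrt_continuous.
by apply/funext => w; case: (f w).
Qed.

Lemma measurable_opp_inv f : measurable_fun setT f ->
  measurable_fun setT (fun w => - (f w)^-1).
Proof.
move=> mf; apply: measurable_complexP.
- under eq_fun do rewrite Re_opp_inv.
  apply: measurableT_comp => //; apply: measurable_funM; first exact: measurable_Re_comp.
  exact/measurable_invr/measurable_normsq.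
- under eq_fun do rewrite Im_opp_inv.
  apply: measurable_funM; first exact: measurable_Im_comp.
  exact/measurable_invr/measurable_normsq.
Qed.

Lemma measurable_hyp f g : measurable_fun setT f -> measurable_fun setT g ->
  measurable_fun setT (fun w => hyp (f w) (g w)).
Proof.
move=> mf mg; rewrite /hyp; apply: measurable_funM.
  apply: measurable_normsq.
  rewrite (_ : (fun w => _) = (fun w => f w + (-1)%:C * g w)).
    apply: measurable_complexD => //; apply: measurable_complexM => //.
  by apply/funext => w; rewrite rmorphN1 mulN1r.
apply: measurable_invr; apply: measurable_funM; exact: measurable_Im_comp.
Qed.

End measurability.

Section laws.
Context {R : realType}.
Local Open Scope ereal_scope.

Lemma eq_law_integral d1 d2 d (T1 : measurableType d1) (T2 : measurableType d2)
    (S : measurableType d) (P1 : probability T1 R) (X1 : T1 -> S)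
    (P2 : probability T2 R) (X2 : T2 -> S) (f : S -> \bar R) :
  eq_law P1 X1 P2 X2 -> measurable_fun setT X1 -> measurable_fun setT X2 ->
  measurable_fun setT f -> (forall x, 0 <= f x) ->
  \int[P1]_w f (X1 w) = \int[P2]_w f (X2 w).
Proof.
move=> H m1 m2 mf f0.
pose Y1 : {mfun T1 >-> S} := HB.pack X1 (isMeasurableFun.Build _ _ _ _ _ m1).
pose Y2 : {mfun T2 >-> S} := HB.pack X2 (isMeasurableFun.Build _ _ _ _ _ m2).
have e1 := @ge0_integral_pushforward _ _ _ _ R X1 m1 P1 setT f measurableT mf (fun y _ => f0 y).
have e2 := @ge0_integral_pushforward _ _ _ _ R X2 m2 P2 setT f measurableT mf (fun y _ => f0 y).
rewrite !preimage_setT in e1 e2.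
rewrite -[LHS]e1 -[RHS]e2.
apply: (@eq_measure_integral _ _ _ setT (pushforward P2 Y2) (pushforward P1 Y1)) => A mA _.
exact: H.
Qed.

Variables (d : measure_display) (T : measurableType d) (P : probability T R).

Lemma eq_law_setT d' (T' : measurableType d') (P' : probability T' R) d''
   (S : measurableType d'') (X : T -> S) (X' : T' -> S) (A : set S) :
  eq_law P X P' X' -> measurable A -> (forall w, A (X' w)) ->
  P (X @^-1` A) = 1.
Proof.
move=> H mA HA; rewrite H // -(@probability_setT _ _ R P'); congr (P' _).
by apply/seteqP; split=> // w _; exact: HA.
Qed.

Lemma prob_setI1 (A B : set T) : measurable A -> measurable B ->
  P A = 1 -> P B = 1 -> P (A `&` B) = 1.
Proof.
move=> mA mB A1 B1.
have: P (~` (A `&` B)) <= 0.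
  have h : P (~` A `|` ~` B) <= P (~` A) + P (~` B).
    by apply: measureU2; exact: measurableC.
  rewrite setCI; apply: (le_trans h).
  by rewrite !probability_setC // A1 B1 subee // adde0.
rewrite probability_setC; last exact: measurableI.
rewrite sube_le0 => h; apply/eqP; rewrite eq_le h andbT.
by apply: probability_le1; exact: measurableI.
Qed.

Lemma prob_bigcap1 (A : nat -> set T) : (forall i, measurable (A i)) ->
  (forall i, P (A i) = 1) -> P (\bigcap_i A i) = 1.
Proof.
move=> mA A1; have mI : measurable (\bigcap_i A i) by exact: bigcapT_measurable.
have: P (~` (\bigcap_i A i)) <= 0.
  rewrite setC_bigcap.
  have mC i : measurable (~` A i) by exact: measurableC.
  have h := @measure_sigma_subadditive _ _ _ P (\bigcup_i ~` A i) (fun i => ~` A i) mC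
    (bigcupT_measurable _ mC) (@subset_refl _ _).
  apply: (le_trans h); rewrite eseries0 // => i _ _.
  by rewrite /= probability_setC // A1 subee.
rewrite probability_setC // sube_le0 => h.
by apply/eqP; rewrite eq_le probability_le1.
Qed.

Lemma ae_le_integral (D : set T) (f g : T -> \bar R) :
  measurable D -> P D = 1 ->
  measurable_fun setT f -> measurable_fun setT g ->
  (forall w, 0 <= f w) -> (forall w, 0 <= g w) ->
  (forall w, D w -> f w <= g w) ->
  \int[P]_w f w <= \int[P]_w g w.
Proof.
move=> mD D1 mf mg f0 g0 fg.
have D0 : P (~` D) = 0 by rewrite probability_setC // D1 subee.
have mD' : measurable_fun setT (fun w => (\1_D w)%:E : \bar R).
  by apply/measurable_EFinP; exact: measurable_indic.
have mfD : measurable_fun setT (fun w => f w * (\1_D w)%:E) by exact: emeasurable_funM.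
have -> : \int[P]_w f w = \int[P]_w (f w * (\1_D w)%:E).
  apply: ge0_ae_eq_integral => //.
    by move=> w _; rewrite mule_ge0 // lee_fin.
  exists (~` D); split; [exact: measurableC|exact: D0|].
  move=> w /= H Dw; apply: H => _; rewrite indicE mem_set // mule1 //.
apply: ge0_le_integral => //.
  by move=> w _; rewrite mule_ge0 // lee_fin.
move=> w _; rewrite indicE; case: (boolP (w \in D)) => wD.
  by rewrite mule1 fg //; rewrite inE in wD.
by rewrite mule0.
Qed.

End laws.

Local Notation push_measure :=
  measure_function_pushforward__canonical__measure_function_Measure.

(* Canonical structure inference does not see the product of two probability
   measures as sigma-finite. *)
Definition prob_sqr {R : realType} (mu : probability R[i] R) :
    probability (R[i] * R[i])%type R :=
  lebesgue_integral_fubini_product_measure1__canonical__probability_measure_Probability mu mu.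

Lemma prob_sqr_integral {R : realType} (mu : probability R[i] R)
    (f : R[i] * R[i] -> \bar R) :
  measurable_fun setT f -> (forall a, (0 <= f a)%E) ->
  (\int[prob_sqr mu]_y f y = \int[mu]_a \int[mu]_b f (a, b))%E.
Proof.
move=> mf f0; rewrite -[RHS](@fubini_tonelli1 _ _ _ _ R mu mu f mf f0).
exact: eq_measure_integral.
Qed.

Lemma measurable_natcomp d (T : measurableType d) d' (S : measurableType d')
    (F : nat -> T -> S) (N : T -> nat) :
  (forall n, measurable_fun setT (F n)) -> measurable_fun setT N ->
  measurable_fun setT (fun w => F (N w) w).
Proof.
move=> mF mN _ A mA; rewrite setTI.
have -> : (fun w => F (N w) w) @^-1` A =
    \bigcup_n ((N @^-1` [set n]) `&` (F n @^-1` A)).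
  apply/seteqP; split => [w Aw|w [n _ [/= <-]]//].
  by exists (N w).
apply: bigcupT_measurable => n; apply: measurableI.
  by have := mN measurableT [set n]; rewrite setTI; apply.
by have := mF n measurableT _ mA; rewrite setTI.
Qed.

Lemma measurable_avg (R : realType) d (T : measurableType d) (F : nat -> nat -> T -> R)
    (N : T -> nat) :
  (forall n i, measurable_fun setT (F n i)) -> measurable_fun setT N ->
  measurable_fun setT (fun w => avg (N w) (fun i => F (N w) i w)).
Proof.
move=> mF mN.
apply: (@measurable_natcomp _ _ _ _ (fun n w => avg n (fun i => F n i w))) => // n.
apply: measurable_funM => //.
by apply: measurable_sum => i; exact: mF.
Qed.

Lemma sume_cst (R : realType) n (c : \bar R) : (0 <= c)%E ->
  (\sum_(i < n) c = n%:R%:E * c)%E.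
Proof.
move=> c0; elim: n => [|n IHn]; first by rewrite big_ord0 mul0e.
by rewrite big_ord_recr /= IHn -natr1 EFinD ge0_muleDl ?mul1e // lee_fin.
Qed.

Section weights.
Context {R : realType}.
Implicit Types (p d lam : R).

Definition setE d lam : set (nat * R[i]) :=
  [set a | [/\ normc a.2 < lam, (2 <= a.1)%N & 1 - lam < a.1%:R / d < 1 + lam]].

Definition setF rho d lam : set (nat * R[i]) :=
  [set a | normc a.2 / rho < lam /\ 1 - lam < a.1%:R / d < 1 + lam].

Definition weight p d (a : nat * R[i]) : R :=
  (1 + normc a.2) `^ (2 * p) * (a.1%:R / d + d / a.1%:R) `^ p.

Lemma measurable_snd_normc : measurable_fun setT (fun a : nat * R[i] => normc a.2).
Proof. exact: (measurable_normc (@measurable_snd _ _ nat R[i])). Qed.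

Lemma measurable_nat_comp (f : nat -> R) :
  measurable_fun setT (fun a : nat * R[i] => f a.1).
Proof.
have mf : measurable_fun setT f by move=> _ B _.
exact: (measurableT_comp mf measurable_fst).
Qed.

Lemma measurable_bool_set (b : nat * R[i] -> bool) : measurable_fun setT b ->
  measurable [set a | b a].
Proof.
by move=> mb; rewrite -[X in measurable X]setTI; exact: (mb measurableT [set true]).
Qed.

Let measurable_ratio (d l : R) :
  measurable_fun setT (fun a : nat * R[i] => 1 - l < a.1%:R / d < 1 + l).
Proof.
have mr := measurable_nat_comp (fun n => n%:R / d).
by apply: measurable_and; exact: measurable_fun_ltr.
Qed.

Lemma measurable_setE d lam : measurable (setE d lam).
Proof.
have -> : setE d lam = [set a | [&& normc a.2 < lam, (1 < a.1)%N
    & 1 - lam < a.1%:R / d < 1 + lam]] by apply/seteqP; split=> a /and3P.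
apply: measurable_bool_set; apply: measurable_and; last apply: measurable_and => //.
  by apply: measurable_fun_ltr => //; exact: measurable_snd_normc.
have m : measurable_fun setT (fun n : nat => (1 < n)%N) by move=> _ B _.
exact: (measurableT_comp m measurable_fst).
Qed.

Lemma measurable_setF rho d lam : measurable (setF rho d lam).
Proof.
have -> : setF rho d lam = [set a | (normc a.2 / rho < lam)
    && (1 - lam < a.1%:R / d < 1 + lam)] by apply/seteqP; split=> a /andP.
apply: measurable_bool_set; apply: measurable_and => //; apply: measurable_fun_ltr => //.
by apply: measurable_funM => //; exact: measurable_snd_normc.
Qed.

Lemma measurable_weight p d : measurable_fun setT (weight p d).
Proof.
apply: measurable_funM.
  apply: (measurableT_comp (measurable_powR _)); apply: measurable_funD => //.
  exact: measurable_snd_normc.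
by apply: (measurableT_comp (measurable_powR _)); exact: (measurable_nat_comp (fun n => n%:R / d + d / n%:R)).
Qed.

Lemma weight_ge0 p d a : 0 <= weight p d a.
Proof. by rewrite mulr_ge0 ?powR_ge0. Qed.

(** The inverse of 0 is 0, so the weight vanishes without children; this is the vanishing that
    [avg_integral] asks for, an empty average being 0. *)
Lemma weight0 p d u : 0 < p -> weight p d (0, u) = 0.
Proof. by move=> p0; rewrite /weight /= mul0r invr0 mulr0 addr0 powR0 ?mulr0 // gt_eqF. Qed.

Lemma add_inv_ge1 (r : R) : 0 < r -> 1 <= r + r^-1.
Proof.
move=> r0; have ri : 0 < r^-1 by rewrite invr_gt0.
have e : r * r^-1 = 1 by rewrite mulfV // gt_eqF.
have [r1|r1] := leP 1 r; first by lra.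
by have : 1 <= r^-1; [rewrite invf_ge1 // ltW|lra].
Qed.

(** The weight is the [p]-th power of a base that is at least 1, so it also dominates lower powers:
    the single quantity [alpha] serves the second and the [p]-th moment. *)
Lemma weight_ge (p q d : R) a : 0 <= q <= p -> 0 < d -> (0 < a.1)%N ->
  ((1 + normc a.2) ^+ 2 * (a.1%:R / d + (a.1%:R / d)^-1)) `^ q <= weight p d a.
Proof.
move=> /andP[q0 qp] d0 a0; rewrite /weight invf_div.
have r0 : 0 < a.1%:R / d by rewrite divr_gt0 // ltr0n.
have := add_inv_ge1 r0; rewrite invf_div; set s := _ + _ => s1.
have n0 := normc_ge0 a.2.
have m1 : 1 <= (1 + normc a.2) ^+ 2 by rewrite exprn_ege1 // lerDl.
rewrite powRrM powR_mulrn ?addr_ge0 // -powRM ?sqr_ge0 //; last lra.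
by apply: ler_powR => //; nra.
Qed.

Lemma weight_ge1 (p d : R) a : 0 <= p -> 0 < d -> (0 < a.1)%N -> 1 <= weight p d a.
Proof.
move=> p0 d0 a0; have := @weight_ge p 0 d a; rewrite lexx p0 powRr0 => H.
exact: H.
Qed.

End weights.

Section potential.
Context {R : realType}.
Variable G : R[i].
Hypothesis G0 : 0 < Im G.

(* The absolute value only matters off the upper half plane, a null set. *)
Definition pot (G y : R[i]) : R := `|hyp y G|.

Lemma pot_ge0 y : 0 <= pot G y. Proof. exact: normr_ge0. Qed.

Lemma potE y : 0 < Im y -> pot G y = hyp y G.
Proof. by move=> y0; rewrite /pot ger0_norm // hyp_ge0. Qed.

Lemma measurable_pot_comp d' (T' : measurableType d') (f : T' -> R[i]) :
  measurable_fun setT f -> measurable_fun setT (fun w => pot G (f w)).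
Proof.
move=> mf; have mc : measurable_fun setT (fun _ : T' => G) by exact: measurable_cst.
by apply: (measurableT_comp _ (measurable_hyp mf mc)).
Qed.

Lemma measurable_potX (q : R) : measurable_fun setT (fun y : R[i] => pot G y `^ q).
Proof.
apply: (measurableT_comp (measurable_powR _)); exact: measurable_pot_comp.
Qed.

Lemma measurable_upper : measurable [set y : R[i] | 0 < Im y].
Proof.
have -> : [set y : R[i] | 0 < Im y] = (@complex.Im R) @^-1` `]0, +oo[%classic.
  by apply/seteqP; split=> y; rewrite /= in_itv /= andbT.
by rewrite -[X in measurable X]setTI; apply: measurable_Im.
Qed.

Lemma measurable_closed_upper : measurable [set y : R[i] | 0 <= Im y].
Proof.
have -> : [set y : R[i] | 0 <= Im y] = (@complex.Im R) @^-1` `[0, +oo[%classic.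
  by apply/seteqP; split=> y; rewrite /= in_itv /= andbT.
by rewrite -[X in measurable X]setTI; apply: measurable_Im.
Qed.

End potential.

Definition cst1 {R : realType} (c : R) : R := 3 + 32 / c ^+ 2.
Definition cst2 {R : realType} (c : R) : R := 36 / c ^+ 2.

Section one_step.
Context {R : realType}.
Variables (c : R) (G : R[i]).
Hypothesis c0 : 0 < c.
Hypothesis cG : c <= Im G.
Hypothesis G1 : normsq G <= 1.

Let G0 : 0 < Im G. Proof. exact: lt_le_trans cG. Qed.

Lemma cst1_gt0 : 0 < cst1 c.
Proof. by rewrite /cst1 ltr_wpDr // divr_ge0 // exprn_ge0 // ltW. Qed.

Lemma cst2_gt0 : 0 < cst2 c.
Proof. by rewrite /cst2 divr_gt0 // exprn_gt0. Qed.

Lemma hyp_step_on (lam r : R) (u h : R[i]) :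
  0 < lam <= 1 / 2 -> 1 - lam < r < 1 + lam -> normc u < lam ->
  0 <= Im u -> 0 < Im h ->
  hyp (r%:C * h + u) G <= (1 + cst1 c * lam) * hyp h G + cst1 c * lam.
Proof.
move=> l r1 ul u0 h0.
have ul2 : normsq u <= lam ^+ 2 by apply: normsq_le; exact: ltW.
apply: (le_trans (hyp_perturb c0 cG G1 l r1 ul2 u0 h0)).
rewrite lerD2l ler_wpM2r //; first by case/andP: l => /ltW.
by rewrite /cst1 lerDr.
Qed.

Lemma hyp_step_off (r q : R) (u h : R[i]) :
  0 < r -> 0 <= Im u -> 0 < Im h -> 0 <= q ->
  hyp (r%:C * h + u) G `^ q <=
    (2 * cst2 c) `^ q * ((1 + normc u) ^+ 2 * (r + r^-1)) `^ q * (1 + hyp h G `^ q).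
Proof.
move=> r0 u0 h0 q0.
have X0 : 0 <= hyp h G by exact: hyp_ge0.
have w0 : 0 < Im (r%:C * h + u) by rewrite ImD ImCM ltr_wpDr // mulr_gt0.
have r1 := add_inv_ge1 r0.
have W0 : 0 <= (1 + normc u) ^+ 2 * (r + r^-1).
  by rewrite mulr_ge0 ?sqr_ge0 //; lra.
have k0 := ltW cst2_gt0.
apply: (@le_trans _ _ ((cst2 c * ((1 + normc u) ^+ 2 * (r + r^-1)) * (1 + hyp h G)) `^ q)).
  by apply: powR_le => //; [exact: hyp_ge0|exact: hyp_perturb_crude].
have := @powRD_le R 1 (hyp h G) q q0 ler01 X0; rewrite powR1.
move: (hyp h G) X0 => X X0; move: (_ * (r + _)) W0 => W W0 H.
have X1 : 0 <= 1 + X by exact: addr_ge0.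
have kW : 0 <= cst2 c * W by exact: mulr_ge0.
have e1 : (cst2 c * W * (1 + X)) `^ q = cst2 c `^ q * W `^ q * (1 + X) `^ q.
  by rewrite (powRM _ kW X1) (powRM _ k0 W0).
have s2 : (0 : R) <= 2 by [].
rewrite e1 (powRM _ s2 k0).
rewrite [X in _ <= X](_ : _ = cst2 c `^ q * W `^ q * (2 `^ q * (1 + X `^ q))); last by ring.
by rewrite ler_wpM2l // mulr_ge0 ?powR_ge0.
Qed.

End one_step.

Lemma normsq_cavg_le (R : realType) n (x : nat -> R[i]) : (0 < n)%N ->
  normsq (cavg n x) <= avg n (fun i => normsq (x i)).
Proof.
move=> n0; rewrite /normsq Re_cavg Im_cavg avgD.
by apply: lerD; exact: sqr_avg_le.
Qed.

Lemma integral_cst_prob (R : realType) d (T : measurableType d) (P : probability T R)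
    (r : R) : (\int[P]_w r%:E = r%:E)%E.
Proof. by rewrite integral_cst // (_ : _ setT = 1%E) ?mule1 //; exact: probability_setT. Qed.

Section nonnegative_integrals.
Context {R : realType} {d : measure_display} {T : measurableType d}.
Variable m : {measure set T -> \bar R}.
Implicit Types f g : T -> R.

Lemma integralD_EFin f g : measurable_fun setT f -> measurable_fun setT g ->
  (forall w, 0 <= f w) -> (forall w, 0 <= g w) ->
  (\int[m]_w (f w + g w)%:E = \int[m]_w (f w)%:E + \int[m]_w (g w)%:E)%E.
Proof.
move=> mf mg f0 g0; under eq_integral do rewrite EFinD.
by apply: ge0_integralD => //; (by move=> w _; rewrite lee_fin) || exact/measurable_EFinP.
Qed.

Lemma integralZ_EFin (k : R) f : 0 <= k -> measurable_fun setT f ->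
  (forall w, 0 <= f w) ->
  (\int[m]_w (k * f w)%:E = k%:E * \int[m]_w (f w)%:E)%E.
Proof.
move=> k0 mf f0; under eq_integral do rewrite EFinM.
by apply: ge0_integralZl_EFin => //; (by move=> w _; rewrite lee_fin) || exact/measurable_EFinP.
Qed.

End nonnegative_integrals.

Lemma affine_integral_le (R : realType) d (T : measurableType d) (P : probability T R)
    (f F : T -> R) (k m B : R) :
  measurable_fun setT f -> measurable_fun setT F ->
  (forall w, 0 <= f w) -> (forall w, 0 <= F w) -> 0 <= k -> 0 <= m ->
  (forall w, F w <= k * f w + m) ->
  (\int[P]_w (f w)%:E <= B%:E)%E -> (\int[P]_w (F w)%:E <= (k * B + m)%:E)%E.
Proof.
move=> mf mF f0 F0 k0 m0 H HB.
have mk : measurable_fun setT (fun w => k * f w) by exact: measurable_funM.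
apply: (@le_trans _ _ (\int[P]_w (k * f w + m)%:E)%E).
  apply: ge0_le_integral => //.
  - by move=> w _; rewrite lee_fin.
  - exact/measurable_EFinP.
  - by apply/measurable_EFinP; exact: measurable_funD.
  - by move=> w _; rewrite lee_fin.
rewrite integralD_EFin //; last by move=> w; exact: mulr_ge0.
by rewrite integral_cst_prob EFinD leeD2r // integralZ_EFin // EFinM lee_wpmul2l.
Qed.

Section prob_sqr_lemmas.
Context {R : realType}.
Variable mu : probability R[i] R.
Local Open Scope ereal_scope.
Implicit Types f g : R[i] -> R.

Lemma prob_sqr_mul f g : measurable_fun setT f -> measurable_fun setT g ->
  (forall y, 0 <= f y)%R -> (forall y, 0 <= g y)%R ->
  \int[prob_sqr mu]_a (f a.1 * g a.2)%:E = \int[mu]_y (f y)%:E * \int[mu]_y (g y)%:E.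
Proof.
move=> mf mg f0 g0.
rewrite (@prob_sqr_integral _ mu (fun a => (f a.1 * g a.2)%:E)); first last.
- by move=> a; rewrite lee_fin mulr_ge0.
- apply/measurable_EFinP; apply: measurable_funM.
    exact: measurableT_comp mf measurable_fst.
  exact: measurableT_comp mg measurable_snd.
under eq_integral => a _.
  rewrite /= integralZ_EFin //; over.
rewrite ge0_integralZr //.
- exact/measurable_EFinP.
- by move=> a _; rewrite lee_fin.
- by apply: integral_ge0 => b _; rewrite lee_fin.
Qed.

Lemma prob_sqr_add f g : measurable_fun setT f -> measurable_fun setT g ->
  (forall y, 0 <= f y)%R -> (forall y, 0 <= g y)%R ->
  \int[prob_sqr mu]_a (f a.1 + g a.2)%:E = \int[mu]_y (f y)%:E + \int[mu]_y (g y)%:E.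
Proof.
move=> mf mg f0 g0.
rewrite (integralD_EFin _ (measurableT_comp mf measurable_fst)
  (measurableT_comp mg measurable_snd)) //=; congr (_ + _).
  rewrite -[RHS]mule1 -(integral_cst_prob mu 1) -prob_sqr_mul //.
  by under [RHS]eq_integral do rewrite mulr1.
rewrite -[RHS]mul1e -(integral_cst_prob mu 1) -prob_sqr_mul //.
by under [RHS]eq_integral do rewrite mul1r.
Qed.

End prob_sqr_lemmas.

Section defect_measurable.
Context {R : realType}.
Variable G : R[i].
Hypothesis G0 : 0 < Im G.

Definition upper : set R[i] := [set y | 0 < Im y].

Lemma defectC k l : defect G k l = defect G l k.
Proof. by rewrite /defect /mid [k + l]addrC [hyp k G ^+ 2 + _]addrC. Qed.

(* The defect is cut off outside the upper half plane, where it has no sign. *)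
Definition defectU (a : R[i] * R[i]) : R :=
  \1_upper a.1 * \1_upper a.2 * `|defect G a.1 a.2|.

Lemma defectU_ge0 a : 0 <= defectU a.
Proof. by rewrite mulr_ge0 // mulr_ge0. Qed.

Lemma defectUE k l : 0 < Im k -> 0 < Im l -> defectU (k, l) = defect G k l.
Proof.
move=> k0 l0; rewrite /defectU !indicE !mem_set // !mul1r ger0_norm //.
exact: defect_ge0.
Qed.

Lemma defectUC k l : defectU (k, l) = defectU (l, k).
Proof. by rewrite /defectU /= [\1_upper k * _]mulrC defectC. Qed.

Lemma defectU_le a : defectU a <= (pot G a.1 ^+ 2 + pot G a.2 ^+ 2) / 2.
Proof.
case: a => k l; have P0 (y : R[i]) : 0 <= pot G y ^+ 2 by exact: sqr_ge0.
rewrite /defectU !indicE /=.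
case: (boolP (k \in upper)) => [kU|_]; last by rewrite !mul0r divr_ge0 // addr_ge0.
case: (boolP (l \in upper)) => [lU|_]; last by rewrite mulr0 mul0r divr_ge0 // addr_ge0.
rewrite !inE /upper /= in kU lU; rewrite !mul1r ger0_norm ?defect_ge0 //.
by rewrite /defect !potE // lerBlDr lerDl sqr_ge0.
Qed.

Lemma measurable_hyp_comp d (T : measurableType d) (f : T -> R[i]) :
  measurable_fun setT f -> measurable_fun setT (fun w => hyp (f w) G).
Proof.
move=> mf; have mc : measurable_fun setT (fun _ : T => G) by exact: measurable_cst.
exact: (measurable_hyp mf mc).
Qed.

Lemma measurable_defectU : measurable_fun setT defectU.
Proof.
have mU : measurable_fun setT (\1_upper : R[i] -> R).
  by apply: measurable_indic; exact: measurable_upper.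
have m1 : measurable_fun setT (fun a : R[i] * R[i] => a.1) by exact: measurable_fst.
have m2 : measurable_fun setT (fun a : R[i] * R[i] => a.2) by exact: measurable_snd.
apply: measurable_funM.
  apply: measurable_funM; first exact: (measurableT_comp mU m1).
  exact: (measurableT_comp mU m2).
have md : measurable_fun setT (fun a : R[i] * R[i] => defect G a.1 a.2).
  apply: measurable_funB.
    apply: measurable_funM => //; apply: measurable_funD; apply: measurable_funX.
      exact: (measurable_hyp_comp m1).
    exact: (measurable_hyp_comp m2).
  apply: measurable_funX; apply: (measurable_hyp_comp (f := fun a : R[i] * R[i] => mid a.1 a.2)).
  apply: measurable_complexM; first exact: measurable_cst.
  exact: measurable_complexD.
by apply: (measurableT_comp _ md).
Qed.

Lemma measurable_defectU_l (k : R[i]) : measurable_fun setT (fun y => defectU (k, y)).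
Proof. exact: (measurableT_comp measurable_defectU (measurable_pair1 k)). Qed.

End defect_measurable.

(** * From the hyperbolic distance back to moduli and imaginary parts *)

Section tails.
Context {R : realType}.
Implicit Types (g s z G : R[i]) (c p rho : R).

Lemma Im_opp_inv_le s : 0 < Im s -> Im (- s^-1) <= (Im s)^-1.
Proof.
move=> s0; rewrite Im_opp_inv ler_pdivrMr ?normsq_gt0 // mulrC ler_pdivlMr //.
by rewrite -expr2 /normsq lerDr sqr_ge0.
Qed.

Lemma powR_sqr (a p : R) : 0 <= a -> (a ^+ 2) `^ (p / 2) = a `^ p.
Proof.
by move=> a0; rewrite -powR_mulrn // -powRrM; congr (_ `^ _); field.
Qed.

(** With [X = hyp g s], [normsq (g - s)] is at most [X * (X + 2) * Im s ^+ 2], so both the powers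
    [p] and [p / 2] of [X] occur. The half power is split by the arithmetic-geometric inequality
    with a free parameter [r], later the square root of epsilon. *)
Lemma distance_pow_le (p c r : R) g s :
  2 <= p -> 0 < c -> 0 < r -> 0 < Im g -> 0 < Im s -> Im s <= c^-1 ->
  normc (g - s) `^ p <=
    (2 `^ p * (c^-1) `^ p) * (hyp g s `^ p + (r^-1 * hyp g s `^ p + r)).
Proof.
move=> p2 c0 r0 g0 s0 sc.
have X0 := hyp_ge0 g0 s0; set X := hyp g s in X0 *.
have ph : 0 <= p / 2 by lra.
have ci : 0 <= c^-1 by rewrite invr_ge0 ltW.
have n2 : normsq (g - s) <= (X * (X + 2)) * (c^-1) ^+ 2.
  rewrite (normsq_eq g0 s0) -/X -mulrA ler_wpM2l //.
  apply: (@le_trans _ _ ((Im s * (X + 2)) * Im s)).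
    by rewrite ler_wpM2r ?(ltW s0) // Im_le_hyp.
  have -> : Im s * (X + 2) * Im s = (X + 2) * Im s ^+ 2 by ring.
  rewrite ler_wpM2l ?addr_ge0 // ler_sqr ?nnegrE //; exact: ltW.
clearbody X.
have e1 : normc (g - s) `^ p = normsq (g - s) `^ (p / 2).
  by rewrite -normc_sq powR_sqr // normc_ge0.
rewrite e1; apply: (le_trans (powR_le ph (normsq_ge0 _) n2)).
have XX : 0 <= X * (X + 2) by rewrite mulr_ge0 ?addr_ge0.
rewrite (powRM _ XX (sqr_ge0 _)) (powR_sqr _ ci) [2 `^ p * _]mulrC -mulrA [leLHS]mulrC ler_wpM2l ?powR_ge0 //.
have XE : X * (X + 2) = X ^+ 2 + 2 * X by ring.
have X20 : 0 <= 2 * X by rewrite mulr_ge0.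
rewrite XE; apply: (le_trans (powRD_le ph (sqr_ge0 X) X20)).
have s2 : (0 : R) <= 2 by [].
rewrite (powR_sqr _ X0) (powRM _ s2 X0).
have e4 : 2 `^ p = 2 `^ (p / 2) * 2 `^ (p / 2) :> R.
  rewrite -powRDn //; last by lra.
  by congr (_ `^ _); field.
have t1 : 1 <= 2 `^ (p / 2) :> R.
  by have := @ler_powR R 2 (ler1n _ 2) 0 (p / 2) ph; rewrite powRr0.
rewrite e4 -mulrA ler_wpM2l ?powR_ge0 //.
have h : X `^ (p / 2) <= r^-1 * X `^ p + r.
  have e5 : X `^ p = X `^ (p / 2) ^+ 2.
    by rewrite -powR_mulrn ?powR_ge0 // -powRrM; congr (_ `^ _); field.
  rewrite e5; set Y := X `^ (p / 2).
  rewrite -(ler_pM2l r0) mulrDr mulrA mulfV ?gt_eqF // mul1r.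
  have := sqr_ge0 (2 * Y - r); have := sqr_ge0 r; lra.
have Xp : 0 <= X `^ p by exact: powR_ge0.
have h' : 2 `^ (p / 2) * X `^ (p / 2) <= 2 `^ (p / 2) * (r^-1 * X `^ p + r).
  by rewrite ler_wpM2l // powR_ge0.
have h'' : X `^ p <= 2 `^ (p / 2) * X `^ p by rewrite ler_peMl.
by rewrite mulrDr; exact: lerD.
Qed.

Lemma inv_Im_pow_le (p M : R) g s :
  0 <= p -> 0 < Im g -> 0 < Im s -> (Im s)^-1 <= M ->
  Im g `^ (- p) <= (2 `^ p * M `^ p) * (hyp g s `^ p + 2 `^ p).
Proof.
move=> p0 g0 s0 sM.
have X0 := hyp_ge0 g0 s0.
have M0 : 0 <= M by apply: le_trans sM; rewrite invr_ge0 ltW.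
have X2 : 0 <= hyp g s + 2 by rewrite addr_ge0.
have -> : Im g `^ (- p) = (Im g)^-1 `^ p.
  by rewrite -[(Im g)^-1]powR_inv1 ?(ltW g0) // -powRrM mulN1r.
apply: (@le_trans _ _ (((hyp g s + 2) * M) `^ p)).
  apply: powR_le => //; first by rewrite invr_ge0 ltW.
  by apply: (le_trans (inv_Im_le_hyp g0 s0)); rewrite ler_wpM2l.
rewrite (powRM _ X2 M0) [2 `^ p * _]mulrC -mulrA [leLHS]mulrC ler_wpM2l ?powR_ge0 //.
exact: powRD_le.
Qed.

End tails.

(** * Moments of the solution *)

Section recursion.
Context {R : realType} {d : measure_display} {T : measurableType d}.
Variables (P : probability T R) (N : {mfun T >-> nat}) (v : {mfun T >-> R[i]}).
Variables (x : nat -> {mfun T >-> R[i]}) (mu : probability R[i] R).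
Hypothesis law_x : forall i A, measurable A -> P (x i @^-1` A) = mu A.
Hypothesis indep : indep_seq P N v (fun i => x i : T -> R[i]).
Hypothesis N1 : P [set w | (1 <= N w)%N] = 1%E.
Hypothesis v0 : P [set w | 0 <= Im (v w)] = 1%E.
Hypothesis mu0 : mu [set y | 0 < Im y] = 1%E.
Variables (z G : R[i]) (c c' dd lam p al : R).
Hypothesis z0 : 0 < Im z.
Hypothesis dd0 : 0 < dd.
Hypothesis c0 : 0 < c.
Hypothesis cG : c <= Im G.
Hypothesis G1 : normsq G <= 1.
Hypothesis GE : G = - (z + G)^-1.
Hypothesis c'0 : 0 < c' <= 1.
Hypothesis ReG : `|Re G| <= (1 - c') * normc G.
Hypothesis l01 : 0 < lam <= 1 / 2.
Hypothesis p2 : 2 <= p.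
Hypothesis cl : cst1 c * lam <= 1 / 20.

Let G0 : 0 < Im G. Proof. exact: lt_le_trans cG. Qed.
Let p1 : 1 < p. Proof. by move: p2; lra. Qed.
Let p0 : 0 <= p. Proof. by move: p2; lra. Qed.
Let eta : R := lam + al.

Section independence.
Local Open Scope ereal_scope.

Definition NV (w : T) : nat * R[i] := (N w, v w).

Lemma measurable_NV : measurable_fun setT NV.
Proof. exact: measurable_fun_pair. Qed.

Let NVm : {mfun T >-> (nat * R[i])%type} :=
  HB.pack NV (isMeasurableFun.Build _ _ _ _ _ measurable_NV).

Definition xx i j (w : T) : R[i] * R[i] := (x i w, x j w).

Lemma measurable_xx i j : measurable_fun setT (xx i j).
Proof. exact: measurable_fun_pair. Qed.

Lemma indep_rectangle (A : set (nat * R[i])) i j (B1 B2 : set R[i]) : i != j ->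
  measurable A -> measurable B1 -> measurable B2 ->
  P (NV @^-1` A `&` xx i j @^-1` (B1 `*` B2)) = P (NV @^-1` A) * (mu B1 * mu B2).
Proof.
move=> ij mA m1 m2.
pose B k := if k == i then B1 else if k == j then B2 else setT.
have mB k : measurable (B k) by rewrite /B; case: ifP => // _; case: ifP.
have := indep (maxn i j).+1 mA mB.
have -> : [set w | A (N w, v w)] = NV @^-1` A by [].
have -> : [set w | forall k, (k < (maxn i j).+1)%N -> B k (x k w)] = xx i j @^-1` (B1 `*` B2).
  apply/seteqP; split => w /=.
    move=> H; split.
      by have := H i; rewrite /B eqxx ltnS leq_maxl; apply.
    by have := H j; rewrite /B eqxx eq_sym (negbTE ij) ltnS leq_maxr; apply.
  move=> [H1 H2] k _; rewrite /B; have [->//|_] := eqVneq k i.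
  by have [->//|_] := eqVneq k j.
move=> ->; congr (_ * _).
have iM : (i < (maxn i j).+1)%N by rewrite ltnS leq_maxl.
have jM : (j < (maxn i j).+1)%N by rewrite ltnS leq_maxr.
rewrite (bigD1 (Ordinal iM)) //= (bigD1 (Ordinal jM)) /=; last first.
  by rewrite -val_eqE /= eq_sym.
rewrite {1 2}/B eqxx [j == i]eq_sym (negbTE ij) eqxx !law_x // big1 ?mule1 // => k.
rewrite -!val_eqE /= => /andP[ki kj].
by rewrite /B (negbTE ki) (negbTE kj) preimage_setT probability_setT.
Qed.

(** For fixed [A] of positive probability, dividing by that probability gives two measures in [Z]
    that agree on rectangles, and the product measure is unique. A null [A] makes both sides 0. *)
Lemma indep_pair_measure (A : set (nat * R[i])) i j (Z : set (R[i] * R[i])) : i != j ->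
  measurable A -> measurable Z ->
  P (NV @^-1` A `&` xx i j @^-1` Z) = P (NV @^-1` A) * (prob_sqr mu) Z.
Proof.
move=> ij mA mZ.
have mNA : measurable (NV @^-1` A).
  by have := measurable_NV measurableT mA; rewrite setTI.
have mxZ Y : measurable Y -> measurable (xx i j @^-1` Y).
  by move=> mY; have := @measurable_xx i j measurableT _ mY; rewrite setTI.
have Afin : P (NV @^-1` A) \is a fin_num by exact: fin_num_measure.
have [A0|A0] := eqVneq (P (NV @^-1` A)) 0.
  rewrite A0 mul0e; apply/eqP; rewrite eq_le measure_ge0 andbT -A0.
  by apply: le_measure; rewrite ?inE //; apply: measurableI => //; exact: mxZ.
have k0 : (0 <= (fine (P (NV @^-1` A)))^-1)%R by rewrite invr_ge0 fine_ge0.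
pose m' := mscale (NngNum k0) (push_measure (mrestr P mNA) (@measurable_xx i j)).
have e : P (NV @^-1` A) * ((fine (P (NV @^-1` A)))^-1)%:E = 1.
  rewrite -[X in X * _]fineK // -EFinM mulfV //.
  by apply: contra_neq A0 => h; rewrite -[LHS]fineK // h.
have H : forall B1 B2, measurable B1 -> measurable B2 -> m' (B1 `*` B2) = mu B1 * mu B2.
  move=> B1 B2 m1 m2; rewrite /m' /mscale /= /pushforward /mrestr setIC.
  rewrite (indep_rectangle ij mA m1 m2) muleA [_ * P _]muleC e mul1e //.
have -> : prob_sqr mu Z = m' Z by exact: (product_measure_unique H mZ).
rewrite /m' /mscale /= /pushforward /mrestr muleA e mul1e.
by rewrite setIC.
Qed.

Lemma indep_integral (K : nat * R[i] -> \bar R) (f : R[i] * R[i] -> \bar R) i j :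
  i != j -> measurable_fun setT K -> measurable_fun setT f ->
  (forall a, 0 <= K a) -> (forall a, 0 <= f a) ->
  \int[P]_w (K (NV w) * f (xx i j w)) =
  \int[P]_w K (NV w) * \int[prob_sqr mu]_y f y.
Proof.
move=> ij mK mf K0 f0.
have mD : measurable_fun setT (fun w => (NV w, xx i j w)).
  by apply: measurable_fun_pair; [exact: measurable_NV|exact: measurable_xx].
pose h (y : (nat * R[i]) * (R[i] * R[i])) := K y.1 * f y.2.
have mh : measurable_fun setT h.
  apply: emeasurable_funM; first exact: measurableT_comp mK measurable_fst.
  exact: measurableT_comp mf measurable_snd.
have h0 y : 0 <= h y by rewrite mule_ge0.
have e := @ge0_integral_pushforward _ _ _ _ R _ mD P setT h measurableT mh (fun y _ => h0 y).
rewrite preimage_setT in e; rewrite -[LHS]e.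
have eK := @ge0_integral_pushforward _ _ _ _ R _ measurable_NV P setT K measurableT mK (fun y _ => K0 y).
rewrite preimage_setT in eK; rewrite -[X in X * _]eK.
have H A Z : measurable A -> measurable Z ->
    push_measure P mD (A `*` Z) = distribution P NVm A * (prob_sqr mu) Z.
  by move=> mA mZ; rewrite /= /pushforward -(indep_pair_measure ij mA mZ).
have u := @product_measure_unique _ _ _ _ _ (distribution P NVm) (prob_sqr mu) (push_measure P mD) H.
transitivity (\int[distribution P NVm]_y fubini_F (prob_sqr mu) h y).
  rewrite -fubini_tonelli1 //.
  apply: (@eq_measure_integral _ _ _ setT _ (push_measure P mD)) => X mX _.
  by rewrite -u.
rewrite /fubini_F /h /=.
under eq_integral do rewrite ge0_integralZl //.
rewrite -ge0_integralZr //; last by apply: integral_ge0.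
exact: measurable_NV.
Qed.

(** A Wald-type identity. On [N = n] each of the [n] summands factorises by independence into the
    same product, and [n%:R^-1] cancels their number. At [n = 0] the average is 0, hence the
    condition on [K (0, u)]; [s n i] must differ from [i] for the pair to be independent. *)
Lemma avg_integral (K : nat * R[i] -> R) (f : R[i] * R[i] -> R) (s : nat -> nat -> nat) :
  measurable_fun setT K -> measurable_fun setT f ->
  (forall a, 0 <= K a)%R -> (forall a, 0 <= f a)%R -> (forall u, K (0, u) = 0)%R ->
  (forall n u i, K (n, u) != 0 -> (i < n)%N -> i != s n i)%R ->
  \int[prob_sqr mu]_y (f y)%:E \is a fin_num ->
  \int[P]_w (K (NV w) * avg (N w) (fun i => f (xx i (s (N w) i) w)))%:E =
  \int[P]_w (K (NV w))%:E * \int[prob_sqr mu]_y (f y)%:E.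
Proof.
move=> mK mf K0 f0 K00 Ks Mfin.
set M := \int[prob_sqr mu]_y (f y)%:E in Mfin *.
have mKN : measurable_fun setT (fun w => K (NV w)).
  exact: measurableT_comp mK measurable_NV.
have mfx i j : measurable_fun setT (fun w => f (xx i j w)).
  exact: measurableT_comp mf (measurable_xx i j).
have mA : measurable_fun setT (fun w => avg (N w) (fun i => f (xx i (s (N w) i) w))).
  by apply: (@measurable_avg R _ T (fun n i w => f (xx i (s n i) w))) => // n i.
have A0 w : (0 <= avg (N w) (fun i => f (xx i (s (N w) i) w)))%R.
  by apply: avg_ge0.
pose F n := N @^-1` [set n].
have mF n : measurable (F n).
  by apply: measurable_funPTI.
have UF : \bigcup_n F n = setT by apply/seteqP; split => // w _; exists (N w).
have tF : trivIset setT F.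
  by apply/trivIsetP => i j _ _ ij; apply/seteqP; split => // w [wi wj];
    move: ij; rewrite -(wi : N w = i) -(wj : N w = j) eqxx.
rewrite -{1}UF ge0_integral_bigcup //; first last.
- by move=> w _; rewrite lee_fin mulr_ge0.
- by rewrite UF; apply/measurable_EFinP; exact: measurable_funM.
rewrite -[in RHS]UF ge0_integral_bigcup //; first last.
- by move=> w _; rewrite lee_fin.
- by rewrite UF; exact/measurable_EFinP.
rewrite muleC -[M]fineK // -nneseriesZl; last first.
  by move=> n _; apply: integral_ge0 => w _; rewrite lee_fin.
apply: eq_eseriesr => n _; rewrite fineK //.
pose Kn (a : nat * R[i]) := (K a * (a.1 == n)%:R)%R.
have mKn : measurable_fun setT Kn.
  apply: measurable_funM => //.
  by apply: (measurableT_comp (_ : measurable_fun setT (fun k : nat => (k == n)%:R : R)) measurable_fst).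
have Kn0 a : (0 <= Kn a)%R by rewrite mulr_ge0.
have patch (g : T -> R) : \int[P]_(w in F n) (K (NV w) * g w)%:E =
    \int[P]_w (Kn (NV w) * g w)%:E.
  rewrite integral_mkcond; apply: eq_integral => w _; rewrite patchE /Kn /NV /=.
  have [e|ne] := eqVneq (N w) n; first by rewrite mem_set // mulr1.
  by rewrite memNset ?mulr0 ?mul0r // => /eqP; rewrite (negbTE ne).
have -> : \int[P]_(w in F n) (K (NV w))%:E = \int[P]_w (Kn (NV w))%:E.
  have := patch (fun=> 1%R).
  by under eq_integral do rewrite mulr1; move=> ->; under eq_integral do rewrite mulr1.
have -> : \int[P]_(w in F n)
     (K (NV w) * avg (N w) (fun i => f (xx i (s (N w) i) w)))%:E =
   \int[P]_w (Kn (NV w) * avg n (fun i => f (xx i (s n i) w)))%:E.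
  rewrite -patch; apply: eq_integral => w; rewrite inE /F /= => -> //.
have [Kz|/existsNP [[n' u] Knu]] := pselect (forall a, Kn a = 0%R).
  under eq_integral do rewrite Kz mul0r.
  under [X in _ = _ * X]eq_integral do rewrite Kz.
  by rewrite !integral0 mule0.
have [n'n Ku] : n' = n /\ K (n, u) != 0%R.
  move: Knu; rewrite /Kn /=; have [-> /eqP|_] := eqVneq n' n.
    by rewrite mulr1.
  by rewrite mulr0.
have n0 : (0 < n)%N.
  by rewrite lt0n; apply: contraNneq Ku => ->; rewrite K00.
have sne i : (i < n)%N -> i != s n i by exact: Ks Ku.
under eq_integral => w _.
  rewrite /avg mulrCA mulr_sumr EFinM -sumEFin.
  over.
rewrite ge0_integralZl_EFin //; last 2 first.
- by move=> w _; apply: sume_ge0 => i _; rewrite lee_fin mulr_ge0.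
- apply: emeasurable_sum => i; apply/measurable_EFinP; apply: measurable_funM => //.
  exact: measurableT_comp mKn measurable_NV.
rewrite ge0_integral_sum //; first last.
- by move=> i w _; rewrite lee_fin mulr_ge0.
- move=> i; apply/measurable_EFinP; apply: measurable_funM => //.
  exact: measurableT_comp mKn measurable_NV.
rewrite (eq_bigr (fun=> M * \int[P]_w (Kn (NV w))%:E)); last first.
  move=> i _; rewrite [RHS]muleC.
  rewrite -(indep_integral (K := fun a => (Kn a)%:E) (f := fun y => (f y)%:E) (sne i (ltn_ord i))).
  - by apply: eq_integral => w _; rewrite EFinM.
  - exact/measurable_EFinP.
  - exact/measurable_EFinP.
  - by move=> a; rewrite lee_fin.
  - by move=> a; rewrite lee_fin.
rewrite sume_cst; last by rewrite mule_ge0 // integral_ge0 // => y _; rewrite lee_fin.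
rewrite muleA -EFinM mulVf ?mul1e //.
by rewrite pnatr_eq0 -lt0n.
Qed.

(** A lone copy would be its own neighbour, so [K] has to vanish for [n <= 1]. The indicator of the
    good event does so, thanks to its clause [2 <= N]. *)
Lemma avg_integral_next (K : nat * R[i] -> R) (f : R[i] * R[i] -> R) :
  measurable_fun setT K -> measurable_fun setT f ->
  (forall a, 0 <= K a)%R -> (forall a, 0 <= f a)%R ->
  (forall n u, (n <= 1)%N -> K (n, u) = 0)%R ->
  \int[prob_sqr mu]_y (f y)%:E \is a fin_num ->
  \int[P]_w (K (NV w) * avg (N w) (fun i => f (x i w, x (next (N w) i) w)))%:E =
  \int[P]_w (K (NV w))%:E * \int[prob_sqr mu]_y (f y)%:E.
Proof.
move=> mK mf K0 f0 K1 Mfin; apply: (@avg_integral K f next) => //.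
  by move=> u; apply: K1.
move=> n u i Ku ni; rewrite eq_sym next_neq // ltnNge.
by apply/negP => /(K1 n u) /eqP; rewrite (negbTE Ku).
Qed.

Lemma avg_integral1 (K : nat * R[i] -> R) (f : R[i] -> R) :
  measurable_fun setT K -> measurable_fun setT f ->
  (forall a, 0 <= K a)%R -> (forall a, 0 <= f a)%R ->
  (forall u, K (0, u) = 0)%R ->
  \int[mu]_y (f y)%:E \is a fin_num ->
  \int[P]_w (K (NV w) * avg (N w) (fun i => f (x i w)))%:E =
  \int[P]_w (K (NV w))%:E * \int[mu]_y (f y)%:E.
Proof.
move=> mK mf K0 f0 K00 Mfin.
have mf1 : measurable_fun setT (fun y : R[i] * R[i] => f y.1).
  exact: measurableT_comp mf measurable_fst.
have e : \int[prob_sqr mu]_y (f y.1)%:E = \int[mu]_y (f y)%:E.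
  rewrite (@prob_sqr_integral _ mu (fun y => (f y.1)%:E)); first last.
  - by move=> a; rewrite lee_fin.
  - exact/measurable_EFinP.
  by apply: eq_integral => a _ /=; rewrite integral_cst // (_ : _ setT = 1) ?mule1 //; exact: probability_setT.
(* [f] ignores the partner [i.+1], which merely has to differ from [i]; it may lie beyond the first
   [N] copies. *)
rewrite -e; apply: (@avg_integral K (fun y => f y.1) (fun _ i => i.+1)) => //.
- by move=> n u i _ _; rewrite ltn_eqF.
- by rewrite e.
Qed.

End independence.

Definition moment (q : R) : \bar R := (\int[mu]_y (pot G y `^ q)%:E)%E.

Lemma moment_ge0 q : (0 <= moment q)%E.
Proof. by apply: integral_ge0 => y _; rewrite lee_fin powR_ge0. Qed.

Definition generic_set : set T :=
  [set w | [/\ (0 < N w)%N, 0 <= Im (v w) & forall i, 0 < Im (x i w)]].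

Let mN1 : measurable [set w | (1 <= N w)%N].
Proof. by apply: (measurable_funPTI N (Y := [set n | (1 <= n)%N])). Qed.

Let mv0 : measurable [set w | 0 <= Im (v w)].
Proof. exact: measurable_funPTI measurable_closed_upper. Qed.

Let mx0 i : measurable [set w | 0 < Im (x i w)].
Proof. exact: measurable_funPTI measurable_upper. Qed.

Let generic_setE : generic_set = [set w | (1 <= N w)%N] `&` ([set w | 0 <= Im (v w)] `&`
  \bigcap_i [set w | 0 < Im (x i w)]).
Proof.
apply/seteqP; split=> w /=; first by move=> [? ? H]; split=> //; split=> // i _; exact: H.
by move=> [? [? H]]; split=> // i; exact: H.
Qed.

Lemma measurable_generic_set : measurable generic_set.
Proof.
rewrite generic_setE; apply: measurableI => //; apply: measurableI => //.
exact: bigcapT_measurable.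
Qed.

Lemma prob_generic_set : P generic_set = 1%E.
Proof.
rewrite generic_setE; apply: prob_setI1 => //.
  by apply: measurableI => //; exact: bigcapT_measurable.
apply: prob_setI1 => //; first exact: bigcapT_measurable.
apply: prob_bigcap1 => // i.
by have := law_x i measurable_upper; rewrite mu0.
Qed.

Lemma generic_le_integral (f g : T -> R) :
  measurable_fun setT f -> measurable_fun setT g ->
  (forall w, 0 <= f w) -> (forall w, 0 <= g w) ->
  (forall w, generic_set w -> f w <= g w) ->
  (\int[P]_w (f w)%:E <= \int[P]_w (g w)%:E)%E.
Proof.
move=> mf mg f0 g0 fg.
apply: (ae_le_integral measurable_generic_set prob_generic_set).
- exact/measurable_EFinP.
- exact/measurable_EFinP.
- by move=> w; rewrite lee_fin.
- by move=> w; rewrite lee_fin.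
- by move=> w Gw; rewrite lee_fin; exact: fg.
Qed.

Definition center (w : T) : R[i] := cavg (N w) (fun i => x i w).

Lemma measurable_center : measurable_fun setT center.
Proof.
have mavg (f : R[i] -> R) : measurable_fun setT f ->
    measurable_fun setT (fun w => avg (N w) (fun i => f (x i w))).
  move=> mf; apply: (@measurable_avg R _ T (fun _ i w => f (x i w))) => // _ i.
  exact: measurableT_comp.
apply: measurable_complexP.
- under eq_fun do rewrite Re_cavg; exact/mavg/measurable_Re.
- under eq_fun do rewrite Im_cavg; exact/mavg/measurable_Im.
Qed.

Lemma Im_center_gt0 w : generic_set w -> 0 < Im (center w).
Proof. by move=> [Nw _ xw]; apply: Im_cavg_gt0. Qed.

Local Notation avg_pot q w := (avg (N w) (fun i => pot G (x i w) `^ q)).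

Lemma avg_pot_ge0 q w : 0 <= avg_pot q w.
Proof. by apply: avg_ge0 => i _; exact: powR_ge0. Qed.

Lemma pot_center_le w : generic_set w ->
  pot G (center w) <= avg (N w) (fun i => pot G (x i w)).
Proof.
move=> Gw; have [Nw _ xw] := Gw.
rewrite potE ?Im_center_gt0 //; apply: (le_trans (hyp_cavg_le G0 Nw _)) => //.
by apply: le_avg => i _; rewrite potE.
Qed.

Lemma pot_centerX_le (q : R) w : 1 < q -> generic_set w ->
  pot G (center w) `^ q <= avg_pot q w.
Proof.
move=> q1 Gw; have [Nw _ xw] := Gw.
apply: le_trans (powR_avg_le q1 Nw _) => [|i _]; last exact: pot_ge0.
apply: powR_le; [lra|exact: pot_ge0|exact: pot_center_le].
Qed.

Lemma measurable_avg_potX q :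
  measurable_fun setT (fun w => avg_pot q w).
Proof.
apply: (@measurable_avg R _ T (fun _ i w => pot G (x i w) `^ q)) => // _ i.
exact: (measurableT_comp (measurable_potX G q) (@measurable_funPT _ _ _ _ (x i))).
Qed.

Lemma integral_weight_avg (K : nat * R[i] -> R) (q : R) :
  measurable_fun setT K -> (forall a, 0 <= K a) -> (forall u, K (0, u) = 0) ->
  moment q \is a fin_num ->
  (\int[P]_w (K (NV w) * (1 + avg_pot q w))%:E =
   \int[P]_w (K (NV w))%:E * (1 + moment q))%E.
Proof.
move=> mK K0 K00 mfin.
have mKN : measurable_fun setT (fun w => K (NV w)).
  exact: measurableT_comp mK measurable_NV.
rewrite ge0_muleDr ?moment_ge0 // mule1.
rewrite -(avg_integral1 (f := fun y => pot G y `^ q)) //; last 2 first.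
- exact: measurable_potX.
- by move=> a; exact: powR_ge0.
rewrite -integralD_EFin //.
- by apply: eq_integral => w _; rewrite mulrDr mulr1.
- by apply: measurable_funM => //; exact: measurable_avg_potX.
- by move=> w; rewrite mulr_ge0 // avg_pot_ge0.
Qed.

(** The common form of the three moment estimates: [F1] is the contribution of the averages that is
    kept sharp, [W] the coefficient of an error that only needs the crude factor [1 + M]. *)
Lemma generic_bound (F F1 : T -> R) (W : nat * R[i] -> R) (q a b M : R) :
  measurable_fun setT F -> measurable_fun setT F1 -> measurable_fun setT W ->
  (forall w, 0 <= F w) -> (forall w, 0 <= F1 w) -> (forall y, 0 <= W y) ->
  (forall u, W (0, u) = 0) ->
  (forall w, generic_set w ->
    F w <= F1 w + W (NV w) * (1 + avg_pot q w)) ->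
  (\int[P]_w (F1 w)%:E <= a%:E)%E -> (\int[P]_w (W (NV w))%:E <= b%:E)%E ->
  moment q = M%:E ->
  (\int[P]_w (F w)%:E <= (a + b * (1 + M))%:E)%E.
Proof.
move=> mF mF1 mW F0 F10 W0 W00 H Ha Hb HM.
have mWN : measurable_fun setT (fun w => W (NV w)) := measurableT_comp mW measurable_NV.
have mS : measurable_fun setT (fun w => 1 + avg_pot q w).
  by apply: measurable_funD => //; exact: measurable_avg_potX.
have S0 w : 0 <= 1 + avg_pot q w.
  by rewrite addr_ge0 // avg_pot_ge0.
apply: (@le_trans _ _ (\int[P]_w (F1 w + W (NV w) * (1 + avg_pot q w))%:E)%E).
  apply: generic_le_integral => //; last by move=> w; rewrite addr_ge0 // mulr_ge0.
  by apply: measurable_funD => //; exact: measurable_funM.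
rewrite integralD_EFin //; last 2 first.
- exact: measurable_funM.
- by move=> w; exact: mulr_ge0.
rewrite integral_weight_avg ?HM // EFinD; apply: leeD => //.
rewrite EFinM; apply: lee_pmul => //.
- by apply: integral_ge0 => w _; rewrite lee_fin.
- by rewrite -HM adde_ge0 // moment_ge0.
Qed.

Definition res (w : T) : R[i] := resolvent_map z dd (N w) (v w) (fun i => x i w).

Definition ratio (w : T) : R := (N w)%:R / dd.

Lemma resE w : (0 < N w)%N -> res w = - (z + (ratio w)%:C * center w + v w)^-1.
Proof.
move=> Nw; rewrite /res /resolvent_map /center /cavg mulrA -rmorphM /ratio.
congr (- (z + _ * _ + _)^-1); congr (_%:C).
have : ((N w)%:R : R) != 0 by rewrite pnatr_eq0 -lt0n.
have : dd != 0 by rewrite gt_eqF.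
by move: ((N w)%:R : R) => k dn kn; field; rewrite dn kn.
Qed.

Lemma ratio_gt0 w : (0 < N w)%N -> 0 < ratio w.
Proof. by move=> Nw; rewrite divr_gt0 // ltr0n. Qed.

Lemma measurable_res : measurable_fun setT res.
Proof.
apply: measurable_opp_inv; apply: measurable_complexD => //.
apply: measurable_complexD; first exact: measurable_cst.
apply: measurable_complexM; first exact: measurable_cst.
apply: (@measurable_natcomp _ _ _ _ (fun n w => \sum_(i < n) x i w)) => // n.
elim: n => [|n IHn].
  by under eq_fun do rewrite big_ord0; exact: measurable_cst.
by under eq_fun do rewrite big_ord_recr /=; exact: measurable_complexD.
Qed.

Lemma Im_arg_gt0 w : generic_set w ->
  0 < Im ((ratio w)%:C * center w + v w).
Proof.
move=> Gw; have [Nw vw _] := Gw.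
by rewrite ImD ImCM ltr_wpDr // mulr_gt0 ?ratio_gt0 // (Im_center_gt0 Gw).
Qed.

Lemma Im_res_gt0 w : generic_set w -> 0 < Im (res w).
Proof.
move=> Gw; have [Nw _ _] := Gw; rewrite resE //.
by apply: Im_opp_inv_gt0; rewrite -addrA ImD addr_gt0 // Im_arg_gt0.
Qed.

(** Inversion and scaling are isometries and the shift by [z] does not increase [hyp]. With
    [rho = 1] the target is [G] itself; with [rho] the ratio of the two mean degrees it is
    [Gamma_star]. *)
Lemma hyp_res_le (rho : R) w : 0 < rho -> generic_set w ->
  hyp (res w) (- (z + rho%:C * G)^-1) <=
  hyp ((ratio w / rho)%:C * center w + (rho^-1)%:C * v w) G.
Proof.
move=> r0 Gw; have [Nw vw _] := Gw.
have a0 := Im_arg_gt0 Gw.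
have rG0 : 0 < Im (rho%:C * G) by rewrite ImCM mulr_gt0.
have za : 0 < Im (z + ((ratio w)%:C * center w + v w)) by rewrite ImD addr_gt0.
have zG : 0 < Im (z + rho%:C * G) by rewrite ImD addr_gt0.
rewrite resE // -[z + _ + _]addrA hyp_opp_inv //.
apply: (le_trans (hyp_shift (ltW z0) a0 rG0)).
have e : (ratio w)%:C * center w + v w =
    rho%:C * ((ratio w / rho)%:C * center w + (rho^-1)%:C * v w).
  rewrite mulrDr !mulrA -!rmorphM mulrCA mulfV ?gt_eqF // mulr1.
  by rewrite rmorph1 mul1r.
rewrite e hyp_scale //.
by move: a0; rewrite e ImCM pmulr_rgt0.
Qed.

Definition onE (a : nat * R[i]) : R := \1_(setE dd lam) a.
Definition offE (a : nat * R[i]) : R := \1_(~` setE dd lam) a * weight p dd a.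

Lemma measurable_onE : measurable_fun setT onE.
Proof. by apply: measurable_indic; exact: measurable_setE. Qed.

Lemma measurable_offE : measurable_fun setT offE.
Proof.
apply: measurable_funM; last exact: measurable_weight.
by apply: measurable_indic; apply: measurableC; exact: measurable_setE.
Qed.

Lemma offE_ge0 a : 0 <= offE a. Proof. by rewrite mulr_ge0 // weight_ge0. Qed.

Lemma onE_small n u : (n <= 1)%N -> onE (n, u) = 0.
Proof.
move=> n1; rewrite /onE indicE memNset // => -[_ /= n2 _].
by rewrite leqNgt ltnS n1 in n2.
Qed.

Lemma offE0 u : offE (0, u) = 0.
Proof. by rewrite /offE weight0 ?mulr0 // (lt_trans _ p1). Qed.

Lemma onE_offE a : (0 < a.1)%N -> 1 <= onE a + offE a.
Proof.
move=> a0; rewrite /onE /offE !indicE in_setC.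
case: (a \in setE dd lam) => /=; first by rewrite mul0r addr0.
by rewrite mul1r add0r; exact: weight_ge1.
Qed.

Lemma pot_res_le w : generic_set w ->
  pot G (res w) <=
  hyp ((ratio w)%:C * center w + v w) G.
Proof.
move=> Gw; have := hyp_res_le ltr01 Gw.
rewrite rmorph1 mul1r -GE invr1 mulr1 rmorph1 mul1r.
by rewrite potE // (Im_res_gt0 Gw).
Qed.

Lemma hyp_off_le (q e : R) (u : R[i]) w : 1 < q <= p -> 0 < e -> 0 <= Im u ->
  generic_set w ->
  hyp (((N w)%:R / e)%:C * center w + u) G `^ q <=
  (2 * cst2 c) `^ q * weight p e (N w, u) * (1 + avg_pot q w).
Proof.
move=> /andP[q1 qp] e0 u0 Gw; have [Nw _ xw] := Gw; have h0 := Im_center_gt0 Gw.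
have q0 : 0 <= q by lra.
have r0 : 0 < (N w)%:R / e by rewrite divr_gt0 // ltr0n.
apply: (le_trans (hyp_step_off c0 cG G1 r0 u0 h0 q0)); apply: ler_pM.
- by rewrite mulr_ge0 ?powR_ge0.
- by rewrite addr_ge0 // powR_ge0.
- rewrite ler_wpM2l ?powR_ge0 //.
  by apply: (@weight_ge R p q e (N w, u)) => //; rewrite q0.
- by rewrite lerD2l -(potE G0 h0); exact: pot_centerX_le.
Qed.

Lemma pot_res_split q w : 1 < q <= p -> generic_set w ->
  pot G (res w) `^ q <=
  onE (NV w) * ((1 + cst1 c * lam) * pot G (center w) + cst1 c * lam) `^ q
  + (2 * cst2 c) `^ q * offE (NV w)
    * (1 + avg_pot q w).
Proof.
move=> /andP[q1 qp] Gw; have [Nw vw xw] := Gw.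
have q0 : 0 <= q by lra.
have h0 := Im_center_gt0 Gw.
apply: (@le_trans _ _ (hyp ((ratio w)%:C * center w + v w) G `^ q)).
  by apply: powR_le => //; [exact: pot_ge0|exact: pot_res_le].
have w0 : 0 < Im ((ratio w)%:C * center w + v w) by exact: Im_arg_gt0.
rewrite /onE /offE !indicE in_setC; case: (boolP (_ \in _)) => /=.
  rewrite inE => -[/= vl _ rl].
  rewrite mul1r mul0r mulr0 mul0r addr0; apply: powR_le => //; first exact: hyp_ge0.
  by rewrite (potE G0 h0); exact: (hyp_step_on c0 cG G1).
by move=> _; rewrite mul0r mul1r add0r; apply: hyp_off_le => //; rewrite q1.
Qed.

Local Notation onN := (fun w => onE (NV w)).
Local Notation offN := (fun w => offE (NV w)).

Lemma measurable_onN : measurable_fun setT onN.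
Proof. exact: (measurableT_comp (measurable_onE) measurable_NV). Qed.

Lemma measurable_offN : measurable_fun setT offN.
Proof. exact: (measurableT_comp (measurable_offE) measurable_NV). Qed.

Definition abs_gap (w : T) : R := `|jensen_gap G (N w) (fun i => x i w)|.

Lemma measurable_abs_gap : measurable_fun setT abs_gap.
Proof.
have m : measurable_fun setT (fun w => jensen_gap G (N w) (fun i => x i w)).
  apply: measurable_funB; last first.
    by apply: measurable_funX; apply: measurable_hyp_comp; exact: measurable_center.
  apply: (@measurable_avg R _ T (fun _ i w => hyp (x i w) G ^+ 2)) => // _ i.
  by apply: measurable_funX; exact: measurable_hyp_comp.
by apply: (measurableT_comp _ m).
Qed.

Hypothesis law_res : forall A, measurable A -> P (res @^-1` A) = mu A.
Hypothesis alE : (\int[P]_w (offE (NV w))%:E = al%:E)%E.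

(** * Finiteness of the moments at a fixed [z] *)

Section finiteness.

Lemma res_integral (f : R[i] -> R) : measurable_fun setT f -> (forall y, 0 <= f y) ->
  (\int[P]_w (f (res w))%:E = \int[mu]_y (f y)%:E)%E.
Proof.
move=> mf f0.
apply: (@eq_law_integral _ _ _ _ _ _ _ P _ mu idfun (fun y => (f y)%:E)).
- by move=> A mA; exact: law_res.
- exact: measurable_res.
- exact: measurable_id.
- exact/measurable_EFinP.
- by move=> y; rewrite lee_fin.
Qed.

(* Resolvents at [z] stay in this disk, hence so do almost all the copies; this
   gives moments that are finite, but not uniformly in [z]. *)
Let disk : set R[i] := [set y | normsq y * Im z <= Im y].

Let measurable_disk : measurable disk.
Proof.
have -> : disk = (fun y => Im y - normsq y * Im z) @^-1` `[0, +oo[%classic.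
  by apply/seteqP; split=> y; rewrite /= in_itv /= andbT subr_ge0.
rewrite -[X in measurable X]setTI; apply: measurable_funB => //.
  exact: measurable_Im.
apply: measurable_funM => //; exact: (measurable_normsq (@measurable_id _ _ setT)).
Qed.

Let res_disk w : generic_set w -> disk (res w).
Proof.
move=> Gw; have [Nw vw _] := Gw.
have a0 := Im_arg_gt0 Gw.
rewrite /disk /= resE // -addrA.
have s0 : 0 < Im (z + ((ratio w)%:C * center w + v w)) by rewrite ImD addr_gt0.
rewrite normsq_opp_inv // Im_opp_inv mulrC ler_wpM2r ?invr_ge0 ?normsq_ge0 //.
by rewrite ImD lerDl ltW.
Qed.

Let mu_disk : mu disk = 1%E.
Proof.
rewrite -law_res //.
have mg := measurable_generic_set; have g1 := prob_generic_set.
have mrd : measurable (res @^-1` disk).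
  rewrite -[X in measurable X]setTI.
  by apply: measurable_res => //; exact: measurable_disk.
apply/eqP; rewrite eq_le; apply/andP; split; first exact: probability_le1.
by rewrite -g1; apply: le_measure; rewrite ?inE // => w /res_disk.
Qed.

Let good : set T := generic_set `&` \bigcap_i (x i @^-1` disk).

Let mxdisk i : measurable (x i @^-1` disk).
Proof. exact: measurable_funPTI. Qed.

Let measurable_good : measurable good.
Proof.
apply: measurableI; first exact: measurable_generic_set.
exact: bigcapT_measurable.
Qed.

Let prob_good : P good = 1%E.
Proof.
apply: prob_setI1.
- exact: measurable_generic_set.
- exact: bigcapT_measurable.
- exact: (prob_generic_set).
- by apply: prob_bigcap1 => // i; rewrite law_x.
Qed.

Let Cz : R := (8 + 8 * normsq z) / (Im z * Im G).

Let Cz_ge0 : 0 <= Cz.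
Proof.
by rewrite divr_ge0 ?mulr_ge0 ?addr_ge0 ?mulr_ge0 ?normsq_ge0 ?(ltW z0) ?(ltW G0).
Qed.

(** [hyp (- s^-1) G] is at most [(2 + 2 * normsq s) / (Im s * Im G)], where [normsq s] contains
    [r ^+ 2 * normsq h]. The disk, being convex, also contains the average [h], so this term is at
    most [r * Im s / Im z]: linear in [r], as the weight requires. *)
Let pot_res_crude w : good w ->
  pot G (res w) <=
  2 * Cz * ((1 + normc (v w)) ^+ 2 * (ratio w + (ratio w)^-1)).
Proof.
move=> [Gw Dw]; have [Nw vw xw] := Gw.
have r0 := ratio_gt0 Nw.
have h0 := Im_center_gt0 Gw.
have a0 := Im_arg_gt0 Gw.
rewrite potE ?Im_res_gt0 // resE // -addrA.
set h := center w in h0 a0 *; set r := ratio w in r0 a0 *.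
set u := v w in vw a0 *.
set s := z + (r%:C * h + u).
have s0 : 0 < Im s by rewrite ImD addr_gt0.
have sz : Im z <= Im s by rewrite ImD lerDl ltW.
have sE : Im s = Im z + (r * Im h + Im u) by rewrite /s !ImD ImCM.
have sh : r * Im h <= Im s by rewrite sE; move: z0 vw; lra.
have ns0 := normsq_gt0 s0.
have hh : normsq h * Im z <= Im h.
  apply: (@le_trans _ _ (avg (N w) (fun i => normsq (x i w)) * Im z)).
    by rewrite ler_wpM2r ?(ltW z0) // normsq_cavg_le.
  rewrite mulrC -avgZ /h /center Im_cavg; apply: le_avg => i _.
  by rewrite mulrC; exact: (Dw i I).
have num : normsq (- s^-1 - G) <= 2 / normsq s + 2.
  apply: (le_trans (normsqD2 _ _)); rewrite normsq_opp_inv // normsqN.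
  by move: G1; lra.
have ns : normsq s <= 4 * normsq z + 4 * normsq u + 2 * (r ^+ 2 * normsq h).
  have -> : s = (z + u) + r%:C * h by rewrite /s; ring.
  apply: (le_trans (normsqD2 _ _)); rewrite normsqZ.
  by have := normsqD2 z u; lra.
have rh : r ^+ 2 * normsq h * Im z <= r * Im s.
  apply: (@le_trans _ _ (r * (r * Im h))).
    have -> : r ^+ 2 * normsq h * Im z = r * (r * (normsq h * Im z)) by ring.
    by do 2 (apply: ler_wpM2l; first exact: ltW).
  by apply: ler_wpM2l => //; exact: ltW.
have main : (2 + 2 * normsq s) * Im z <= (8 + 8 * normsq z) * (1 + normsq u + r) * Im s.
  have nz := normsq_ge0 z; have nu := normsq_ge0 u.
  have b1 : normsq s * Im z <= (4 * normsq z + 4 * normsq u) * Im s + 2 * (r * Im s).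
    apply: (@le_trans _ _ ((4 * normsq z + 4 * normsq u + 2 * (r ^+ 2 * normsq h)) * Im z)).
      by rewrite ler_wpM2r // ltW.
    rewrite mulrDl; apply: lerD; first by rewrite ler_wpM2l // addr_ge0 ?mulr_ge0.
    by rewrite -mulrA; lra.
  have b2 : 0 <= normsq z * normsq u * Im s := mulr_ge0 (mulr_ge0 nz nu) (ltW s0).
  have b3 : 0 <= normsq z * r * Im s := mulr_ge0 (mulr_ge0 nz (ltW r0)) (ltW s0).
  have b4 : 0 <= normsq u * Im s := mulr_ge0 nu (ltW s0).
  have b5 : 0 <= r * Im s := mulr_ge0 (ltW r0) (ltW s0).
  move: (normsq z) (normsq u) (normsq s) (Im s) (Im z) b1 b2 b3 b4 b5 sz s0 => a b e y t b1 b2 b3 b4 b5 sz s0.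
  by lra.
have e1 : hyp (- s^-1) G <= (2 + 2 * normsq s) / (Im s * Im G).
  rewrite /hyp Im_opp_inv.
  have -> : (2 + 2 * normsq s) / (Im s * Im G) = (2 / normsq s + 2) / (Im s / normsq s * Im G).
    by field; rewrite !gt_eqF.
  by rewrite ler_wpM2r // invr_ge0 !mulr_ge0 ?invr_ge0 ?ltW.
apply: (le_trans e1).
apply: (@le_trans _ _ (Cz * (1 + normsq u + r))).
  rewrite ler_pdivrMr ?mulr_gt0 //.
  have -> : Cz * (1 + normsq u + r) * (Im s * Im G) =
     (8 + 8 * normsq z) * (1 + normsq u + r) * Im s / Im z.
    by rewrite /Cz; field; rewrite !gt_eqF.
  by rewrite ler_pdivlMr.
rewrite [X in _ <= X](_ : _ = Cz * (2 * ((1 + normc u) ^+ 2 * (r + r^-1)))); last by ring.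
apply: (ler_wpM2l Cz_ge0).
have r1 := add_inv_ge1 r0.
have ri : 0 < r^-1 by rewrite invr_gt0.
have n0 := normc_ge0 u; rewrite -normc_sq.
move: (r^-1) (normc u) r1 ri n0 => t m r1 ri n0.
have m0 : 0 <= m ^+ 2 by exact: sqr_ge0.
have a1 : 0 <= (2 * m + m ^+ 2) * (r + t) by rewrite mulr_ge0 //; lra.
have a2 : m ^+ 2 <= m ^+ 2 * (r + t) by rewrite ler_peMr.
have a3 : 0 <= m * (r + t) by rewrite mulr_ge0 //; lra.
by lra.
Qed.

Lemma moment_p_fin : moment p \is a fin_num.
Proof.
have [l0 l1] := andP l01; rewrite ge0_fin_numE ?moment_ge0 //.
rewrite /moment -(res_integral (f := fun y => pot G y `^ p)); last 2 first.
- exact: measurable_potX.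
- by move=> y; exact: powR_ge0.
(* On the good event [(1 + normc v) ^+ 2 <= 4], and [r + r^-1 <= 3 / 2 + 2 = 7 / 2]. *)
pose M := (2 * 2) `^ p * (7 / 2) `^ p.
have M0 : 0 <= M by rewrite mulr_ge0 ?powR_ge0.
pose g w := (2 * Cz) `^ p * (M + offN w).
have W0 w : 0 <= offN w by exact: offE_ge0.
have mW := measurable_offN.
have mg : measurable_fun setT g.
  by apply: measurable_funM => //; apply: measurable_funD.
have g0 w : 0 <= g w by rewrite mulr_ge0 ?powR_ge0 // addr_ge0.
apply: (@le_lt_trans _ _ (\int[P]_w (g w)%:E)%E).
  apply: (ae_le_integral measurable_good prob_good).
  - apply/measurable_EFinP.
    exact: (measurableT_comp (measurable_potX G p) measurable_res).
  - exact/measurable_EFinP.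
  - by move=> w; rewrite lee_fin powR_ge0.
  - by move=> w; rewrite lee_fin.
  move=> w gw; rewrite lee_fin; have [Gw _] := gw; have [Nw vw xw] := Gw.
  have r0 := ratio_gt0 Nw; have r1 := add_inv_ge1 r0.
  have n0 := normc_ge0 (v w).
  have Wp : 0 <= (1 + normc (v w)) ^+ 2 * (ratio w + (ratio w)^-1).
    by rewrite mulr_ge0 ?sqr_ge0 //; lra.
  apply: (@le_trans _ _ ((2 * Cz * ((1 + normc (v w)) ^+ 2 * (ratio w + (ratio w)^-1))) `^ p)).
    by apply: powR_le; [exact: p0|exact: pot_ge0|exact: pot_res_crude].
  have k0 : 0 <= 2 * Cz by rewrite mulr_ge0.
  rewrite (powRM _ k0 Wp) /g ler_wpM2l ?powR_ge0 // /offE indicE.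
  have [inE'|nE] := boolP (NV w \in ~` setE dd lam).
    apply: le_trans (_ : weight p dd (NV w) <= _); last by rewrite mul1r lerDr.
    have pp : 0 <= p <= p by rewrite lexx p0.
    exact: (@weight_ge R p p dd (NV w) pp dd0 Nw).
  rewrite mul0r addr0.
  have /= [vl _ /andP[ra rb]] : setE dd lam (NV w).
    by move: nE; rewrite notin_setE => /contrapT.
  rewrite -/(ratio w) in ra rb.
  rewrite /M -powRM //; apply: powR_le => //.
  apply: ler_pM; rewrite ?sqr_ge0 //; first by lra.
    rewrite expr2; apply: ler_pM; rewrite ?addr_ge0 //; lra.
  have : (ratio w)^-1 <= 2.
    by rewrite -[2]invrK lef_pV2 ?posrE ?invr_gt0 //; lra.
  by lra.
rewrite integralZ_EFin ?powR_ge0 //; last 2 first.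
- exact: measurable_funD.
- by move=> w; exact: addr_ge0.
rewrite lte_mul_pinfty ?lee_fin ?powR_ge0 // integralD_EFin //.
by rewrite integral_cst_prob alE -EFinD ltry.
Qed.

End finiteness.

(** * The second moment *)

Section second_moment.

Lemma onN_le1 w : onE (NV w) <= 1.
Proof. by rewrite /onE indicE; case: (_ \in _). Qed.

Lemma al_ge0 : 0 <= al.
Proof.
by rewrite -lee_fin -alE; apply: integral_ge0 => w _; rewrite lee_fin offE_ge0.
Qed.

(** [pE] is the probability of the good event. Almost surely the weight in [alpha] is at least 1, so
    the complement has probability at most [al]. *)
Lemma exists_prob_onE : exists pE : R,
  [/\ (\int[P]_w (onN w)%:E = pE%:E)%E, 0 <= pE <= 1 & 1 <= pE + al].
Proof.
have h1 : (\int[P]_w (onN w)%:E <= 1)%E.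
  rewrite -(integral_cst_prob P 1); apply: ge0_le_integral => //.
  - by move=> w _; rewrite lee_fin.
  - exact/measurable_EFinP/measurable_onN.
  - by move=> w _; rewrite lee_fin onN_le1.
have h0 : (0 <= \int[P]_w (onN w)%:E)%E by apply: integral_ge0 => w _; rewrite lee_fin.
have f : (\int[P]_w (onN w)%:E)%E \is a fin_num.
  by rewrite ge0_fin_numE // (le_lt_trans h1) // ltry.
exists (fine (\int[P]_w (onN w)%:E)%E); split; first by rewrite fineK.
  by rewrite fine_ge0 //= -lee_fin fineK.
rewrite -lee_fin EFinD fineK // -alE -integralD_EFin //; last 3 first.
- exact: measurable_onN.
- exact: measurable_offN.
- by move=> w; exact: offE_ge0.
rewrite -(integral_cst_prob P 1).
apply: generic_le_integral => //.
- by apply: measurable_funD; [exact: measurable_onN|exact: measurable_offN].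
- by move=> w; rewrite addr_ge0 // offE_ge0.
- by move=> w [Nw _ _]; exact: onE_offE.
Qed.

Lemma moment_le1D q : 0 <= q <= p -> (moment q <= 1 + moment p)%E.
Proof.
move=> qp; rewrite -(integral_cst_prob mu 1) /moment -integralD_EFin //; last 2 first.
- exact: measurable_potX.
- by move=> y; exact: powR_ge0.
apply: ge0_le_integral => //.
- by move=> y _; rewrite lee_fin powR_ge0.
- exact/measurable_EFinP/measurable_potX.
- apply/measurable_EFinP; apply: measurable_funD => //; exact: measurable_potX.
- by move=> y _; rewrite lee_fin; apply: powR_le1D => //; exact: pot_ge0.
Qed.

Lemma moment_fin q : 0 <= q <= p -> moment q \is a fin_num.
Proof.
move=> qp; rewrite ge0_fin_numE ?moment_ge0 //.
apply: (le_lt_trans (moment_le1D qp)).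
by rewrite lte_add_pinfty ?ltry // -ge0_fin_numE ?moment_ge0 // moment_p_fin.
Qed.

Let A : R := fine (moment 2).

Let momentA : moment 2 = A%:E.
Proof. by rewrite fineK // moment_fin //; move: p2; lra. Qed.

Let pot2 (y : R[i]) : pot G y `^ 2 = pot G y ^+ 2.
Proof. by rewrite powR_mulrn // pot_ge0. Qed.

Let A_ge0 : 0 <= A. Proof. by rewrite -lee_fin -momentA moment_ge0. Qed.

Let pot2A : (\int[mu]_y (pot G y ^+ 2)%:E = A%:E)%E.
Proof. by rewrite -momentA; apply: eq_integral => y _; rewrite pot2. Qed.

Definition cst3 (c : R) : R := 3 * cst1 c + 2 * cst1 c ^+ 2 + (2 * cst2 c) ^+ 2.

Lemma cst3_gt0 : 0 < cst3 c.
Proof.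
rewrite /cst3; have k1 := cst1_gt0 c0; have := sqr_ge0 (2 * cst2 c).
by have := sqr_ge0 (cst1 c); lra.
Qed.

(** On the good event the square at the average equals the average of the squares minus the Jensen
    gap; moving the gap to the left makes it measurable against the errors. *)
Let res_sqr_le w : generic_set w ->
  pot G (res w) ^+ 2 + onN w * abs_gap w <=
  onN w * avg_pot 2 w
  + ((3 * cst1 c + 2 * cst1 c ^+ 2) * lam * onN w + (2 * cst2 c) ^+ 2 * offN w)
    * (1 + avg_pot 2 w).
Proof.
move=> Gw; have [Nw vw xw] := Gw.
have q12 : (1 : R) < 2 <= p by apply/andP; split; [lra|exact: p2].
have := pot_res_split q12 Gw.
have k20 := ltW (cst2_gt0 c0); have k1 := cst1_gt0 c0.
have h0 := Im_center_gt0 Gw.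
rewrite pot2 powR_mulrn; last first.
  have [l0 _] := andP l01.
  have kl0 : 0 <= cst1 c * lam := mulr_ge0 (ltW k1) (ltW l0).
  by apply: addr_ge0 => //; apply: mulr_ge0; [exact: addr_ge0|exact: pot_ge0].
have k22 : 0 <= 2 * cst2 c := mulr_ge0 (ler0n _ 2) k20.
rewrite [(2 * cst2 c) `^ 2]powR_mulrn //.
have J0 := jensen_gap_ge0 G0 Nw (fun i _ => xw i).
rewrite /abs_gap (ger0_norm J0).
have JE : jensen_gap G (N w) (fun i => x i w) =
    avg_pot 2 w - pot G (center w) ^+ 2.
  rewrite /jensen_gap -/(center w) (potE G0 h0); congr (_ - _).
  by apply: eq_avg => i _; rewrite pot2 potE.
rewrite {}JE in J0 *.
have X0 := pot_ge0 G (center w).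
move: (pot G (center w)) X0 J0 => X X0.
move: (avg (N w) _) => S; move: (pot G _ ^+ 2) => Y.
have o1 : onN w = 1 \/ onN w = 0.
  by rewrite /onE indicE; case: (_ \in _); [left|right].
have of0 := offE_ge0 (NV w).
move: (onE _) (offE _) o1 of0 => o f o1 of0.
have [l0 l1] := andP l01.
move: (cst1 c) (cst2 c) k1 k20 => a b a0 b0 J0 H.
have e1 : ((1 + a * lam) * X + a * lam) ^+ 2 <=
   X ^+ 2 + (3 * a + 2 * a ^+ 2) * lam * (1 + X ^+ 2).
  have al0 : 0 <= a * lam by rewrite mulr_ge0 // ltW.
  have al1 : (a * lam) * (a * lam) <= a ^+ 2 * lam.
    have -> : a * lam * (a * lam) = a ^+ 2 * lam * lam by ring.
    by rewrite ler_piMr ?mulr_ge0 ?sqr_ge0 ?(ltW l0) //; lra.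
  have X2 : X * 2 <= 1 + X ^+ 2 by have := sqr_ge0 (X - 1); lra.
  set m := a * lam in al0 al1 *.
  have -> : (3 * a + 2 * a ^+ 2) * lam = 3 * m + 2 * (a ^+ 2 * lam) by rewrite /m; ring.
  move: (a ^+ 2 * lam) al1 => n al1.
  have n0 : 0 <= n by apply: le_trans al1; rewrite mulr_ge0.
  have XX : 0 <= X ^+ 2 by exact: sqr_ge0.
  have h1 : m * m * X ^+ 2 <= n * X ^+ 2 by rewrite ler_wpM2r.
  have h2 : m * (X * 2) <= m * (1 + X ^+ 2) by rewrite ler_wpM2l.
  have h3 : m * m * (X * 2) <= n * (1 + X ^+ 2).
    by apply: ler_pM => //; rewrite mulr_ge0.
  by lra.
have C0 : 0 <= (3 * a + 2 * a ^+ 2) * lam.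
  by rewrite mulr_ge0 ?(ltW l0) // addr_ge0 ?mulr_ge0 ?sqr_ge0 ?(ltW a0).
have e2 : (3 * a + 2 * a ^+ 2) * lam * (1 + X ^+ 2) <= (3 * a + 2 * a ^+ 2) * lam * (1 + S).
  by rewrite ler_wpM2l // lerD2l; lra.
by case: o1 H => ->; move: e1 e2; move: ((3 * a + 2 * a ^+ 2) * lam) => C e1 e2; lra.
Qed.

(** Integrating [res_sqr_le], the second moment [A] appears on the left, since the resolvent has law
    [mu], and at most [A] comes from the averages on the right. Cancelling the finite [A] leaves
    only the gap and the errors. *)
Lemma integral_gap_le :
  (\int[P]_w (onN w * abs_gap w)%:E <= (cst3 c * eta * (1 + A))%:E)%E.
Proof.
have [pE [pEE /andP[pE0 pE1] _]] := exists_prob_onE.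
have [l0 l1] := andP l01.
pose C := (3 * cst1 c + 2 * cst1 c ^+ 2) * lam.
pose K a := C * onE a + (2 * cst2 c) ^+ 2 * offE a.
have C0 : 0 <= C.
  have k1 := ltW (cst1_gt0 c0).
  by rewrite mulr_ge0 ?(ltW l0) // addr_ge0 ?mulr_ge0 ?sqr_ge0.
have D0 : 0 <= (2 * cst2 c) ^+ 2 by exact: sqr_ge0.
have mK : measurable_fun setT K.
  apply: measurable_funD; apply: measurable_funM => //.
    exact: measurable_onE.
  exact: measurable_offE.
have K0 a : 0 <= K a by rewrite addr_ge0 // mulr_ge0 // offE_ge0.
have mres : measurable_fun setT (fun w => pot G (res w) ^+ 2).
  by apply: measurable_funX; apply: measurable_pot_comp; exact: measurable_res.
have mL : measurable_fun setT (fun w => onN w * abs_gap w).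
  by apply: measurable_funM; [exact: measurable_onN|exact: measurable_abs_gap].
have L0 w : 0 <= onN w * abs_gap w by rewrite mulr_ge0 // normr_ge0.
have H1 : (\int[P]_w (onN w * avg_pot 2 w)%:E <= (pE * A)%:E)%E.
  rewrite (avg_integral1 (K := onE) (f := fun y => pot G y `^ 2)) //; first last.
  - by rewrite -/(moment 2) momentA.
  - by move=> u; exact: onE_small.
  - by move=> y; exact: powR_ge0.
  - exact: measurable_potX.
  - exact: measurable_onE.
  by rewrite -/(moment 2) momentA pEE.
have H2 : (\int[P]_w (K (NV w))%:E <= ((2 * cst2 c) ^+ 2 * al + C)%:E)%E.
  apply: (affine_integral_le measurable_offN) => //.
  - exact: (measurableT_comp mK measurable_NV).
  - by move=> w; exact: offE_ge0.
  - by move=> w; rewrite /K addrC lerD2l ler_piMr // onN_le1.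
  - by rewrite alE.
have H := generic_bound (measurable_funD mres mL) _ mK _ _ K0 _ res_sqr_le H1 H2 momentA.
have {H} : (\int[P]_w (pot G (res w) ^+ 2 + onN w * abs_gap w)%:E <=
    (pE * A + ((2 * cst2 c) ^+ 2 * al + C) * (1 + A))%:E)%E.
  apply: H.
  - by apply: measurable_funM; [exact: measurable_onN|exact: measurable_avg_potX].
  - by move=> w; rewrite addr_ge0 ?sqr_ge0.
  - by move=> w; rewrite mulr_ge0 // avg_pot_ge0.
  - by move=> u; rewrite /K onE_small // offE0 !mulr0 addr0.
rewrite integralD_EFin //; last by move=> w; exact: sqr_ge0.
rewrite (res_integral (f := fun y => pot G y ^+ 2)); first last.
- by move=> y; exact: sqr_ge0.
- by apply: measurable_funX; exact: measurable_pot_comp.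
rewrite pot2A => H.
have Lge : (0 <= \int[P]_w (onN w * abs_gap w)%:E)%E.
  by apply: integral_ge0 => w _; rewrite lee_fin.
move: H Lge; case: (\int[P]_w _)%E => [L|//|//]; rewrite -EFinD !lee_fin => H _.
have al0 := al_ge0.
have a1 : pE * A <= A by rewrite ler_piMl.
have a3 : ((2 * cst2 c) ^+ 2 * al + C) * (1 + A) <= (cst3 c * eta) * (1 + A).
  rewrite ler_wpM2r ?addr_ge0 //.
  have k1 := ltW (cst1_gt0 c0).
  have k30 : 0 <= 3 * cst1 c + 2 * cst1 c ^+ 2 by rewrite addr_ge0 ?mulr_ge0 ?sqr_ge0.
  rewrite /C /cst3 /eta.
  have b1 := mulr_ge0 k30 al0; have b2 := mulr_ge0 D0 (ltW l0).
  by move: ((2 * cst2 c) ^+ 2) (3 * cst1 c + 2 * cst1 c ^+ 2) b1 b2 => D C' b1 b2; lra.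
by lra.
Qed.

Let mpot2 : measurable_fun setT (fun y : R[i] => pot G y ^+ 2).
Proof. by apply: measurable_funX; exact: measurable_pot_comp. Qed.

Let mu_le_integral (f g : R[i] -> R) : measurable_fun setT f -> measurable_fun setT g ->
  (forall y, 0 <= f y) -> (forall y, 0 <= g y) ->
  (forall y, 0 < Im y -> f y <= g y) ->
  (\int[mu]_y (f y)%:E <= \int[mu]_y (g y)%:E)%E.
Proof.
move=> mf mg f0 g0 fg.
apply: (ae_le_integral measurable_upper mu0).
- exact/measurable_EFinP.
- exact/measurable_EFinP.
- by move=> y; rewrite lee_fin.
- by move=> y; rewrite lee_fin.
- by move=> y y0; rewrite lee_fin; exact: fg.
Qed.

Let pair_defect : \bar R := (\int[prob_sqr mu]_a (defectU G a)%:E)%E.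

Let pair_defect_le : (pair_defect <= A%:E)%E.
Proof.
apply: (@le_trans _ _ (\int[prob_sqr mu]_a (2^-1 * pot G a.1 ^+ 2 + 2^-1 * pot G a.2 ^+ 2)%:E)%E).
  apply: ge0_le_integral => //.
  - by move=> a _; rewrite lee_fin defectU_ge0.
  - by apply/measurable_EFinP; exact: measurable_defectU.
  - apply/measurable_EFinP; apply: measurable_funD; apply: measurable_funM => //.
      exact: (measurableT_comp mpot2 measurable_fst).
    exact: (measurableT_comp mpot2 measurable_snd).
  - move=> a _; rewrite lee_fin; apply: (le_trans (defectU_le G0 a)).
    by rewrite mulrC mulrDr.
have h0 (y : R[i]) : 0 <= 2^-1 * pot G y ^+ 2 by rewrite mulr_ge0 ?sqr_ge0.
have mh : measurable_fun setT (fun y : R[i] => 2^-1 * pot G y ^+ 2).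
  exact: measurable_funM.
rewrite (prob_sqr_add mu mh mh h0 h0).
have -> : (\int[mu]_y (2^-1 * pot G y ^+ 2)%:E = (2^-1 * A)%:E)%E.
  by rewrite integralZ_EFin // ?pot2A // => y; exact: sqr_ge0.
by rewrite -EFinD lee_fin; lra.
Qed.

Let pair_defect_fin : pair_defect \is a fin_num.
Proof.
rewrite ge0_fin_numE; first exact: (le_lt_trans pair_defect_le (ltry _)).
by apply: integral_ge0 => a _; rewrite lee_fin defectU_ge0.
Qed.

Let slice_defect (s : R[i]) : \bar R := (\int[mu]_y (defectU G (s, y))%:E)%E.

Let pair_defectE : pair_defect = (\int[mu]_s slice_defect s)%E.
Proof.
rewrite /pair_defect (@prob_sqr_integral _ mu (fun a => (defectU G a)%:E)) //.
- by apply/measurable_EFinP; exact: measurable_defectU.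
- by move=> a; rewrite lee_fin defectU_ge0.
Qed.

Let measurable_slice : measurable_fun setT slice_defect.
Proof.
apply: (@measurable_fun_fubini_tonelli_F _ _ _ _ R mu (fun a => (defectU G a)%:E)).
- by apply/measurable_EFinP; exact: measurable_defectU.
- by move=> a; rewrite lee_fin defectU_ge0.
Qed.

Let slice_ge0 s : (0 <= slice_defect s)%E.
Proof. by apply: integral_ge0 => y _; rewrite lee_fin defectU_ge0. Qed.

(** Otherwise every point [s] would satisfy the reverse inequality, and integrating in [s] would
    give [pair_defect >= 3 * kap * A]. *)
Let exists_center (kap : R) : 0 < kap -> 0 < A ->
  (pair_defect <= (2 * kap * A)%:E)%E ->
  exists s : R[i], [/\ 0 < Im s, 0 < pot G s &
    (slice_defect s <= (3 * kap * pot G s ^+ 2)%:E)%E].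
Proof.
move=> k0 A0 H; apply: contrapT => nex.
have far s : 0 < Im s -> ((3 * kap * pot G s ^+ 2)%:E <= slice_defect s)%E.
  move=> s0; have [t0|t0] := ltP 0 (pot G s).
    rewrite leNgt; apply/negP => lt; apply: nex; exists s; split => //.
    exact: ltW.
  have -> : pot G s = 0 by apply/eqP; rewrite eq_le t0 pot_ge0.
  by rewrite expr0n mulr0.
have : ((3 * kap * A)%:E <= pair_defect)%E.
  rewrite pair_defectE EFinM -pot2A -integralZ_EFin //; last 2 first.
  - by rewrite mulr_ge0 // ltW.
  - by move=> y; exact: sqr_ge0.
  apply: (ae_le_integral measurable_upper mu0) => //.
  - by apply/measurable_EFinP; exact: measurable_funM.
  - by move=> y; rewrite lee_fin mulr_ge0 ?sqr_ge0 // mulr_ge0 // ltW.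
move/le_trans => /(_ _ H); rewrite lee_fin => h.
have : 0 < kap * A by rewrite mulr_gt0.
by lra.
Qed.

(** With [a = pot G y] and [t = pot G s], [a ^+ 2 <= 2 * (a - t) ^+ 2 + 2 * t ^+ 2], and the defect
    dominates [(a - t) ^+ 2 / 4]. Integrating in [y] gives [A <= (24 * kap + 2) * t ^+ 2]. *)
Let moment_le_center (kap : R) s : 0 <= kap <= 1 / 24 -> 0 < Im s ->
  (slice_defect s <= (3 * kap * pot G s ^+ 2)%:E)%E -> A <= 3 * pot G s ^+ 2.
Proof.
move=> /andP[k0 k1] s0 H; set t := pot G s in H *.
have t2 : 0 <= t ^+ 2 by exact: sqr_ge0.
have : (A%:E <= \int[mu]_y (8 * defectU G (s, y) + 2 * t ^+ 2)%:E)%E.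
  rewrite -pot2A; apply: mu_le_integral => //.
  - by apply: measurable_funD => //; apply: measurable_funM => //; exact: measurable_defectU_l.
  - by move=> y; exact: sqr_ge0.
  - by move=> y; apply: addr_ge0; apply: mulr_ge0 => //; exact: defectU_ge0.
  - move=> y y0; rewrite defectUC defectUE //.
    have := defect_ge G0 y0 s0.
    have gp := hyp_gap_ge0 G0 y0 s0.
    have hy := hyp_ge0 y0 G0; have hs := hyp_ge0 s0 G0.
    have gp2 : 0 <= hyp_gap G y s * (hyp y G + hyp s G).
      by rewrite mulr_ge0 // addr_ge0.
    rewrite /t !potE //; move: (hyp y G) (hyp s G) (defect G y s) gp2 => a b D gp2 h.
    by have := sqr_ge0 (a - 2 * b); lra.
have mD := measurable_defectU_l G s.
rewrite integralD_EFin //; last 3 first.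
- exact: measurable_funM.
- by move=> y; rewrite mulr_ge0 ?defectU_ge0.
- by move=> y; exact: mulr_ge0.
rewrite integral_cst_prob integralZ_EFin //; last by move=> y; exact: defectU_ge0.
rewrite -/(slice_defect s).
move: (slice_ge0 s) H; case: (slice_defect s) => [D|//|//] _.
rewrite -EFinM -EFinD !lee_fin => HD HA.
have : kap * t ^+ 2 <= 1 / 24 * t ^+ 2 by rewrite ler_wpM2r.
by lra.
Qed.

(** [cst_gap] and [cst_lam] are the constants in the conclusion and the smallness hypothesis of
    [no_concentration]. The 20 in [cst_kap] closes the final count, which needs a divisor above 18.
    The two terms of [cst_moment] let a large [A] absorb the Jensen gap and enforce that smallness
    hypothesis. *)
Definition cst_gap (c' : R) : R := (c' / 40 / 20) ^+ 2 / 3.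
Definition cst_lam (c c' : R) : R := (c' / 40) ^+ 2 * c ^+ 2.
Definition cst_kap (c' : R) : R := cst_gap c' / 20.
Definition cst_moment (c c' : R) : R := 2 * cst3 c / cst_kap c' + 108 / cst_lam c c'.

Lemma cst_gap_bounds : 0 < cst_gap c' <= 1 / 3.
Proof.
have [c'00 c'01] := andP c'0; rewrite /cst_gap; apply/andP; split.
  by rewrite divr_gt0 // exprn_gt0 // !divr_gt0.
have : c' / 40 / 20 <= 1 by lra.
have : 0 <= c' / 40 / 20 by lra.
by move: (c' / 40 / 20) => y y0 y1; nra.
Qed.

Lemma cst_lam_gt0 : 0 < cst_lam c c'.
Proof.
have [c'00 _] := andP c'0.
by rewrite mulr_gt0 ?exprn_gt0 // divr_gt0.
Qed.

(** By contradiction: a larger [A] makes the mean pair defect small relative to [A], so that some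
    point [s] nearly represents the whole law, and [no_concentration] with this [s] fails on
    average. *)
Lemma second_moment_le :
  eta <= 1 / 2 -> 2 * cst3 c * eta <= cst_kap c' -> 36 * eta <= cst_lam c c' ->
  (moment 2 <= (cst_moment c c' * eta)%:E)%E.
Proof.
move=> eta1 eta2 eta3; rewrite momentA lee_fin leNgt; apply/negP => HA.
have [l0 l1] := andP l01.
have al0 : 0 <= al := al_ge0.
have eta0 : 0 < eta by rewrite ltr_pwDl.
have C30 : 0 < cst3 c := cst3_gt0.
have [g0 g1] := andP cst_gap_bounds.
have k0 : 0 < cst_kap c' by rewrite divr_gt0.
have k24 : 0 <= cst_kap c' <= 1 / 24 by rewrite (ltW k0) /cst_kap /=; lra.
have lm0 := cst_lam_gt0.
have r1 : 0 <= 2 * cst3 c / cst_kap c'.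
  by apply: divr_ge0; [apply: mulr_ge0; [exact: ler0n|exact: ltW]|exact: ltW].
have r2 : 0 <= 108 / cst_lam c c' by apply: divr_ge0; [exact: ler0n|exact: ltW].
have Apos : 0 < A.
  apply: le_lt_trans HA; apply: mulr_ge0; last exact: ltW.
  exact: addr_ge0.
have A1 : 2 * cst3 c / cst_kap c' * eta <= A.
  by apply: le_trans (ltW HA); rewrite ler_wpM2r ?(ltW eta0) // lerDl.
have A2 : 108 / cst_lam c c' * eta <= A.
  by apply: le_trans (ltW HA); rewrite ler_wpM2r ?(ltW eta0) // lerDr.
(* Half of the right side absorbs the 1, because [A] is large compared with [eta]; the other half
   absorbs [A], because [eta] is small. *)
have gapA : cst3 c * eta * (1 + A) <= cst_kap c' * A.
  have : 2 * cst3 c * eta <= cst_kap c' * A.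
    by move: A1; rewrite mulrAC ler_pdivrMr // [A * _]mulrC.
  have : 2 * cst3 c * eta * A <= cst_kap c' * A by rewrite ler_wpM2r.
  by lra.
have [pE [pEE /andP[pE0 pE1] pEal]] := exists_prob_onE.
have pEhalf : 1 / 2 <= pE by move: eta1; rewrite /eta; lra.
have Lint := integral_gap_le.
have LkA : (\int[P]_w (onN w * abs_gap w)%:E <= (cst_kap c' * A)%:E)%E.
  by apply: (le_trans Lint); rewrite lee_fin.
have mL : measurable_fun setT (fun w => onN w * abs_gap w).
  by apply: measurable_funM; [exact: measurable_onN|exact: measurable_abs_gap].
have L0 w : 0 <= onN w * abs_gap w by rewrite mulr_ge0 // normr_ge0.
have mpair : measurable_fun setT (fun w => avg (N w)
     (fun i => defectU G (x i w, x (next (N w) i) w))).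
  apply: (@measurable_avg R _ T (fun n i w => defectU G (x i w, x (next n i) w))) => // n i.
  exact: (measurableT_comp (measurable_defectU G) (measurable_xx i (next n i))).
have pair : (pair_defect <= (2 * cst_kap c' * A)%:E)%E.
  have : (pE%:E * pair_defect <= (cst_kap c' * A)%:E)%E.
    rewrite -pEE -(avg_integral_next) //; first last.
    - by move=> n u; exact: onE_small.
    - exact: defectU_ge0.
    - exact: measurable_defectU.
    - exact: measurable_onE.
    apply: le_trans LkA; apply: generic_le_integral => //.
    - by apply: measurable_funM => //; exact: measurable_onN.
    - by move=> w; rewrite mulr_ge0 // avg_ge0 // => i _; exact: defectU_ge0.
    - move=> w [Nw vw xw]; rewrite ler_wpM2l // /abs_gap ger0_norm; last first.
        exact: jensen_gap_ge0.
      apply: le_trans (jensen_gap_defect G0 Nw (fun i _ => xw i)).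
      by apply: le_avg => i _; rewrite defectUE.
  rewrite -[pair_defect]fineK // -EFinM !lee_fin => h.
  have pd0 : 0 <= fine pair_defect.
    by rewrite fine_ge0 // integral_ge0 // => a _; rewrite lee_fin defectU_ge0.
  have : 1 / 2 * fine pair_defect <= pE * fine pair_defect by rewrite ler_wpM2r.
  by lra.
have [s [s0 t0 Ds]] := exists_center k0 Apos pair.
have At := moment_le_center k24 s0 Ds.
set t := pot G s in t0 Ds At.
(* For [t >= 1] the smallness of [eta] suffices, as [4 * (t + 8) <= 36 * t]. For [t < 1] it is the
   lower bound on [A], hence on [3 * t ^+ 2], that keeps [t] large compared with [eta];
   [108 = 3 * 36]. *)
have lamt : 4 * lam ^+ 2 * (t + 8) <= (c' / 40) ^+ 2 * c ^+ 2 * t.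
  rewrite -/(cst_lam c c').
  have le : lam <= eta by rewrite lerDl.
  have ll : lam ^+ 2 <= lam by rewrite expr2 ler_piMl ?(ltW l0) //; lra.
  have [t1|t1] := leP 1 t.
    have : lam ^+ 2 * (t + 8) <= lam * (9 * t).
      by apply: ler_pM => //; [exact: sqr_ge0|lra|lra].
    have : lam * t <= eta * t by rewrite ler_wpM2r // ltW.
    have : 36 * eta * t <= cst_lam c c' * t by rewrite ler_wpM2r // ltW.
    by lra.
  have h1 : 108 * eta <= 3 * t ^+ 2 * cst_lam c c'.
    have := le_trans A2 At.
    by rewrite mulrAC ler_pdivrMr.
  have h2 : lam ^+ 2 * (t + 8) <= lam * 9.
    by apply: ler_pM => //; [exact: sqr_ge0|lra|lra].
  have h3 : t ^+ 2 * cst_lam c c' <= t * cst_lam c c'.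
    by rewrite ler_wpM2r ?(ltW lm0) // expr2 ler_piMl // ltW.
  by lra.
have tE : t = hyp s G by rewrite /t potE.
have slice : slice_defect s \is a fin_num.
  by rewrite ge0_fin_numE // (le_lt_trans Ds) // ltry.
have mres : measurable_fun setT (fun w => defectU G (s, res w)).
  exact: (measurableT_comp (measurable_defectU_l G s) measurable_res).
have mavs : measurable_fun setT (fun w => avg (N w) (fun i => defectU G (s, x i w))).
  apply: (@measurable_avg R _ T (fun _ i w => defectU G (s, x i w))) => // _ i.
  exact: (measurableT_comp (measurable_defectU_l G s)).
have avs0 w : 0 <= avg (N w) (fun i => defectU G (s, x i w)).
  by apply: avg_ge0 => i _; exact: defectU_ge0.
have mon := measurable_onN.
(* [no_concentration] integrated over the good event with [s] fixed. Resolvent and copies both have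
   law [mu], so the right side will be [slice_defect s] counted at most twice, plus the gap. *)
have key : (\int[P]_w (cst_gap c' * t ^+ 2 * onN w)%:E <=
   \int[P]_w (defectU G (s, res w) +
     (onN w * avg (N w) (fun i => defectU G (s, x i w)) + onN w * abs_gap w))%:E)%E.
  apply: generic_le_integral.
  - exact: measurable_funM.
  - by apply: measurable_funD => //; apply: measurable_funD => //; exact: measurable_funM.
  - by move=> w; rewrite mulr_ge0 // mulr_ge0 ?sqr_ge0 // ltW.
  - by move=> w; rewrite addr_ge0 ?defectU_ge0 // addr_ge0 // mulr_ge0.
  move=> w Gw; have [Nw vw xw] := Gw.
  have [oE|/eqP] := eqVneq (onN w) 0.
    by rewrite oE !mul0r mulr0 !addr0 defectU_ge0.
  rewrite /onE indicE; case: (boolP (_ \in _)) => // + _.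
  rewrite inE => -[/= vl _ rl]; rewrite mulr1 !mul1r.
  have rs : 0 < Im (res w) by exact: (Im_res_gt0 Gw).
  rewrite defectUE // defectC /abs_gap ger0_norm; last exact: jensen_gap_ge0.
  rewrite (eq_avg (f' := fun i => defect G (x i w) s)); last first.
    by move=> i _; rewrite defectUE // defectC.
  rewrite addrA resE //.
  have cc : 0 < c <= Im G by rewrite c0.
  have vl2 : normsq (v w) <= lam ^+ 2 by apply: normsq_le; exact: ltW.
  exact: (no_concentration c'0 cc G1 GE ReG (ltW z0) Nw (fun i _ => xw i) s0 tE t0 l01 rl vl2 vw lamt).
move: key.
have -> : (\int[P]_w (cst_gap c' * t ^+ 2 * onN w)%:E = (cst_gap c' * t ^+ 2 * pE)%:E)%E.
  by rewrite integralZ_EFin ?pEE ?EFinM // mulr_ge0 ?sqr_ge0 // ltW.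
have ma := measurable_funM mon mavs.
rewrite integralD_EFin //; last 3 first.
- exact: measurable_funD.
- by move=> w; exact: defectU_ge0.
- by move=> w; rewrite addr_ge0 // mulr_ge0.
rewrite integralD_EFin //; last by move=> w; exact: mulr_ge0.
rewrite (res_integral (f := fun y => defectU G (s, y))); last 2 first.
- exact: measurable_defectU_l.
- by move=> y; exact: defectU_ge0.
rewrite (avg_integral1 (K := onE) (f := fun y => defectU G (s, y))) //; last 4 first.
- exact: measurable_onE.
- exact: measurable_defectU_l.
- by move=> y; exact: defectU_ge0.
- by move=> u; exact: onE_small.
rewrite -/(slice_defect s) pEE.
move: LkA.
have Lge : (0 <= \int[P]_w (onN w * abs_gap w)%:E)%E.
  by apply: integral_ge0 => w _; rewrite lee_fin.
move: Lge; case: (\int[P]_w (onN w * abs_gap w)%:E)%E => [L|//|//] _; rewrite lee_fin => LA.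
move: Ds (slice_ge0 s) slice; case: (slice_defect s) => [D|//|//]; rewrite !lee_fin => DD D0 _ key.
have key' : cst_gap c' * t ^+ 2 * pE <= D + (pE * D + L) by rewrite -lee_fin.
(* The count: [2 * D + L] is at most [6 + 3 = 9] times [cst_kap c' * t ^+ 2], that is [9 / 20] of
   [cst_gap c' * t ^+ 2], while the left side keeps at least one half. *)
have tt : 0 < cst_gap c' * t ^+ 2 by rewrite mulr_gt0 // exprn_gt0.
have q1 : pE * D <= D by rewrite ler_piMl.
have q2 : cst_gap c' * t ^+ 2 * (1 / 2) <= cst_gap c' * t ^+ 2 * pE by rewrite ler_wpM2l // ltW.
have q3 : cst_kap c' * A <= cst_kap c' * (3 * t ^+ 2) by rewrite ler_wpM2l // ltW.
have q4 : cst_kap c' * t ^+ 2 = cst_gap c' * t ^+ 2 / 20 by rewrite /cst_kap; field.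
by move: q4 q3 q2 q1 tt key' LA DD; move: (cst_kap c') (cst_gap c') (t ^+ 2) => kk gg u q4 q3 q2 q1 tt key' LA DD; lra.
Qed.

End second_moment.

(** * The [p]-th moment of the tree recursion *)

Section moment_bound.

Let pair_bound (a : R[i] * R[i]) : R :=
  (3 / 8 * pot G a.1 `^ p + 3 / 8 * pot G a.2 `^ p)
  + (7 `^ p * pot G a.1 `^ 2 * pot G a.2 `^ (p - 2) + (22 * cst1 c) `^ p * lam).

Let pair_bound_ge0 a : 0 <= pair_bound a.
Proof.
have [l0 _] := andP l01.
by rewrite !addr_ge0 // ?mulr_ge0 ?powR_ge0 // ltW.
Qed.

Let measurable_pot1 q : measurable_fun setT (fun a : R[i] * R[i] => pot G a.1 `^ q).
Proof. exact: (measurableT_comp (measurable_potX G q) measurable_fst). Qed.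

Let measurable_pot2 q : measurable_fun setT (fun a : R[i] * R[i] => pot G a.2 `^ q).
Proof. exact: (measurableT_comp (measurable_potX G q) measurable_snd). Qed.

Let measurable_pair_bound : measurable_fun setT pair_bound.
Proof.
apply: measurable_funD; apply: measurable_funD => //; try exact: measurable_funM.
by apply: measurable_funM => //; exact: measurable_funM.
Qed.

(** The mean of the copies is also the mean, around the cycle, of the averages of two neighbours.
    Convexity of the power then reduces everything to [powR_pair] for two independent copies. *)
Let res_pow_le w : generic_set w ->
  pot G (res w) `^ p <=
  onN w * avg (N w) (fun i => pair_bound (x i w, x (next (N w) i) w))
  + (2 * cst2 c) `^ p * offN w * (1 + avg_pot p w).
Proof.
move=> Gw; have [Nw vw xw] := Gw.
have p1p : 1 < p <= p by rewrite lexx andbT.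
apply: (le_trans (pot_res_split p1p Gw)).
rewrite lerD2r ler_wpM2l //.
have [l0 l1] := andP l01.
have k1 := cst1_gt0 c0.
have cl0 : 0 <= cst1 c * lam := mulr_ge0 (ltW k1) (ltW l0).
pose b i := (1 + cst1 c * lam) * ((pot G (x i w) + pot G (x (next (N w) i) w)) / 2) + cst1 c * lam.
have b0 i : 0 <= b i.
  apply: addr_ge0 => //; apply: mulr_ge0; first exact: addr_ge0.
  by apply: divr_ge0 => //; apply: addr_ge0; exact: pot_ge0.
have hb : (1 + cst1 c * lam) * pot G (center w) + cst1 c * lam <= avg (N w) b.
  rewrite /b avgD avgZ avg_cst // lerD2r ler_wpM2l ?addr_ge0 //.
  apply: (le_trans (pot_center_le Gw)).
  rewrite [leRHS](eq_avg (f' := fun i => 2^-1 * pot G (x i w) + 2^-1 * pot G (x (next (N w) i) w))); last first.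
    by move=> i _; rewrite mulrC mulrDr.
  rewrite avgD !avgZ (avg_next (fun i => pot G (x i w))) //.
  by rewrite -mulrDl (_ : 2^-1 + 2^-1 = 1 :> R) ?mul1r //; lra.
have hb0 : 0 <= (1 + cst1 c * lam) * pot G (center w) + cst1 c * lam.
  apply: addr_ge0 => //; apply: mulr_ge0; first exact: addr_ge0.
  exact: pot_ge0.
apply: (le_trans (powR_le p0 hb0 hb)).
apply: (le_trans (powR_avg_le p1 Nw (fun i _ => b0 i))).
apply: le_avg => i _.
have l01' : 0 < lam <= 1 by rewrite l0 /=; lra.
apply: (le_trans (powR_pair p2 (pot_ge0 G (x i w)) (pot_ge0 G (x (next (N w) i) w)) (ltW k1) l01' cl)).
rewrite /pair_bound /= [pot G (x i w) `^ 2]powR_mulrn; last exact: pot_ge0.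
by rewrite le_eqVlt; apply/orP; left; apply/eqP; ring.
Qed.

Let A : R := fine (moment p).

Let momentA : moment p = A%:E.
Proof. by rewrite fineK // (moment_p_fin). Qed.

Let A_ge0 : 0 <= A. Proof. by rewrite -lee_fin -momentA moment_ge0. Qed.

(** Each of the two variables contributes [3 / 8 * A]. The mixed term factorises by independence
    into the moments of order 2 and [p - 2], the latter at most [1 + A], so it is small because the
    second moment is. *)
Lemma pair_bound_integral (K2 : R) : (moment 2 <= K2%:E)%E -> 0 <= K2 ->
  (\int[prob_sqr mu]_a (pair_bound a)%:E <=
    (3 / 4 * A + 7 `^ p * K2 * (1 + A) + (22 * cst1 c) `^ p * lam)%:E)%E.
Proof.
move=> HK K20.
have [l0 l1] := andP l01.
have mp : measurable_fun setT (fun y : R[i] => 3 / 8 * pot G y `^ p).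
  by apply: measurable_funM => //; exact: measurable_potX.
have mq : measurable_fun setT (fun y : R[i] => 7 `^ p * pot G y `^ 2).
  by apply: measurable_funM => //; exact: measurable_potX.
have p00 (y : R[i]) : 0 <= 3 / 8 * pot G y `^ p by rewrite mulr_ge0 ?powR_ge0.
have q00 (y : R[i]) : 0 <= 7 `^ p * pot G y `^ 2 by rewrite mulr_ge0 ?powR_ge0.
have r00 (y : R[i]) : 0 <= pot G y `^ (p - 2) by exact: powR_ge0.
have M0 : 0 <= (22 * cst1 c) `^ p * lam by rewrite mulr_ge0 ?powR_ge0 // ltW.
have mpr : measurable_fun setT (fun a : R[i] * R[i] => 7 `^ p * pot G a.1 `^ 2 * pot G a.2 `^ (p - 2)).
  by apply: measurable_funM => //; exact: measurable_funM.
rewrite integralD_EFin; last 4 first.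
- by apply: measurable_funD; exact: measurable_funM.
- exact: measurable_funD.
- by move=> a; rewrite addr_ge0.
- by move=> a; rewrite addr_ge0 // mulr_ge0.
rewrite (prob_sqr_add mu mp mp p00 p00) integralD_EFin //; last by move=> a; exact: mulr_ge0.
rewrite integral_cst_prob.
rewrite (prob_sqr_mul mu mq (measurable_potX G (p - 2)) q00 r00).
have -> : (\int[mu]_y (3 / 8 * pot G y `^ p)%:E = (3 / 8 * A)%:E)%E.
  rewrite integralZ_EFin //; last by move=> y; exact: powR_ge0.
    by rewrite -/(moment p) momentA.
  exact: measurable_potX.
have h2 : (\int[mu]_y (7 `^ p * pot G y `^ 2)%:E <= (7 `^ p * K2)%:E)%E.
  rewrite integralZ_EFin ?powR_ge0 //; last by move=> y; exact: powR_ge0.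
    by rewrite EFinM lee_wpmul2l // lee_fin powR_ge0.
  exact: measurable_potX.
have hq : (\int[mu]_y (pot G y `^ (p - 2))%:E <= (1 + A)%:E)%E.
  rewrite EFinD -momentA.
  apply: moment_le1D.
  by apply/andP; split; move: p2; lra.
have h : (\int[mu]_y (7 `^ p * pot G y `^ 2)%:E * \int[mu]_y (pot G y `^ (p - 2))%:E
    <= (7 `^ p * K2 * (1 + A))%:E)%E.
  rewrite EFinM; apply: lee_pmul => //.
  - by apply: integral_ge0 => y _; rewrite lee_fin.
  - by apply: integral_ge0 => y _; rewrite lee_fin.
apply: (@le_trans _ _ ((3 / 8 * A)%:E + (3 / 8 * A)%:E + ((7 `^ p * K2 * (1 + A))%:E + ((22 * cst1 c) `^ p * lam)%:E))%E).
  by rewrite leeD2l // leeD2r.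
by rewrite -!EFinD lee_fin; lra.
Qed.

Definition cst_pow (c K2 p : R) : R :=
  7 `^ p * K2 + (22 * cst1 c) `^ p + (2 * cst2 c) `^ p.

(** One obtains [A <= 3 / 4 * A + C * eta * (1 + A)] with [C = cst_pow c K2 p]; as
    [C * eta <= 1 / 8], an eighth of [A] remains on the left. *)
Lemma moment_le (K2 : R) : (moment 2 <= (K2 * eta)%:E)%E -> 0 <= K2 ->
  cst_pow c K2 p * eta <= 1 / 8 ->
  (moment p <= (8 * cst_pow c K2 p * eta)%:E)%E.
Proof.
move=> HK K20 Keta.
have [l0 l1] := andP l01.
have al0 : 0 <= al := al_ge0.
have eta0 : 0 < eta by rewrite ltr_pwDl.
have [pE [pEE /andP[pE0 pE1] _]] := exists_prob_onE.
have mpair : measurable_fun setT (fun w => avg (N w)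
     (fun i => pair_bound (x i w, x (next (N w) i) w))).
  apply: (@measurable_avg R _ T (fun n i w => pair_bound (x i w, x (next n i) w))) => // n i.
  exact: (measurableT_comp measurable_pair_bound (measurable_xx i (next n i))).
have pair0 w : 0 <= avg (N w) (fun i => pair_bound (x i w, x (next (N w) i) w)).
  by apply: avg_ge0.
have B0 : 0 <= (2 * cst2 c) `^ p by exact: powR_ge0.
have pb := pair_bound_integral HK (mulr_ge0 K20 (ltW eta0)).
have pb0 : (0 <= \int[prob_sqr mu]_a (pair_bound a)%:E)%E.
  by apply: integral_ge0 => a _; rewrite lee_fin.
have pbf : (\int[prob_sqr mu]_a (pair_bound a)%:E)%E \is a fin_num.
  by rewrite ge0_fin_numE // (le_lt_trans pb) // ltry.
move: pb pb0; rewrite -[(\int[prob_sqr mu]_a _)%E]fineK // !lee_fin.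
set F := fine _ => HF F0.
have H1 : (\int[P]_w (onN w * avg (N w) (fun i => pair_bound (x i w, x (next (N w) i) w)))%:E <= (pE * F)%:E)%E.
  rewrite (avg_integral_next (K := onE) (f := pair_bound)) //; last 2 first.
  - exact: measurable_onE.
  - by move=> n u; exact: onE_small.
  by rewrite pEE EFinM fineK.
have H2 : (\int[P]_w ((2 * cst2 c) `^ p * offE (NV w))%:E <= ((2 * cst2 c) `^ p * al + 0)%:E)%E.
  apply: (affine_integral_le measurable_offN) => //.
  - by apply: measurable_funM => //; exact: measurable_offN.
  - by move=> w; exact: offE_ge0.
  - by move=> w; rewrite mulr_ge0 // offE_ge0.
  - by move=> w; rewrite addr0.
  - by rewrite alE.
have HA' : A <= pE * F + (2 * cst2 c) `^ p * al * (1 + A).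
  rewrite -lee_fin -momentA /moment -(res_integral (f := fun y => pot G y `^ p)); last 2 first.
  - exact: measurable_potX.
  - by move=> y; exact: powR_ge0.
  rewrite -[_ * al]addr0.
  apply: (generic_bound (W := fun a => (2 * cst2 c) `^ p * offE a) _ _ _ _ _ _ _ res_pow_le H1 H2 momentA).
  - exact: (measurableT_comp (measurable_potX G p) measurable_res).
  - by apply: measurable_funM => //; exact: measurable_onN.
  - by apply: measurable_funM => //; exact: measurable_offE.
  - by move=> w; exact: powR_ge0.
  - by move=> w; rewrite mulr_ge0.
  - by move=> a; rewrite mulr_ge0 // offE_ge0.
  - by move=> u; rewrite /= offE0 mulr0.
rewrite momentA lee_fin; clear HK H1 H2.
have F1 : pE * F <= F by rewrite ler_piMl.
have e1 : lam <= eta by rewrite lerDl.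
have e2 : al <= eta by rewrite /eta lerDr ltW.
have D0 : 0 <= (22 * cst1 c) `^ p by exact: powR_ge0.
have S0 : 0 <= 7 `^ p * K2 by rewrite mulr_ge0 ?powR_ge0.
have e3 : (22 * cst1 c) `^ p * lam <= (22 * cst1 c) `^ p * eta * (1 + A).
  apply: (@le_trans _ _ ((22 * cst1 c) `^ p * eta)); first by rewrite ler_wpM2l.
  by rewrite ler_peMr ?lerDl // mulr_ge0 // ltW.
have e4 : (2 * cst2 c) `^ p * al * (1 + A) <= (2 * cst2 c) `^ p * eta * (1 + A).
  by rewrite ler_wpM2r ?addr_ge0 // ler_wpM2l.
have e5 : A <= 3 / 4 * A + cst_pow c K2 p * eta * (1 + A).
  rewrite /cst_pow; move: HF e3 e4.
  by move: (7 `^ p) ((22 * cst1 c) `^ p) ((2 * cst2 c) `^ p) HA' => s t u HA' HF e3 e4; lra.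
have e6 : cst_pow c K2 p * eta * A <= 1 / 8 * A by rewrite ler_wpM2r.
by move: e5 e6; move: (cst_pow c K2 p) => C e5 e6; lra.
Qed.

End moment_bound.

(** * One step at the root *)

Section star.
Variables ds be A : R.
Hypothesis ds0 : 0 < ds.
Hypothesis momentA : moment p = A%:E.

Local Notation rho := (ds / dd).

Definition offF (a : nat * R[i]) : R :=
  \1_(~` setF rho ds lam) a * weight p ds (a.1, a.2 / rho%:C).

Hypothesis beE : (\int[P]_w (offF (NV w))%:E = be%:E)%E.

Let rho0 : 0 < rho. Proof. exact: divr_gt0. Qed.

Local Notation Gs := (- (z + rho%:C * G)^-1).

Lemma measurable_offF : measurable_fun setT offF.
Proof.
apply: measurable_funM.
  by apply: measurable_indic; apply: measurableC; exact: measurable_setF.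
have m : measurable_fun setT (fun a : nat * R[i] => (a.1, a.2 / rho%:C)).
  apply: measurable_fun_pair; first exact: measurable_fst.
  apply: measurable_complexM; first exact: measurable_snd.
  exact: measurable_cst.
exact: (measurableT_comp (measurable_weight p ds) m).
Qed.

Lemma offF_ge0 a : 0 <= offF a. Proof. by rewrite mulr_ge0 // weight_ge0. Qed.

(* Almost surely 1, but 0 at [N = 0], as [avg_integral1] requires. *)
Let has_child (a : nat * R[i]) : R := (0 < a.1)%N%:R.

Let Im_zG : 0 < Im (z + rho%:C * G).
Proof. by rewrite ImD ImCM addr_gt0 // mulr_gt0. Qed.

Let Gs0 : 0 < Im Gs. Proof. exact: Im_opp_inv_gt0. Qed.

(** No moment has to be absorbed here, since that of [g] is already known, so plain convexity and
    the lossy constants [2 ^ p] are affordable. *)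
Let star_le w : generic_set w ->
  pot Gs (res w) `^ p <=
  2 `^ p * 2 `^ p * (has_child (NV w) * avg_pot p w)
    + 2 `^ p * (cst1 c * lam)
  + (2 * cst2 c) `^ p * offF (NV w) * (1 + avg_pot p w).
Proof.
rewrite -[2 `^ p * 2 `^ p * _]mulrA -mulrDr.
move=> Gw; have [Nw vw xw] := Gw.
have h0 := Im_center_gt0 Gw.
have [l0 l1] := andP l01.
have rs0 := Im_res_gt0 Gw.
rewrite (potE Gs0 rs0).
have H := hyp_res_le rho0 Gw.
have rE : ratio w / rho = (N w)%:R / ds.
  rewrite /ratio; move: (lt0r_neq0 dd0) (lt0r_neq0 ds0) => h1 h2; field.
  by rewrite h1 h2.
rewrite {}rE in H; set r := _ / ds in H.
have r0 : 0 < r by rewrite divr_gt0 // ltr0n.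
set u := (rho^-1)%:C * v w in H.
have u0 : 0 <= Im u by rewrite ImCM mulr_ge0 // invr_ge0 ltW.
have uE : v w / rho%:C = u by rewrite /u mulrC fmorphV.
have nu : normc u = normc (v w) / rho by rewrite normcZ ?invr_ge0 ?(ltW rho0) // mulrC.
have w0 : 0 < Im (r%:C * center w + u) by rewrite ImD ImCM ltr_wpDr // mulr_gt0.
have S0 := avg_pot_ge0 p w.
have hS := pot_centerX_le p1 Gw.
apply: (le_trans (powR_le p0 (hyp_ge0 rs0 Gs0) H)).
have -> : has_child (NV w) = 1 by rewrite /has_child /= Nw.
rewrite mul1r.
have k1 := cst1_gt0 c0.
have cl0 : 0 <= cst1 c * lam := mulr_ge0 (ltW k1) (ltW l0).
have t2 : 0 <= 2 `^ p :> R by exact: powR_ge0.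
rewrite /offF indicE in_setC; case: (boolP (_ \in _)) => /=.
  rewrite inE => -[/= vl rl].
  rewrite mul0r mulr0 mul0r addr0.
  have ul : normc u < lam by rewrite nu.
  have H2 := hyp_step_on c0 cG G1 l01 rl ul u0 h0.
  apply: (le_trans (powR_le p0 (hyp_ge0 w0 G0) H2)).
  have X0 := hyp_ge0 h0 G0.
  rewrite (potE G0 h0) in hS.
  have a0 : 0 <= (1 + cst1 c * lam) * hyp (center w) G by rewrite mulr_ge0 ?addr_ge0.
  apply: (le_trans (powRD_le p0 a0 cl0)).
  rewrite ler_wpM2l //; apply: lerD.
    have s2 : (0 : R) <= 2 by [].
    apply: (@le_trans _ _ ((2 * hyp (center w) G) `^ p)).
      by apply: powR_le => //; rewrite ler_wpM2r //; move: cl; lra.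
    by rewrite (powRM _ s2 X0) ler_wpM2l.
  apply: ge1r_powR; last by move: p1; lra.
  by rewrite mulr_gt0 //=; move: cl; lra.
move=> _; rewrite mul1r; apply: (@le_trans _ _ ((2 * cst2 c) `^ p *
  weight p ds (N w, v w / rho%:C) * (1 + avg_pot p w))); last first.
  by rewrite lerDr mulr_ge0 // addr_ge0 // mulr_ge0.
by rewrite -uE in u0 *; apply: hyp_off_le => //; rewrite p1 lexx.
Qed.

Let A_ge0 : 0 <= A. Proof. by rewrite -lee_fin -momentA moment_ge0. Qed.

Definition cst_star (c p : R) : R := 2 `^ p * (2 `^ p) + 2 `^ p * cst1 c + (2 * cst2 c) `^ p.

Lemma star_moment_le :
  (\int[P]_w (pot Gs (res w) `^ p)%:E <=
    (cst_star c p * (A + lam + be * (1 + A)))%:E)%E.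
Proof.
have [l0 l1] := andP l01.
have k1 := cst1_gt0 c0.
have cl0 : 0 <= cst1 c * lam := mulr_ge0 (ltW k1) (ltW l0).
have t2 : 0 <= 2 `^ p :> R by exact: powR_ge0.
have ms : measurable_fun setT has_child.
  exact: (measurable_nat_comp (fun n => (0 < n)%N%:R)).
have msN : measurable_fun setT (fun w => has_child (NV w)) := measurableT_comp ms measurable_NV.
have mf : measurable_fun setT (fun w => offF (NV w)) := measurableT_comp measurable_offF measurable_NV.
have mav := measurable_avg_potX p.
have S0 := avg_pot_ge0 p.
have s0 a : 0 <= has_child a by [].
have B0 : 0 <= (2 * cst2 c) `^ p by exact: powR_ge0.
have be0 : 0 <= be.
  by rewrite -lee_fin -beE; apply: integral_ge0 => w _; rewrite lee_fin offF_ge0.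
have h0 : (\int[P]_w (has_child (NV w) * avg_pot p w)%:E <= A%:E)%E.
  rewrite (avg_integral1 (K := has_child) (f := fun y => pot G y `^ p)) //; last 3 first.
  - exact: measurable_potX.
  - by move=> y; exact: powR_ge0.
  - by rewrite -/(moment p) momentA.
  rewrite -/(moment p) momentA -[leRHS]mul1e lee_wpmul2r ?lee_fin //.
  rewrite -(integral_cst_prob P 1); apply: ge0_le_integral => //.
  - by move=> w _; rewrite lee_fin.
  - exact/measurable_EFinP.
  - by move=> w _; rewrite lee_fin /has_child; case: (0 < _)%N.
have h1 : (\int[P]_w (2 `^ p * 2 `^ p * (has_child (NV w) * avg_pot p w)
     + 2 `^ p * (cst1 c * lam))%:E <= (2 `^ p * 2 `^ p * A + 2 `^ p * (cst1 c * lam))%:E)%E.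
  apply: (affine_integral_le _ _ _ _ _ _ _ h0) => //; rewrite ?(mulr_ge0 t2) //.
  - exact: measurable_funM.
  - by apply: measurable_funD => //; apply: measurable_funM => //; exact: measurable_funM.
  - by move=> w; rewrite mulr_ge0.
  - by move=> w; apply: addr_ge0; last exact: mulr_ge0; apply: mulr_ge0; exact: mulr_ge0.
have h2 : (\int[P]_w ((2 * cst2 c) `^ p * offF (NV w))%:E <= ((2 * cst2 c) `^ p * be + 0)%:E)%E.
  apply: (affine_integral_le mf) => //.
  - exact: measurable_funM.
  - by move=> w; exact: offF_ge0.
  - by move=> w; rewrite mulr_ge0 // offF_ge0.
  - by move=> w; rewrite addr0.
  - by rewrite beE.
apply: (le_trans (generic_bound (W := fun a => (2 * cst2 c) `^ p * offF a) _ _ _ _ _ _ _ star_le h1 h2 momentA)).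
- apply: (measurableT_comp (measurable_powR p)).
  by apply: measurable_pot_comp; exact: measurable_res.
- by apply: measurable_funD => //; apply: measurable_funM => //; exact: measurable_funM.
- by apply: measurable_funM => //; exact: measurable_offF.
- by move=> w; exact: powR_ge0.
- by move=> w; apply: addr_ge0; last exact: mulr_ge0; apply: mulr_ge0; exact: mulr_ge0.
- by move=> a; rewrite mulr_ge0 // offF_ge0.
- by move=> u; rewrite /offF /= weight0 ?mulr0 //; move: p1; lra.
rewrite lee_fin addr0 /cst_star.
have D0 := mulr_ge0 t2 (ltW k1); have E0 := mulr_ge0 t2 t2.
have F1 : 0 <= be * (1 + A) by rewrite mulr_ge0 // addr_ge0.
have D1 := mulr_ge0 D0 A_ge0; have E1 := mulr_ge0 E0 (ltW l0); have B1 := mulr_ge0 B0 A_ge0.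
have B2 := mulr_ge0 B0 (ltW l0).
have D2 := mulr_ge0 D0 F1; have E2 := mulr_ge0 E0 F1.
by move: D1 E1 B1 B2 D2 E2; move: (2 `^ p) (cst1 c) ((2 * cst2 c) `^ p) => s t u D1 E1 B1 B2 D2 E2; lra.
Qed.

End star.

End recursion.

Section errors.
Context {R : realType} {d : measure_display} {T : measurableType d}.
Variables (P : probability T R) (N : {mfun T >-> nat}) (v : {mfun T >-> R[i]}).
Implicit Types p dd ds lam : R.

Lemma alphaE p dd lam :
  alpha P N v p dd lam = (\int[P]_w (offE dd lam p (NV N v w))%:E)%E.
Proof.
rewrite /alpha unlock; apply: eq_integral => w _; congr (_%:E).
by rewrite /offE /weight mulrA !indicE !in_setC.
Qed.

Lemma betaE p dd ds lam :
  beta P N v p (ds / dd) ds lam = (\int[P]_w (offF dd lam p ds (NV N v w))%:E)%E.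
Proof.
rewrite /beta unlock; apply: eq_integral => w _; congr (_%:E).
by rewrite /offF /weight mulrA !indicE !in_setC.
Qed.

Lemma expectation_ge1 ds : P [set w | (1 <= N w)%N] = 1%E ->
  ('E_P[fun w => (N w)%:R%R] = ds%:E)%E -> 1 <= ds.
Proof.
move=> N1; rewrite unlock -lee_fin => <-; rewrite -(integral_cst_prob P 1).
have mN : measurable [set w | (1 <= N w)%N].
  by apply: (measurable_funPTI N (Y := [set n | (1 <= n)%N])).
apply: (ae_le_integral mN N1).
- exact: measurable_cst.
- apply/measurable_EFinP.
  apply: (measurableT_comp _ (@measurable_funPT _ _ _ _ N)).
  by move=> _ B _.
- by move=> w.
- by move=> w; rewrite lee_fin.
- by move=> w /= Nw; rewrite lee_fin ler1n.
Qed.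

End errors.

(** * The constants depending on [E] and [p] *)

Definition cst_im {R : realType} (E : R) : R := (1 - E / 2) / 12.

Definition cst_tree {R : realType} (E p : R) : R :=
  8 * cst_pow (cst_im E) (cst_moment (cst_im E) (1 - E / 2)) p.

(** The inverse of a sum of nonnegative terms: below it, [eta] times each single term is at most 1,
    which gives the five smallness conditions at once. *)
Definition threshold {R : realType} (E p : R) : R :=
  (2 + 20 * cst1 (cst_im E) + 2 * cst3 (cst_im E) / cst_kap (1 - E / 2)
   + 36 / cst_lam (cst_im E) (1 - E / 2) + cst_tree E p)^-1.

Section thresholds.
Context {R : realType} (E p : R).
Hypotheses (E0 : 0 < E) (E2 : E < 2).

Lemma cst_im_gt0 : 0 < cst_im E.
Proof. by rewrite /cst_im; move: E2; lra. Qed.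

Let c0 := cst_im_gt0.
Let c'0 : 0 < 1 - E / 2 <= 1. Proof. by move: E0 E2; lra. Qed.

Lemma cst_kap_gt0 : 0 < cst_kap (1 - E / 2).
Proof. by have /andP[h _] := cst_gap_bounds c'0; rewrite divr_gt0. Qed.

Lemma cst_moment_ge0 : 0 <= cst_moment (cst_im E) (1 - E / 2).
Proof.
apply: addr_ge0; apply: divr_ge0 => //.
- by rewrite mulr_ge0 // ltW // cst3_gt0.
- exact: ltW cst_kap_gt0.
- exact: ltW (cst_lam_gt0 c0 c'0).
Qed.

Lemma cst_tree_ge0 : 0 <= cst_tree E p.
Proof.
apply: mulr_ge0 => //; rewrite /cst_pow !addr_ge0 ?powR_ge0 //.
by rewrite mulr_ge0 ?powR_ge0 // cst_moment_ge0.
Qed.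

Lemma threshold_gt0_le (eta : R) : 0 < threshold E p /\
  (0 <= eta -> eta <= threshold E p ->
  [/\ eta <= 1 / 2, cst1 (cst_im E) * eta <= 1 / 20,
    2 * cst3 (cst_im E) * eta <= cst_kap (1 - E / 2),
    36 * eta <= cst_lam (cst_im E) (1 - E / 2) & cst_tree E p * eta <= 1]).
Proof.
have k1 := ltW (cst1_gt0 c0); have k3 := cst3_gt0 c0.
have kk := cst_kap_gt0; have kl := cst_lam_gt0 c0 c'0; have kt := cst_tree_ge0.
have q3 : 0 <= 2 * cst3 (cst_im E) / cst_kap (1 - E / 2).
  by apply: divr_ge0; [exact: mulr_ge0 _ (ltW k3)|exact: ltW].
have ql : 0 <= 36 / cst_lam (cst_im E) (1 - E / 2) by rewrite divr_ge0 // ltW.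
rewrite /threshold; set S := (X in X^-1).
have S0 : 0 < S.
  by rewrite /S; move: k1 q3 ql kt; move: (cst1 _) (_ / cst_kap _) (36 / _) (cst_tree _ _) => s t u w; lra.
split; first by rewrite invr_gt0.
move=> e0; rewrite -(ler_pM2r S0) mulVf ?gt_eqF // => H.
have [h1 h2 h3 h4 h5] : [/\ 2 * eta <= 1, 20 * cst1 (cst_im E) * eta <= 1,
   2 * cst3 (cst_im E) / cst_kap (1 - E / 2) * eta <= 1,
   36 / cst_lam (cst_im E) (1 - E / 2) * eta <= 1 & cst_tree E p * eta <= 1].
  have a1 := mulr_ge0 k1 e0; have a2 := mulr_ge0 q3 e0.
  have a3 := mulr_ge0 ql e0; have a4 := mulr_ge0 kt e0.
  move: H a1 a2 a3 a4; rewrite /S; move: (cst1 _) (_ / cst_kap _) (36 / _) (cst_tree _ _) => s t u w H a1 a2 a3 a4.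
  by split; lra.
split=> //.
- by lra.
- by move: h2; move: (cst1 _) => s; lra.
- by move: h3; rewrite -(ler_pM2r kk) mul1r; congr (_ <= _); field; exact: lt0r_neq0.
- by move: h4; rewrite -(ler_pM2r kl) mul1r; congr (_ <= _); field; exact: lt0r_neq0.
Qed.

End thresholds.

(** * The equations in law *)

Section copies.
Context {R : realType} {d d' : measure_display}
  {T : measurableType d} {T' : measurableType d'}.
Variables (P : probability T R) (P' : probability T' R).
Variables (N : {mfun T >-> nat}) (v : {mfun T >-> R[i]}).
Variables (N' : {mfun T' >-> nat}) (v' : {mfun T' >-> R[i]}).
Hypothesis H : eq_law P (NV N v) P' (NV N' v').

Lemma eq_law_NV_N1 : P' [set w | (1 <= N' w)%N] = 1%E -> P [set w | (1 <= N w)%N] = 1%E.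
Proof.
move=> <-; apply: (H (A := [set a | (1 <= a.1)%N])).
by rewrite -[X in measurable X]setTI; exact: (@measurable_fst _ _ nat R[i] measurableT [set n | (1 <= n)%N]).
Qed.

Lemma eq_law_NV_Im : (forall w, 0 <= Im (v' w)) -> P [set w | 0 <= Im (v w)] = 1%E.
Proof.
move=> v0; apply: (eq_law_setT (A := [set a | 0 <= Im a.2]) H) => //.
by rewrite -[X in measurable X]setTI;
  apply: (@measurable_snd _ _ nat R[i] measurableT [set y | 0 <= Im y]); exact: measurable_closed_upper.
Qed.

End copies.

Section tree.
Context {R : realType} (E p : R).
Hypotheses (E0 : 0 < E) (E2 : E < 2) (p2 : 2 <= p).
Context {d2 d4 : measure_display} {T2 : measurableType d2} {T4 : measurableType d4}.
Variables (P2 : probability T2 R) (P4 : probability T4 R).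
Variables (N : {mfun T2 >-> nat}) (v : {mfun T2 >-> R[i]}) (g : {mfun T4 >-> R[i]}).

Let mu : probability R[i] R := distribution P4 g.

Lemma distribution_upper : (forall w, upper_half_plane (g w)) ->
  mu [set y | 0 < Im y] = 1%E.
Proof.
move=> g0; rewrite -(@probability_setT _ _ R P4) /mu /distribution /=; congr (P4 _).
by apply/seteqP; split=> // w _; exact: g0.
Qed.

(** Transfers the estimates to the auxiliary space of [recursion_law]: [alpha] depends only on the
    joint law of [N] and [v]. The position of [Gamma z] enters through the lower bound [cst_im E] on
    its imaginary part and [c' = 1 - E / 2]. *)
Lemma tree_moment_le (dd lam : R) (z : R[i]) : 0 < dd -> 0 < lam ->
  (forall w, 0 <= Im (v w)) -> P2 [set w | (1 <= N w)%N] = 1%E ->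
  (lam%:E + alpha P2 N v p dd lam <= (threshold E p)%:E)%E ->
  half_strip E z -> (forall w, upper_half_plane (g w)) ->
  recursion_law z dd P2 N v P4 g P4 g ->
  exists al : R, [/\ alpha P2 N v p dd lam = al%:E, 0 <= al,
    lam + al <= threshold E p &
    (moment mu (Gamma z) p <= (cst_tree E p * (lam + al))%:E)%E].
Proof.
move=> dd0 l0 v0 N1 Hd zE g0 [d [T [P [N' [v' [x [Hlaw Hx Hind Hres]]]]]]].
have al0 : (0 <= alpha P2 N v p dd lam)%E.
  by rewrite alphaE; apply: integral_ge0 => w _; rewrite lee_fin offE_ge0.
have [al alE] : exists al, alpha P2 N v p dd lam = al%:E.
  exists (fine (alpha P2 N v p dd lam)); rewrite fineK // ge0_fin_numE //.
  apply: (@le_lt_trans _ _ (threshold E p)%:E); last exact: ltry.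
  by apply: le_trans Hd; rewrite -[leLHS]add0e leeD2r // lee_fin ltW.
exists al; rewrite alE in Hd al0 *; rewrite lee_fin in al0.
rewrite -EFinD lee_fin in Hd; split=> //.
have eta0 : 0 <= lam + al by rewrite addr_ge0 // ltW.
have [_ /(_ eta0 Hd) [e1 e2 e3 e4 e5]] := threshold_gt0_le p E0 E2 (lam + al).
have c0 := cst_im_gt0 E2.
have c'0 : 0 < 1 - E / 2 <= 1 by move: E0 E2; lra.
have zH : 0 < Im z by case: zE.
have [G0 GE] := Gamma_fixed_point zH.
have G1 := ltW (Gamma_normsq_lt1 zH).
have [cG ReG] := Gamma_bounds E0 E2 zE.
have ReG' : `|Re (Gamma z)| <= (1 - (1 - E / 2)) * normc (Gamma z).
  by have -> : 1 - (1 - E / 2) = E / 2 by ring.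
have l01 : 0 < lam <= 1 / 2 by rewrite l0 /=; lra.
have cl : cst1 (cst_im E) * lam <= 1 / 20.
  apply: le_trans e2; rewrite ler_wpM2l ?lerDl //; exact: ltW (cst1_gt0 c0).
have law_x i A : measurable A -> P (x i @^-1` A) = mu A by exact: Hx.
have law_res A : measurable A -> P (res N' v' x z dd @^-1` A) = mu A.
  by move=> mA; rewrite -(Hres A mA).
have N1' := eq_law_NV_N1 Hlaw N1.
have v0' := eq_law_NV_Im Hlaw v0.
have mu0 := distribution_upper g0.
have alE' : (\int[P]_w (offE dd lam p (NV N' v' w))%:E = al%:E)%E.
  rewrite -alE alphaE.
  apply: (@eq_law_integral _ _ _ _ _ _ _ P _ P2 _ (fun a => (offE dd lam p a)%:E)) => //.
  - exact: measurable_NV.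
  - exact: measurable_NV.
  - by apply/measurable_EFinP; exact: measurable_offE.
  - by move=> a; rewrite lee_fin offE_ge0.
have M2 := second_moment_le law_x Hind N1' v0' mu0 zH dd0 c0 cG G1 GE c'0 ReG' l01 p2 law_res alE' e1 e3 e4.
have h := moment_le law_x Hind N1' v0' mu0 zH dd0 c0 cG G1 GE l01 p2 cl law_res alE' M2 (cst_moment_ge0 E0 E2).
apply: h; move: e5; rewrite /cst_tree.
by move: (cst_pow _ _ _) => s; lra.
Qed.

End tree.

(** For [s = z + rho%:C * Gamma z] one has [Im s >= rho * cst_im E] and
    [normsq s <= 10 + 10 * rho ^+ 2]; the inverse imaginary part of [Gamma_star] is
    [normsq s / Im s]. *)
Lemma Gamma_star_bounds {R : realType} (E rho : R) (z : R[i]) :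
  0 < E -> E < 2 -> 0 < rho -> half_strip E z ->
  [/\ 0 < Im (Gamma_star rho z), Im (Gamma_star rho z) <= (rho * cst_im E)^-1 &
    (Im (Gamma_star rho z))^-1 <= 10 / cst_im E * (rho + rho^-1)].
Proof.
move=> E0 E2 rho0 zE; have [/= z0 [/andP[z1 z2] z3]] := zE.
rewrite /upper_half_plane /= in z0.
have [G0 GE] := Gamma_fixed_point z0.
have G1 := Gamma_normsq_lt1 z0.
have [cG _] := Gamma_bounds E0 E2 zE; rewrite -/(cst_im E) in cG.
have c0 := cst_im_gt0 E2.
have rc0 : 0 < rho * cst_im E by exact: mulr_gt0.
have sI : rho * cst_im E <= Im (z + rho%:C * Gamma z).
  by rewrite ImD ImCM; apply: ler_wpDl; [exact: ltW|rewrite ler_pM2l].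
have s0 := lt_le_trans rc0 sI.
rewrite /Gamma_star; split; first exact: Im_opp_inv_gt0.
  by apply: (le_trans (Im_opp_inv_le s0)); rewrite lef_pV2.
have nz : normsq z <= 5 by rewrite /normsq; nra.
have ns : normsq (z + rho%:C * Gamma z) <= 10 + 10 * rho ^+ 2.
  have rr : 0 <= rho ^+ 2 by exact: sqr_ge0.
  apply: (@le_trans _ _ (2 * normsq z + 2 * normsq (rho%:C * Gamma z))); first exact: normsqD2.
  rewrite normsqZ.
  have : rho ^+ 2 * normsq (Gamma z) <= rho ^+ 2 * 1 by rewrite ler_wpM2l // ltW.
  by move: nz rr; lra.
rewrite Im_opp_inv invf_div ler_pdivrMr //.
apply: (le_trans ns).
have -> : 10 + 10 * rho ^+ 2 = 10 / cst_im E * (rho + rho^-1) * (rho * cst_im E).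
  by field; rewrite !lt0r_neq0.
have k0 : 0 <= 10 / cst_im E * (rho + rho^-1).
  apply: mulr_ge0; first exact: divr_ge0 _ (ltW c0).
  by apply: addr_ge0; rewrite ?invr_ge0; exact: ltW.
by rewrite ler_wpM2l.
Qed.

Section star_moment.
Context {R : realType} (E p : R).
Hypotheses (E0 : 0 < E) (E2 : E < 2) (p2 : 2 <= p).
Context {d1 d3 d4 : measure_display} {T1 : measurableType d1}
  {T3 : measurableType d3} {T4 : measurableType d4}.
Variables (P1 : probability T1 R) (P3 : probability T3 R) (P4 : probability T4 R).
Variables (N : {mfun T1 >-> nat}) (v : {mfun T1 >-> R[i]}).
Variables (go : {mfun T3 >-> R[i]}) (g : {mfun T4 >-> R[i]}).

Lemma recursion_star_moment_le (dd ds lam be A : R) (z : R[i]) :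
  0 < dd -> 0 < ds -> 0 < lam <= 1 / 2 -> cst1 (cst_im E) * lam <= 1 / 20 ->
  (forall w, 0 <= Im (v w)) -> P1 [set w | (1 <= N w)%N] = 1%E ->
  beta P1 N v p (ds / dd) ds lam = be%:E ->
  half_strip E z -> (forall w, upper_half_plane (g w)) ->
  moment (distribution P4 g) (Gamma z) p = A%:E ->
  recursion_law z dd P1 N v P4 g P3 go ->
  (\int[P3]_w (pot (Gamma_star (ds / dd) z) (go w) `^ p)%:E <=
    (cst_star (cst_im E) p * (A + lam + be * (1 + A)))%:E)%E.
Proof.
move=> dd0 ds0 l01 cl v0 N1 beE zE g0 AE [d [T [P [N' [v' [x [Hlaw Hx Hind Hres]]]]]]].
have zH : 0 < Im z by case: zE.
have c0 := cst_im_gt0 E2.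
have G1 := ltW (Gamma_normsq_lt1 zH).
have [cG _] := Gamma_bounds E0 E2 zE.
have law_x i B : measurable B -> P (x i @^-1` B) = distribution P4 g B by exact: Hx.
have N1' := eq_law_NV_N1 Hlaw N1.
have v0' := eq_law_NV_Im Hlaw v0.
have mu0 := distribution_upper P4 g0.
have beE' : (\int[P]_w (offF dd lam p ds (NV N' v' w))%:E = be%:E)%E.
  rewrite -beE betaE.
  apply: (@eq_law_integral _ _ _ _ _ _ _ P _ P1 _ (fun a => (offF dd lam p ds a)%:E)) => //.
  - exact: measurable_NV.
  - exact: measurable_NV.
  - by apply/measurable_EFinP; exact: measurable_offF.
  - by move=> a; rewrite lee_fin offF_ge0.
have := star_moment_le law_x Hind N1' v0' mu0 zH dd0 c0 cG G1 l01 p2 cl ds0 AE beE'.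
rewrite (@eq_law_integral _ _ _ _ _ _ _ P3 go P (res N' v' x z dd)
  (fun y => (pot (Gamma_star (ds / dd) z) y `^ p)%:E)) //.
- exact: measurable_res.
- by apply/measurable_EFinP; exact: measurable_potX.
- by move=> y; rewrite lee_fin powR_ge0.
Qed.

End star_moment.

Section final_bounds.
Context {R : realType} {d : measure_display} {T : measurableType d}.
Variables (P : probability T R) (go : {mfun T >-> R[i]}) (s : R[i]) (p c : R).
Hypotheses (go0 : forall w, upper_half_plane (go w)) (s0 : 0 < Im s).
Hypotheses (p2 : 2 <= p) (c0 : 0 < c).

Let mgo : measurable_fun setT (fun w => pot s (go w) `^ p).
Proof. exact: (measurableT_comp (measurable_potX s p) (@measurable_funPT _ _ _ _ go)). Qed.

Lemma distance_moment_le (B r : R) : 0 < r -> Im s <= c^-1 ->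
  (\int[P]_w (pot s (go w) `^ p)%:E <= B%:E)%E ->
  ('E_P[fun w => (normc (go w - s) `^ p)%R] <=
    (2 `^ p * (c^-1) `^ p * (B + r^-1 * B + r))%:E)%E.
Proof.
move=> r0 sc HB; rewrite unlock.
have k0 : 0 <= 2 `^ p * (c^-1) `^ p :> R by rewrite mulr_ge0 ?powR_ge0.
have ri : 0 < r^-1 by rewrite invr_gt0.
have -> : 2 `^ p * (c^-1) `^ p * (B + r^-1 * B + r) =
  2 `^ p * (c^-1) `^ p * (1 + r^-1) * B + 2 `^ p * (c^-1) `^ p * r by ring.
apply: (affine_integral_le mgo) => //.
- apply: (measurableT_comp (measurable_powR p)).
  apply: measurable_normc; apply: measurable_complexD; first exact: measurable_funPT.
  exact: measurable_cst.
- by move=> w; exact: powR_ge0.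
- by move=> w; exact: powR_ge0.
- by rewrite mulr_ge0 // addr_ge0 // ltW.
- by rewrite mulr_ge0 // ltW.
- move=> w; rewrite (potE s0 (go0 w)).
  apply: (le_trans (distance_pow_le p2 c0 r0 (go0 w) s0 sc)).
  by rewrite le_eqVlt; apply/orP; left; apply/eqP; ring.
Qed.

Lemma inv_Im_moment_le (B M : R) : (Im s)^-1 <= M ->
  (\int[P]_w (pot s (go w) `^ p)%:E <= B%:E)%E ->
  ('E_P[fun w => (complex.Im (go w) `^ (- p))%R] <=
    (2 `^ p * M `^ p * (B + 2 `^ p))%:E)%E.
Proof.
move=> sM HB; rewrite unlock.
have k0 : 0 <= 2 `^ p * M `^ p :> R by rewrite mulr_ge0 ?powR_ge0.
rewrite mulrDr; apply: (affine_integral_le mgo) => //.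
- apply: (measurableT_comp (measurable_powR (- p))).
  by apply: measurable_Im_comp; exact: measurable_funPT.
- by move=> w; exact: powR_ge0.
- by move=> w; exact: powR_ge0.
- by rewrite mulr_ge0 // powR_ge0.
- move=> w; rewrite (potE s0 (go0 w)) -mulrDr.
  apply: inv_Im_pow_le => //; first by move: p2; lra.
  exact: go0.
Qed.

End final_bounds.

Lemma eps_EFin {R : realType} (lam al be : R) :
  eps lam al%:E be%:E = ((1 + lam + al) * (1 + lam + be) - 1)%:E.
Proof. by rewrite /eps EFinB EFinM !EFinD. Qed.

Lemma cst_star_ge0 {R : realType} (c p : R) : 0 < c -> 0 <= cst_star c p.
Proof.
move=> c0; rewrite /cst_star !addr_ge0 ?powR_ge0 // mulr_ge0 ?powR_ge0 //.
exact: ltW (cst1_gt0 c0).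
Qed.

Definition cst_distance {R : realType} (E p : R) : R :=
  2 `^ p * (cst_im E)^-1 `^ p * (2 * (cst_star (cst_im E) p * (cst_tree E p + 2)) + 1).

Definition cst_inv_Im {R : realType} (E p : R) : R :=
  2 `^ p * (10 / cst_im E) `^ p * (2 * cst_star (cst_im E) p + 2 `^ p).

(** The parameter of [distance_moment_le] is taken to be [Num.sqrt e]: with [B = O(e)], both
    [B / Num.sqrt e] and the parameter itself are [O(Num.sqrt e)]. *)
Lemma distance_constant_le {R : realType} (E p rho e B : R) :
  0 < E -> E < 2 -> 0 < rho -> 0 < e ->
  B <= cst_star (cst_im E) p * (cst_tree E p + 2) * e ->
  2 `^ p * ((rho * cst_im E)^-1) `^ p * (B + (Num.sqrt e)^-1 * B + Num.sqrt e) <=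
  cst_distance E p * rho `^ (- p) * Num.max e (Num.sqrt e).
Proof.
move=> E0 E2 rho0 e0 HB.
have c0 := cst_im_gt0 E2; have ci0 : 0 <= (cst_im E)^-1 by rewrite invr_ge0 ltW.
have ri0 : 0 <= rho^-1 by rewrite invr_ge0 ltW.
have r0 : 0 < Num.sqrt e by rewrite sqrtr_gt0.
rewrite invfM powRM // -powR_inv1 ?(ltW rho0) // -powRrM mulN1r.
rewrite /cst_distance.
have K0 : 0 <= cst_star (cst_im E) p * (cst_tree E p + 2).
  by rewrite mulr_ge0 ?cst_star_ge0 // addr_ge0 // cst_tree_ge0.
move: K0 HB; move: (cst_star _ _ * _) => K K0 HB.
have -> : 2 `^ p * (cst_im E)^-1 `^ p * (2 * K + 1) * rho `^ (- p) * Num.max e (Num.sqrt e)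
  = 2 `^ p * (rho `^ (- p) * (cst_im E)^-1 `^ p) * ((2 * K + 1) * Num.max e (Num.sqrt e)) by ring.
rewrite ler_wpM2l ?mulr_ge0 ?powR_ge0 //.
have eE : e = Num.sqrt e * Num.sqrt e by rewrite -expr2 sqr_sqrtr // ltW.
have HB' : (Num.sqrt e)^-1 * B <= K * Num.sqrt e.
  rewrite mulrC ler_pdivrMr //; apply: (le_trans HB).
  by rewrite -mulrA -eE.
have m1 : e <= Num.max e (Num.sqrt e) by rewrite le_max lexx.
have m2 : Num.sqrt e <= Num.max e (Num.sqrt e) by rewrite le_max lexx orbT.
have := ler_wpM2l K0 m1; have := ler_wpM2l K0 m2.
by move: HB HB' m2; clear; lra.
Qed.

Lemma inv_Im_constant_le {R : realType} (E p rho be B : R) :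
  0 < E -> E < 2 -> 1 <= p -> 0 < rho -> 0 <= be ->
  B <= 2 * cst_star (cst_im E) p * (1 + be) ->
  2 `^ p * (10 / cst_im E * (rho + rho^-1)) `^ p * (B + 2 `^ p) <=
  cst_inv_Im E p * (1 + be) `^ p * (rho + rho^-1) `^ p.
Proof.
move=> E0 E2 p1 rho0 be0 HB.
have c0 := cst_im_gt0 E2.
have k0 : 0 <= 10 / cst_im E by exact: divr_ge0 _ (ltW c0).
have rr : 0 <= rho + rho^-1 by apply: addr_ge0; rewrite ?invr_ge0; exact: ltW.
rewrite (powRM _ k0 rr) /cst_inv_Im.
have S0 := cst_star_ge0 p c0; move: S0 HB; move: (cst_star _ _) => S S0 HB.
have -> : 2 `^ p * (10 / cst_im E) `^ p * (2 * S + 2 `^ p) * (1 + be) `^ p * (rho + rho^-1) `^ p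
  = 2 `^ p * ((10 / cst_im E) `^ p * (rho + rho^-1) `^ p) * ((2 * S + 2 `^ p) * (1 + be) `^ p) by ring.
rewrite ler_wpM2l ?mulr_ge0 ?powR_ge0 //.
have b1 : 1 + be <= (1 + be) `^ p.
  have h : 1 <= 1 + be by rewrite lerDl.
  by have := @ler_powR R (1 + be) h 1 p p1; rewrite powRr1 // (le_trans _ h).
have b2 : 1 <= (1 + be) `^ p by apply: le_trans b1; rewrite lerDl.
have t2 : 0 <= 2 `^ p :> R by exact: powR_ge0.
have h1 := ler_wpM2l S0 b1; have h2 := ler_wpM2l t2 b2.
by move: HB h1 h2; clear; lra.
Qed.

Theorem corollary5 (R : realType) (E p : R) (hE0 : 0 < E) (hE2 : E < 2)
    (hp : 2 <= p) :
  exists delta Cstar : R,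
    0 < delta /\ 0 < Cstar /\
    forall (d1 d2 : measure_display)
      (T1 : measurableType d1) (P1 : probability T1 R)
      (T2 : measurableType d2) (P2 : probability T2 R)
      (Nstar : {RV P1 >-> nat}) (vstar : {RV P1 >-> R[i]})
      (N : {RV P2 >-> nat}) (v : {RV P2 >-> R[i]})
      (dstar d : R),
    (forall w, 0 <= complex.Im (vstar w)) ->
    (forall w, 0 <= complex.Im (v w)) ->
    ('E_P1[fun w => (Nstar w)%:R%R] = dstar%:E)%E ->
    ('E_P2[fun w => (N w)%:R%R] = d%:E)%E ->
    P1 [set w | (1 <= Nstar w)%N] = 1%E ->
    P2 [set w | (1 <= N w)%N] = 1%E ->
    ((\forall w \ae P2, complex.Im (v w) = 0) \/
     ('E_P2[fun w => ((N w)%:R `^ (2 * p))%R] < +oo)%E) ->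
    let rho := dstar / d in
    forall lambda : R, 0 < lambda < 1 ->
    let a := alpha P2 N v p d lambda in
    let b := beta P1 Nstar vstar p rho dstar lambda in
    let e := eps lambda a b in
    (lambda%:E + a <= delta%:E)%E ->
    forall z : R[i], half_strip E z ->
    forall (d3 d4 : measure_display)
      (T3 : measurableType d3) (P3 : probability T3 R)
      (T4 : measurableType d4) (P4 : probability T4 R)
      (go : {RV P3 >-> R[i]}) (g : {RV P4 >-> R[i]}),
    (forall w, upper_half_plane (go w)) ->
    (forall w, upper_half_plane (g w)) ->
    recursion_law z d P1 Nstar vstar P4 g P3 go ->
    recursion_law z d P2 N v P4 g P4 g ->
    ('E_P3[fun w => (normc (go w - Gamma_star rho z) `^ p)%R]
       <= (Cstar * rho `^ (- p))%:E * maxe e (sqrte e))%E /\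
    ('E_P3[fun w => (complex.Im (go w) `^ (- p))%R]
       <= Cstar%:E * poweR (1 + b) p * ((rho + rho^-1) `^ p)%:E)%E.
Proof.
have c0 := cst_im_gt0 hE2.
have S0 := cst_star_ge0 p c0.
have t0 := cst_tree_ge0 p hE0 hE2.
have D10 : 0 <= cst_distance E p.
  by rewrite /cst_distance mulr_ge0 ?mulr_ge0 ?powR_ge0 // addr_ge0 // !mulr_ge0 // addr_ge0.
have D20 : 0 <= cst_inv_Im E p.
  by rewrite /cst_inv_Im mulr_ge0 ?mulr_ge0 ?powR_ge0 // addr_ge0 ?powR_ge0 // mulr_ge0.
have p1 : 1 <= p by move: hp; lra.
have [thr0 _] := threshold_gt0_le p hE0 hE2 0.
exists (threshold E p), (cst_distance E p + cst_inv_Im E p + 1); split=> //.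
set Cs := (_ + _ + 1).
have Cs1 : cst_distance E p <= Cs by rewrite /Cs -addrA lerDl addr_ge0.
have Cs2 : cst_inv_Im E p <= Cs by rewrite /Cs addrAC addrC lerDl addr_ge0.
have Cs0 : 0 < Cs by rewrite /Cs ltr_wpDl // addr_ge0.
split=> //; clearbody Cs.
move=> d1 d2 T1 P1 T2 P2 Nstar vstar N v dstar d vs0 v0 HNs HN Ns1 N1 _ rho lam /andP[l0 l1] a b e Hd z zE.
move=> d3 d4 T3 P3 T4 P4 go g go0 g0 Rgo Rg.
have dd0 : 0 < d by apply: lt_le_trans (expectation_ge1 N1 HN).
have ds0 : 0 < dstar by apply: lt_le_trans (expectation_ge1 Ns1 HNs).
have rho0 : 0 < rho by exact: divr_gt0.
have [al [aE al0 Heta Hm]] := tree_moment_le hE0 hE2 hp dd0 l0 v0 N1 Hd zE g0 Rg.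
rewrite -/a in aE.
have eta0 : 0 < lam + al by rewrite ltr_pwDl.
have [_ /(_ (ltW eta0) Heta) [e1 e2 _ _ e5]] := threshold_gt0_le p hE0 hE2 (lam + al).
have l12 : 0 < lam <= 1 / 2 by rewrite l0 /=; move: e1 al0; lra.
have cl : cst1 (cst_im E) * lam <= 1 / 20.
  by apply: le_trans e2; rewrite ler_wpM2l ?lerDl //; exact: ltW (cst1_gt0 c0).
have b0 : (0 <= b)%E.
  by rewrite /b /rho betaE; apply: integral_ge0 => w _; rewrite lee_fin offF_ge0.
have rp : 0 < (rho + rho^-1) `^ p by rewrite powR_gt0 // addr_gt0 // invr_gt0.
have rn : 0 < rho `^ (- p) by rewrite powR_gt0.
(* An infinite [beta] makes both right-hand sides infinite, as the factors multiplying it are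
   positive. *)
have [bE|bfin] := eqVneq b +oo%E.
  have -> : e = +oo%E.
    rewrite /e bE /eps aE addey // -!EFinD gt0_muley // lte_fin.
    by move: l0 al0; lra.
  rewrite bE addey // poweRyr; last by rewrite lt0r_neq0 //; move: p1; lra.
  have -> : maxe +oo%E (sqrte +oo%E) = +oo%E :> \bar R by apply/max_idPl; rewrite leey.
  split; first by rewrite gt0_muley ?lte_fin ?mulr_gt0 // leey.
  by rewrite gt0_muley ?lte_fin // gt0_mulye ?lte_fin // leey.
have [be bE] : exists be, b = be%:E.
  by exists (fine b); rewrite fineK // ge0_fin_numE // ltey.
have be0 : 0 <= be by rewrite -lee_fin -bE.
pose A := fine (moment (distribution P4 g) (Gamma z) p).
have AE : moment (distribution P4 g) (Gamma z) p = A%:E.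
  by rewrite fineK // ge0_fin_numE ?moment_ge0 // (le_lt_trans Hm) // ltry.
have A0 : 0 <= A by rewrite -lee_fin -AE moment_ge0.
rewrite AE lee_fin in Hm.
have A1 : A <= 1 by exact: le_trans e5.
have HS := recursion_star_moment_le hE0 hE2 hp dd0 ds0 l12 cl vs0 Ns1 bE zE g0 AE Rgo.
rewrite -/rho in HS.
have [s0 sI sV] := Gamma_star_bounds hE0 hE2 rho0 zE.
have beA : be * (1 + A) <= be * 2 by rewrite ler_wpM2l //; move: A1; lra.
split.
- pose er := (1 + lam + al) * (1 + lam + be) - 1.
  have erE : e = er%:E by rewrite /e bE aE eps_EFin.
  have er_ge : lam + al + be <= er.
    have := mulr_ge0 (ltW eta0) (addr_ge0 (ltW l0) be0).
    by rewrite /er; move: l0; clear; lra.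
  have er0 : 0 < er by apply: lt_le_trans er_ge; rewrite ltr_wpDr.
  (* [A] is at most [cst_tree E p * (lam + al)] and also at most 1, so [be * (1 + A) <= 2 * be];
     expanding the product shows that [er] dominates [lam + al + be]. *)
  have HB : cst_star (cst_im E) p * (A + lam + be * (1 + A)) <=
      cst_star (cst_im E) p * (cst_tree E p + 2) * er.
    rewrite -mulrA ler_wpM2l //.
    have h1 := ler_wpM2l t0 er_ge; have h2 := mulr_ge0 t0 be0.
    by move: Hm beA er_ge l0 al0 be0 h1 h2; clear; lra.
  have HS' := distance_moment_le go0 s0 hp (mulr_gt0 rho0 c0) (r := Num.sqrt er) _ sI HS.
  rewrite erE /sqrte -EFin_max -EFinM.
  apply: (le_trans (HS' _)); first by rewrite sqrtr_gt0.
  rewrite lee_fin; apply: (le_trans (distance_constant_le hE0 hE2 rho0 er0 HB)).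
  rewrite -[leLHS]mulrA -[leRHS]mulrA ler_wpM2r // mulr_ge0 ?(ltW rn) //.
  by rewrite le_max (ltW er0).
(* Here only boundedness matters: [A <= 1] and [lam < 1] give
   [A + lam + be * (1 + A) <= 2 * (1 + be)]. *)
- have HB : cst_star (cst_im E) p * (A + lam + be * (1 + A)) <=
      2 * cst_star (cst_im E) p * (1 + be).
    rewrite [2 * _]mulrC -mulrA ler_wpM2l //.
    by move: A1 beA l1; clear; lra.
  rewrite bE -EFinD poweR_EFin -!EFinM.
  apply: (le_trans (inv_Im_moment_le go0 s0 hp sV HS)).
  rewrite lee_fin; apply: (le_trans (inv_Im_constant_le hE0 hE2 p1 rho0 be0 HB)).
  by rewrite -[leLHS]mulrA -[leRHS]mulrA ler_wpM2r // mulr_ge0 ?powR_ge0 // ltW.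
Qed.
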